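(* Let $(n_k)_{k\in\mathbb N}$ be a lacunary sequence of positive integers, i.e. $\liminf_{k\to\infty} n_{k+1}/n_k \ge q$ for some $q>1$. Let $(c_{k,N})_{k\le N,\,N\in\mathbb N}$ be a triangular array of non-negative reals with $$\sup_{N\in\mathbb N}\sup_{k\le N} c_{k,N}\le 1,\qquad h(N):=\sum_{k\le N}c_{k,N}^2\longrightarrow\infty\quad (N\to\infty).$$ Let $f\in\mathbb L_2(\mathbb T)$ be real-valued with $\int_{\mathbb T} f(x)\,\mathrm dx=0$ and $\int_{\mathbb T} f^2(x)\,\mathrm dx\in(0,\infty)$, with Fourier series $f(x)=\sum_{j=1}^\infty\left[a_j\cos(2\pi jx)+b_j\sin(2\pi jx)\right]$, and suppose there are constants $M>0$ and $\rho>\tfrac12$ such that $|a_j|+|b_j|\le M j^{-\rho}$ for all $j\in\mathbb N$. Assume that for every fixed $D\in\mathbb N$, $$L^*(N,D):=L(N,D)+\sum_{\substack{1\le k,\ell\le N\\ k\ne\ell}}\ \sum_{1\le j,j'\le D}c_{k,N}c_{\ell,N}\,\mathbf 1_{[jn_k-j'n_\ell=0]}=o(h(N))\quad (N\to\infty),$$ where $$L(N,D):=\sup_{c>0}\ \sum_{k,\ell\le N}\ \sum_{1\le j,j'\le D} c_{k,N}c_{\ell,N}\,\mathbf 1_{[jn_k-j'n_\ell=c]}.$$ Then $$\frac{\sum_{k\le N}c_{k,N}f(n_kx)}{\|f\|_2\sqrt{h(N)}}\ \stackrel{w}{\longrightarrow}\ \mathcal N(0,1)\qquad (N\to\infty)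.$$
   Context: $\mathbb T=\mathbb R/\mathbb Z$ carries its Borel $\sigma$-algebra and normalized Haar (Lebesgue) measure, regarded as a probability space; functions of $x\in\mathbb T$ are random variables on it. $\|g\|_2=(\int_{\mathbb T}g(x)^2\,\mathrm dx)^{1/2}$. $\stackrel{w}{\longrightarrow}$ denotes convergence in distribution, and $\mathcal N(0,1)$ is the standard normal law. $\mathbf 1_{[P]}$ is $1$ if $P$ holds and $0$ otherwise. *)

(* Defs.v *)
From HB Require Import structures.
From mathcomp Require Import all_boot all_order all_algebra.
From mathcomp Require Import all_classical all_reals all_analysis.

Set Implicit Arguments.
Unset Strict Implicit.
Unset Printing Implicit Defensive.

Import Order.TTheory GRing.Theory Num.Theory.
Import numFieldNormedType.Exports.

Local Open Scope classical_set_scope.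
Local Open Scope ring_scope.

(* A function on the circle R/Z is represented by a 1-periodic Borel function
   on the line, and normalized Haar measure by the uniform probability on
   [0, 1]: integrals of 1-periodic functions over R/Z are integrals against
   [circle R].  Every class in L2 of the circle has such a representative. *)
Definition circle (R : realType) : probability (measurableTypeR R) R :=
  @uniform_prob R 0 1 ltr01.

Definition L2norm (R : realType) (f : R -> R) : R :=
  fine ('N[circle R]_2%:E [EFin \o f]).

Definition fourier_cos (R : realType) (f : R -> R) (j : nat) : R :=
  2 * \int[circle R]_x (f x * cos (2 * pi * j%:R * x)).

Definition fourier_sin (R : realType) (f : R -> R) (j : nat) : R :=
  2 * \int[circle R]_x (f x * sin (2 * pi * j%:R * x)).

(* Sequences are indexed by the positive integers: the value [n 0] is junk, and
   does not influence the lower limit.  The lower limit is taken in the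
   extended reals, since the ratios may be unbounded. *)
Definition lacunary (R : realType) (n : nat -> nat) : Prop :=
  exists2 q : R, 1 < q &
    (q%:E <= limn_einf (fun k => ((n k.+1)%:R / (n k)%:R)%:E))%E.

(* The entry c_{k,N} of a triangular array is [c k N], for 1 <= k <= N; other
   values are junk. *)
Definition array_sup (R : realType) (c : nat -> nat -> R) : \bar R :=
  ereal_sup (range (fun N : nat =>
    ereal_sup [set (c k N)%:E | k in [set k : nat | (1 <= k <= N)%N]])).

Definition sum_sqr (R : realType) (c : nat -> nat -> R) (N : nat) : R :=
  \sum_(1 <= k < N.+1) c k N ^+ 2.

(* The summands with k = l are included. *)
Definition dioph_sum (R : realType) (n : nat -> nat) (c : nat -> nat -> R)
    (N D : nat) (v : R) : R :=
  \sum_(1 <= k < N.+1) \sum_(1 <= l < N.+1)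
    \sum_(1 <= j < D.+1) \sum_(1 <= j' < D.+1)
      c k N * c l N * ((j * n k)%N%:R - (j' * n l)%N%:R == v)%:R.

Definition dioph_sum0 (R : realType) (n : nat -> nat) (c : nat -> nat -> R)
    (N D : nat) : R :=
  \sum_(1 <= k < N.+1) \sum_(1 <= l < N.+1 | k != l)
    \sum_(1 <= j < D.+1) \sum_(1 <= j' < D.+1)
      c k N * c l N * ((j * n k)%N%:R - (j' * n l)%N%:R == 0 :> R)%:R.

(* [dioph_sum n c N D v] vanishes unless v is an integer, so that letting v range
   over the positive reals or the positive integers gives the same supremum.
   The set under [sup] is nonempty and bounded, so [sup] is a genuine
   supremum. *)
Definition Lsup (R : realType) (n : nat -> nat) (c : nat -> nat -> R)
    (N D : nat) : R :=
  sup [set dioph_sum n c N D v | v in [set v : R | 0 < v]].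

Definition Lstar (R : realType) (n : nat -> nat) (c : nat -> nat -> R)
    (N D : nat) : R :=
  Lsup n c N D + dioph_sum0 n c N D.

Definition cvg_in_distribution (R : realType) (d : measure_display)
    (T : measurableType d) (P : probability T R) (X : nat -> T -> R)
    (mu : probability (measurableTypeR R) R) : Prop :=
  (forall N, measurable_fun [set: T] (X N)) /\
  forall g : R -> R, continuous g -> bounded_fun g ->
    \int[P]_w g (X N w) @[N --> \oo] --> \int[mu]_y g y.

(* Main.v *)
Require Import Defs.
From HB Require Import structures.
From mathcomp Require Import all_boot all_order all_algebra.
From mathcomp Require Import all_classical all_reals all_analysis.
From mathcomp Require Import measurable_realfun.
From mathcomp Require Import zify ring lra.

Set Implicit Arguments.
Unset Strict Implicit.
Unset Printing Implicit Defensive.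

Import Order.TTheory GRing.Theory Num.Theory.
Import numFieldNormedType.Exports.

Local Open Scope classical_set_scope.
Local Open Scope ring_scope.

(** Why the theorem holds. Write E for the mean over the circle, h for
    [sum_sqr c N] and X for the normalized sum.

    Characteristic functions. By [weak_cvg_of_char] it is enough that the
    normalized sums have bounded second moments and that E cos (t X + th)
    tends to cos th exp (- t^2 / 2) for all real t and th. Letting the phase
    th vary replaces the complex characteristic function.

    Truncation. Let p be the Fourier partial sum of f of order D. If j n_k =
    j' n_l with k < l, and n grows by the factor q from k on, then j is at
    least q^(l-k) j', so the decay of the coefficients makes the correlation
    of the k-th and l-th terms of the sum of the c_k (f - p)(n_k x) decay
    geometrically in l - k. Schur's test bounds the squared L2 norm of this
    sum by h times a multiple of the tail of sum j^(- 2 rho) beyond D, which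
    is small because rho > 1/2 ([lacunary_L2], [tail_L2]). So f may be
    replaced by p.

    Blocks. Cut the indices into blocks of bounded length separated by gaps of
    r consecutive indices, and choose the position of the cuts so that the
    gaps carry a proportion at most 1/s of h ([gap_choice]). If r is large in
    terms of D, lacunarity makes every frequency of a block larger than the
    sum of all frequencies of the earlier blocks. Hence, if Y_i are the block
    sums, the Riesz product of the 1 + i tau Y_i has mean exactly 1
    ([riesz_mean]).

    Central limit theorem. Since exp (i y) = (1 + i y) exp (- y^2 / 2) up to
    O(|y|^3), the exponential of i tau times the sum of the Y_i is close to
    the Riesz product times exp (- tau^2 V / 2), where V is the sum of the
    Y_i^2. The Riesz product is bounded, because its modulus is at most exp
    (tau^2 V / 2) with tau^2 = O(1 / h) and V = O(h), and V concentrates: the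
    product formulas write its fluctuation as a sum of waves, the L2 norm of
    which is controlled by the number of coincidences between their
    frequencies. For the frequencies j n_k - j' n_l these are counted by
    [Lstar], which is o(h); frequencies j n_k + j' n_l can only coincide
    inside one block. This is [square_sum_variance] and [block_char].
    Replacing V by its mean and integrating the Riesz product leaves cos th
    exp (- t^2 / 2).

    For a fixed N all errors are collected in [char_bound]; [char_cvg] chooses
    D, then s, then r, and lets N tend to infinity. *)

(** * Bernstein polynomials *)

Section Bernstein.
Variable R : realType.
Implicit Types (x c e : R) (h g : nat -> R).

(** The Bernstein operator: the mean of [h] at the number of successes in [m]
    independent trials of success probability [x].  Conditioning on one trial
    avoids binomial coefficients, and shows at once that [bern m h] maps an
    algebra of functions to itself. *)
Fixpoint bern (m : nat) (h : nat -> R) (x : R) : R :=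
  if m is m'.+1 then x * bern m' (fun k => h k.+1) x + (1 - x) * bern m' h x
  else h 0%N.

Lemma bern_le m h g x : 0 <= x <= 1 -> (forall k, h k <= g k) ->
  bern m h x <= bern m g x.
Proof.
move=> /andP[x0 x1]; elim: m h g => [|m IH] h g hg /=; first exact: hg.
by apply: lerD; apply: ler_wpM2l; rewrite ?subr_ge0//; apply: IH => k.
Qed.

Lemma bernD m h g x : bern m (fun k => h k + g k) x = bern m h x + bern m g x.
Proof. by elim: m h g => [|m IH] h g //=; rewrite !IH; ring. Qed.

Lemma bernZ m h c x : bern m (fun k => c * h k) x = c * bern m h x.
Proof. by elim: m h => [|m IH] h //=; rewrite !IH; ring. Qed.

Lemma bern_cst m c x : bern m (fun=> c) x = c.
Proof. by elim: m => [|m IH] //=; rewrite !IH; ring. Qed.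

(** The variance of the binomial law. *)
Lemma bern_sqr m c x :
  bern m (fun k => (k%:R - c) ^+ 2) x = m%:R * x * (1 - x) + (m%:R * x - c) ^+ 2.
Proof.
elim: m c => [|m IH] c /=; first by ring.
under [X in bern m X x](_ : _ = fun k => (k%:R - (c - 1)) ^+ 2).
  by apply/funext => k; rewrite -natr1; ring.
by rewrite !IH -natr1; ring.
Qed.

(** Uniform continuity in the form that Chebyshev's inequality calls for: away
    from the diagonal the quadratic term dominates the oscillation of [G]. *)
Lemma continuous_quad_modulus (G : R -> R) e : continuous G -> 0 < e ->
  exists2 C, 0 <= C & forall x y, 0 <= x <= 1 -> 0 <= y <= 1 ->
    `|G x - G y| <= e + C * (x - y) ^+ 2.
Proof.
move=> cG e0.
have tri (a b c r d : R) : `|a - b| < r / 2 -> d < r / 2 -> `|b - c| < d ->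
    `|a - c| < r.
  by have := ler_normD (a - b) (b - c); rewrite addrA subrK; lra.
have halfr (r : R) : 0 < r -> r / 2 < r by lra.
have cpt : compact `[(0:R), 1] by exact: segment_compact.
have [B B0 HB] : exists2 B, 0 <= B & forall x, 0 <= x <= 1 -> `|G x| <= B.
  have : compact (G @` `[0, 1]).
    by apply: continuous_compact => //; exact: continuous_subspaceT.
  move=> /compact_bounded[M [_ HM]]; exists (`|M| + 1).
    by rewrite addr_ge0.
  move=> x x01; apply: HM.
    by rewrite (le_lt_trans (ler_norm M))// ltrDl.
  by exists x => //=; rewrite in_itv.
have [d d0 Hd] : exists2 d, 0 < d & forall x y, 0 <= x <= 1 ->
    `|x - y| < d -> `|G x - G y| <= e.
  have /compact_near_coveringP cov := cpt.
  have H : \forall d \near 0^'+, forall x, `[0, 1]%classic x ->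
      forall y, `|x - y| < d -> `|G x - G y| <= e.
    apply: (cov _ 0^'+ (fun d x => forall y, `|x - y| < d -> `|G x - G y| <= e)).
    move=> x _.
    have e20 : 0 < e / 2 by rewrite divr_gt0.
    have /cvgrPdist_lt/(_ _ e20) := cG x.
    move=> /nbhs_ballP[r /= r0 Hr].
    have r20 : 0 < r / 2 by rewrite divr_gt0.
    near=> z d => y xyd.
    have zx : `|x - z| < r / 2.
      by near: z; apply: (@cvgr_dist_lt _ _ _ _ _ id x) => //; exact: cvg_id.
    have dr : d < r / 2 by near: d; exact: nbhs_right_lt.
    have Hz : `|G x - G z| < e / 2.
      by apply: Hr; exact: (lt_trans zx (halfr _ r0)).
    have Hy : `|G x - G y| < e / 2.
      by apply: Hr; exact: (tri x z y r d).
    rewrite (_ : G z - G y = (G x - G y) - (G x - G z)); last by ring.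
    by rewrite (le_trans (ler_normB _ _))//; lra.
  have H2 := nbhs_right_gt (0:R).
  near (0:R)^'+ => d; exists d.
    by near: d; exact: H2.
  move=> x y x01.
  have Hx : forall x : R, `[0, 1]%classic x ->
      forall y : R, `|x - y| < d -> `|G x - G y| <= e by near: d.
  by apply: Hx; rewrite /= in_itv.
exists (2 * B / d ^+ 2); first by rewrite !mulr_ge0// invr_ge0 sqr_ge0.
move=> x y x01 y01; have [xy|xy] := ltP `|x - y| d.
  rewrite (le_trans (Hd _ _ x01 xy))// lerDl mulr_ge0// ?sqr_ge0//.
  by rewrite !mulr_ge0// invr_ge0 sqr_ge0.
apply: (@le_trans _ _ (2 * B)).
  rewrite (le_trans (ler_normB _ _))//.
  by have := HB _ x01; have := HB _ y01; lra.
have : d ^+ 2 <= (x - y) ^+ 2.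
  by rewrite -(real_normK (num_real (x - y))) ler_pXn2r// nnegrE ltW.
move=> dxy; apply: (@le_trans _ _ (2 * B / d ^+ 2 * d ^+ 2)).
  by rewrite divfK// expf_neq0// gt_eqF.
rewrite (@le_trans _ _ (2 * B / d ^+ 2 * (x - y) ^+ 2))//.
  by rewrite ler_wpM2l// !mulr_ge0// invr_ge0 sqr_ge0.
by rewrite lerDr ltW.
Unshelve. all: by end_near. Qed.

(** The quadratic modulus reduces the error to the variance
    [x * (1 - x) / m] of the empirical mean. *)
Lemma bern_cvg (G : R -> R) e : continuous G -> 0 < e ->
  exists m, forall x, 0 <= x <= 1 ->
    `|bern m (fun k => G (k%:R / m%:R)) x - G x| <= e.
Proof.
move=> cG e0.
have e20 : 0 < e / 2 by rewrite divr_gt0.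
have [C C0 HC] := continuous_quad_modulus cG e20.
pose m := (Num.truncn (2 * C / e)).+1; exists m => x x01.
have m0 : 0 < m%:R :> R by rewrite ltr0n.
have HCm : C / m%:R <= e / 2.
  rewrite ler_pdivrMr//.
  have : 2 * C / e < m%:R by exact: truncnS_gt.
  by rewrite ltr_pdivrMr//; nra.
have quad : bern m (fun k => e / 2 + C * (k%:R / m%:R - x) ^+ 2) x <= e.
  rewrite bernD bern_cst bernZ.
  under [X in bern m X x](_ : _ = fun k => m%:R ^- 2 * (k%:R - m%:R * x) ^+ 2).
    apply/funext => k; rewrite -exprVn -exprMn; congr (_ ^+ 2).
    by rewrite mulrBr mulrA mulVf ?gt_eqF// mul1r mulrC.
  rewrite bernZ bern_sqr subrr expr0n /= addr0.
  have -> : C * (m%:R ^- 2 * (m%:R * x * (1 - x))) = C / m%:R * (x * (1 - x)).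
    by field; rewrite gt_eqF.
  case/andP: x01 => x0 x1.
  have : x * (1 - x) <= 1 by nra.
  have : 0 <= x * (1 - x) by nra.
  have : 0 <= C / m%:R by rewrite divr_ge0// ltW.
  nra.
have dom k : `|G (k%:R / m%:R) - G x| <= e / 2 + C * (k%:R / m%:R - x) ^+ 2 \/ (m < k)%N.
  have [km|km] := leqP k m; [left|by right].
  apply: HC => //; rewrite divr_ge0 ?ler0n//= ler_pdivrMr// mul1r ler_nat//.
(* Only the values at k <= m enter, so G may be replaced by G x beyond, where
   k / m leaves the unit interval. *)
have ext h g : (forall k, (k <= m)%N -> h k = g k) -> bern m h x = bern m g x.
  elim: m h g {m0 HCm quad dom} => [|m' IH] h g hg /=; first exact: hg.
  congr (_ * _ + _ * _); apply: IH => k km; apply: hg => //.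
  exact: leqW.
pose q k := if (k <= m)%N then G (k%:R / m%:R) else G x.
rewrite (ext _ q); last by move=> k km; rewrite /q km.
have Hq k : `|q k - G x| <= e / 2 + C * (k%:R / m%:R - x) ^+ 2.
  rewrite /q; case: leqP => km.
    by case: (dom k) => //; rewrite ltnNge km.
  have := sqr_ge0 (k%:R / m%:R - x); rewrite subrr normr0.
  by move=> k0; have := mulr_ge0 C0 k0; lra.
have H1 : bern m q x <= G x + e.
  rewrite -[X in X + _](bern_cst m (G x) x).
  apply: le_trans (lerD (lexx _) quad); rewrite -bernD.
  by apply: (@bern_le m _ _ x x01) => i; have := Hq i; rewrite ler_norml => /andP[]; lra.
have H2 : G x <= bern m q x + e.
  rewrite -[X in X <= _](bern_cst m (G x) x).
  apply: le_trans (lerD (lexx _) quad); rewrite -bernD.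
  by apply: (@bern_le m _ _ x x01) => i; have := Hq i; rewrite ler_norml => /andP[]; lra.
by rewrite ler_norml; apply/andP; split; lra.
Qed.
End Bernstein.

(** * Trigonometric sums *)

Section Trig.
Variable R : realType.
Implicit Types (u v : R -> R) (S : set R).

(** Real trigonometric sums with frequencies in [S].  With a free phase [th],
    cosines also span the sines, and no complex exponential is needed. *)
Inductive trig (S : set R) : (R -> R) -> Prop :=
| trig0 : trig S (fun=> 0)
| trig_cos w th : S w -> trig S (fun x => cos (w * x + th))
| trig_lin a u v : trig S u -> trig S v -> trig S (fun x => a * u x + v x).

Lemma eq_trig S u v : u =1 v -> trig S u -> trig S v.
Proof. by move=> /funext->. Qed.

Lemma trigD S u v : trig S u -> trig S v -> trig S (fun x => u x + v x).
Proof. by move=> hu hv; apply: eq_trig (trig_lin 1 hu hv) => x; rewrite mul1r. Qed.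

Lemma trigZ S a u : trig S u -> trig S (fun x => a * u x).
Proof. by move=> hu; apply: eq_trig (trig_lin a hu (trig0 S)) => x; rewrite addr0. Qed.

Lemma trigB S u v : trig S u -> trig S v -> trig S (fun x => u x - v x).
Proof. by move=> hu hv; apply: eq_trig (trig_lin (-1) hv hu) => x; ring. Qed.

Lemma trig_sum S (I : Type) (s : seq I) (P : pred I) (F : I -> R -> R) :
  (forall i, P i -> trig S (F i)) -> trig S (fun x => \sum_(i <- s | P i) F i x).
Proof.
move=> hF; elim: s => [|i s IH].
  by apply: eq_trig (trig0 S) => x; rewrite big_nil.
have [Pi|nPi] := boolP (P i).
  by apply: eq_trig (trigD (hF i Pi) IH) => x; rewrite big_cons Pi.
by apply: eq_trig IH => x; rewrite big_cons (negbTE nPi).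
Qed.

Lemma trig_sub S S' u : S `<=` S' -> trig S u -> trig S' u.
Proof.
move=> SS'; elim=> [|w th Sw|a {}u v _ hu _ hv].
- exact: trig0.
- by apply: trig_cos; exact: SS'.
- exact: trig_lin.
Qed.

Lemma trig_sin S w th : S w -> trig S (fun x => sin (w * x + th)).
Proof.
move=> Sw; apply: eq_trig (trig_cos (th - pi / 2) Sw) => x.
by rewrite addrA cosBpihalf.
Qed.

Lemma cosMcos (a b : R) : cos a * cos b = (cos (a + b) + cos (a - b)) / 2.
Proof. by rewrite cosB cosD; field. Qed.

Lemma trigM S1 S2 S u v :
  (forall a b, S1 a -> S2 b -> S (a + b) /\ S (a - b)) ->
  trig S1 u -> trig S2 v -> trig S (fun x => u x * v x).
Proof.
move=> hS; elim=> [|w th Sw|a {}u u' _ hu _ hu'] hv.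
- by apply: eq_trig (trig0 S) => x; rewrite mul0r.
- elim: hv => [|w' th' Sw'|a v1 v2 _ h1 _ h2].
  + by apply: eq_trig (trig0 S) => x; rewrite mulr0.
  + have [S1w S2w] := hS _ _ Sw Sw'.
    have h := trig_lin (2^-1) (trig_cos (th + th') S1w)
                (trigZ (2^-1) (trig_cos (th - th') S2w)).
    apply: eq_trig h => x; rewrite cosMcos.
    rewrite (_ : w * x + th + (w' * x + th') = (w + w') * x + (th + th')); last by ring.
    rewrite (_ : w * x + th - (w' * x + th') = (w - w') * x + (th - th')); last by ring.
    by field.
  + by apply: eq_trig (trig_lin a h1 h2) => x; ring.
- by apply: eq_trig (trig_lin a (hu hv) (hu' hv)) => x; ring.
Qed.

Lemma trig_cst S c : S 0 -> trig S (fun=> c).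
Proof.
move=> S0; apply: eq_trig (trigZ c (trig_cos 0 S0)) => x.
by rewrite mul0r addr0 cos0 mulr1.
Qed.

Lemma trig_continuous S u : trig S u -> continuous u.
Proof.
elim=> [|w th _|a {}u v _ hu _ hv] x.
- exact: cvg_cst.
- apply: continuous_comp; last exact: continuous_cos.
  by apply: cvgD; [apply: cvgM; [exact: cvg_cst|exact: cvg_id]|exact: cvg_cst].
- by apply: cvgD; [apply: cvgM; [exact: cvg_cst|exact: hu]|exact: hv].
Qed.

Lemma trig_measurable S u : trig S u -> measurable_fun setT u.
Proof. by move=> /trig_continuous; exact: continuous_measurable_fun. Qed.

Lemma trig_bounded S u : trig S u -> exists B, forall x, `|u x| <= B.
Proof.
elim=> [|w th _|a {}u v _ [B hB] _ [C hC]].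
- by exists 0 => x; rewrite normr0.
- by exists 1 => x; exact: cos_max.
- exists (`|a| * B + C) => x; rewrite (le_trans (ler_normD _ _))//.
  by rewrite lerD// normrM ler_wpM2l.
Qed.

Lemma trig_bern S u (h : nat -> R) m :
  (forall a b, S a -> S b -> S (a + b) /\ S (a - b)) -> S 0 ->
  trig S u -> trig S (fun x => bern m h (u x)).
Proof.
move=> hS S0 hu; elim: m h => [|m IH] h /=; first exact: trig_cst.
apply: trigD; first exact: (trigM hS hu (IH _)).
exact: (trigM hS (trigB (trig_cst 1 S0) hu) (IH _)).
Qed.

(** Approximate [G] by Bernstein polynomials and use that trigonometric sums
    form an algebra. *)
Lemma trig_comp_approx S u (G : R -> R) e :
  (forall a b, S a -> S b -> S (a + b) /\ S (a - b)) -> S 0 ->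
  trig S u -> (forall x, 0 <= u x <= 1) -> continuous G -> 0 < e ->
  exists2 v, trig S v & forall x, `|v x - G (u x)| <= e.
Proof.
move=> hS S0 hu u01 cG e0; have [m Hm] := bern_cvg cG e0.
exists (fun x => bern m (fun k => G (k%:R / m%:R)) (u x)).
  exact: trig_bern.
by move=> x; exact: Hm.
Qed.

End Trig.

Section TrigApprox.
Variable R : realType.

Definition clamp (a b x : R) := Num.max a (Num.min b x).

Lemma clamp_id a b x : a <= x <= b -> clamp a b x = x.
Proof. by move=> /andP[ax xb]; rewrite /clamp (min_r xb) (max_r ax). Qed.

Lemma clamp_itv a b x : a <= b -> a <= clamp a b x <= b.
Proof.
by move=> ab; rewrite /clamp le_max lexx/= ge_max ab/= ge_min lexx.
Qed.

Lemma clamp_continuous a b : continuous (clamp a b).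
Proof.
move=> x; apply: (@continuous_max R R (fun=> a) (fun x => Num.min b x) x).
  exact: cvg_cst.
apply: (@continuous_min R R (fun=> b) id x); first exact: cvg_cst.
exact: cvg_id.
Qed.

(** On [[-K, K]] the function [g] is a continuous function of
    [sin (x / (2 * K))].  Clamping the sine keeps [asin] inside its domain, and
    makes the approximant bounded on the whole line, which is needed to control
    the mass that a law puts outside the interval. *)
Lemma trig_approx_itv (g : R -> R) (B K e : R) : continuous g -> 0 < K ->
  (forall x, `|g x| <= B) -> 0 < e ->
  exists2 v, trig setT v & (forall x, `|x| <= K -> `|v x - g x| <= e) /\
    (forall x, `|v x| <= B + e).
Proof.
move=> cg K0 gB e0.
pose s : R := sin (2^-1).
have pi2 := @pihalf_ge1 R.
have K'0 : 0 < 2 * K by rewrite mulr_gt0.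
have s0 : 0 < s by apply: sin_gt0_pi; lra.
have s1 : s < 1.
  by rewrite -(@sin_pihalf R) ltr_sin ?in_itv/=; lra.
pose G y := g (2 * K * asin (clamp (- s) s (2 * y - 1))).
have cG : continuous G.
  move=> y; apply: continuous_comp; last exact: cg.
  apply: cvgM; first exact: cvg_cst.
  apply: continuous_cvg.
    apply: continuous_asin.
    have /andP[] := @clamp_itv (- s) s (2 * y - 1) ltac:(lra); lra.
  apply: continuous_cvg; first exact: clamp_continuous.
  by apply: cvgB; [apply: cvgM; [exact: cvg_cst|exact: cvg_id]|exact: cvg_cst].
have hu : trig setT (fun x : R => 2^-1 * sin ((2 * K)^-1 * x + 0) + 2^-1).
  apply: trig_lin; first exact: trig_sin.
  exact: trig_cst.
have u01 (x : R) : 0 <= 2^-1 * sin ((2 * K)^-1 * x + 0) + 2^-1 <= 1.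
  by have := sin_geN1 ((2 * K)^-1 * x + 0); have := sin_le1 ((2 * K)^-1 * x + 0); lra.
have [v hv Hv] := @trig_comp_approx R setT _ G e (fun _ _ _ _ => conj I I) I hu u01 cG e0.
exists v => //; split=> x; last first.
  have := Hv x; have := gB (2 * K * asin (clamp (- s) s (2 * (2^-1 * sin ((2 * K)^-1 * x + 0) + 2^-1) - 1))).
  rewrite -/(G _) => h1 h2; rewrite -(subrK (G (2^-1 * sin ((2 * K)^-1 * x + 0) + 2^-1)) (v x)).
  by rewrite (le_trans (ler_normD _ _))// addrC lerD.
move=> xK; suff <- : G (2^-1 * sin ((2 * K)^-1 * x + 0) + 2^-1) = g x by exact: Hv.
rewrite /G addr0 (_ : 2 * _ - 1 = sin ((2 * K)^-1 * x)); last by field.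
have /andP[x1 x2] : - 2^-1 <= (2 * K)^-1 * x <= 2^-1.
  move: xK; rewrite ler_norml => /andP[a b].
  by rewrite mulrC ler_pdivlMr// ler_pdivrMr// ; apply/andP; split; lra.
have itv (y : R) : - 2^-1 <= y <= 2^-1 -> y \in `[(- (pi / 2)), pi / 2].
  by rewrite in_itv/=; lra.
rewrite clamp_id; last first.
  rewrite -sinN /s !le_eqVlt; apply/andP; split.
    move: x1; rewrite le_eqVlt => /predU1P[<-|x1]; first by rewrite eqxx.
    by rewrite ltr_sin ?x1 ?orbT//; apply: itv; lra.
  move: x2; rewrite le_eqVlt => /predU1P[->|x2]; first by rewrite eqxx.
  by rewrite ltr_sin ?x2 ?orbT//; apply: itv; lra.
rewrite sinK; last by apply: itv; lra.
by rewrite mulrA mulfV ?mul1r// gt_eqF.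
Qed.

End TrigApprox.

(** * Weak convergence from characteristic functions *)

Section Expectation.
Context d (T : measurableType d) (R : realType) (P : probability T R).
Implicit Types (u v : T -> R).

Lemma bounded_integrable u B : measurable_fun setT u ->
  (forall x, `|u x| <= B) -> P.-integrable setT (EFin \o u).
Proof.
move=> mu uB; apply: (@le_integrable _ _ _ P _ measurableT _ (EFin \o cst B)).
- exact/measurable_EFinP.
- by move=> x _ /=; rewrite lee_fin (le_trans (uB x))// ler_norm.
- exact: finite_measure_integrable_cst.
Qed.

Lemma ge0_integrable u (C : R) : measurable_fun setT u -> (forall x, 0 <= u x) ->
  (\int[P]_x (u x)%:E <= C%:E)%E -> P.-integrable setT (EFin \o u).
Proof.
move=> mu u0 uC; apply/integrableP; split; first exact/measurable_EFinP.
under eq_integral => x _ do rewrite /= ger0_norm//.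
by rewrite (le_lt_trans uC)// ltry.
Qed.

Lemma ge0_Rintegral_le u (C : R) : measurable_fun setT u -> (forall x, 0 <= u x) ->
  (\int[P]_x (u x)%:E <= C%:E)%E -> \int[P]_x u x <= C.
Proof.
move=> mu u0 uC; rewrite -[C]/(fine C%:E) fine_le//.
apply: integrable_fin_num => //; exact: (ge0_integrable mu u0 uC).
Qed.

Lemma Rintegral_cst1 (c : R) : \int[P]_x c = c.
Proof.
rewrite (Rintegral_cst P measurableT); have /= -> := @probability_setT _ _ _ P.
by rewrite mulr1.
Qed.

Lemma Rintegral_norm_le u a b (C : R) v : P.-integrable setT (EFin \o u) ->
  0 <= b -> measurable_fun setT v -> (forall x, 0 <= v x) ->
  (\int[P]_x (v x)%:E <= C%:E)%E ->
  (forall x, `|u x| <= a + b * v x) -> `|\int[P]_x u x| <= a + b * C.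
Proof.
move=> iu b0 mv v0 vC H.
have iv := ge0_integrable mv v0 vC.
have ibv : P.-integrable setT (EFin \o (fun x => b * v x)).
  by have := integrableZl measurableT b iv; apply: eq_integrable.
have ic := @finite_measure_integrable_cst _ _ _ P setT a measurableT.
have iabv : P.-integrable setT (EFin \o (fun x => a + b * v x)).
  by have := integrableD measurableT ic ibv; apply: eq_integrable.
apply: (le_trans (le_normr_Rintegral _ iu)) => //.
apply: (@le_trans _ _ (\int[P]_x (a + b * v x))).
  apply: le_Rintegral => //.
  by have := integrable_abse iu; apply: eq_integrable.
rewrite RintegralD// Rintegral_cst1 RintegralZl// lerD2l ler_wpM2l//.
exact: ge0_Rintegral_le.
Qed.

End Expectation.

Section WeakConvergence.
Context d (T : measurableType d) (R : realType) (P : probability T R).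
Variable nu : probability (measurableTypeR R) R.
Variables (X : nat -> T -> R) (C : R).
Hypothesis mX : forall N, measurable_fun setT (X N).
Hypothesis X2 : \forall N \near \oo, (\int[P]_w (X N w ^+ 2)%:E <= C%:E)%E.
Hypothesis nu2 : (\int[nu]_y (y ^+ 2)%:E <= C%:E)%E.
Hypothesis char : forall t th,
  \int[P]_w cos (t * X N w + th) @[N --> \oo] --> \int[nu]_y cos (t * y + th).

Lemma trig_weak_cvg v : trig setT v ->
  \int[P]_w v (X N w) @[N --> \oo] --> \int[nu]_y v y.
Proof.
have int_T u N : trig setT u -> P.-integrable setT (EFin \o (fun w => u (X N w))).
  move=> hu; have [B uB] := trig_bounded hu.
  apply: (@bounded_integrable _ _ _ _ _ B) => //.
  exact: measurableT_comp (trig_measurable hu) (mX N).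
have int_nu u : trig setT u -> nu.-integrable setT (EFin \o u).
  move=> hu; have [B uB] := trig_bounded hu.
  by apply: (@bounded_integrable _ _ _ _ _ B) => //; exact: trig_measurable hu.
elim=> [|w th _|a u u' hu IHu hu' IHu'].
- by rewrite !Rintegral_cst1; exact: cvg_cst.
- exact: char.
- have -> : \int[nu]_y (a * u y + u' y) = a * \int[nu]_y u y + \int[nu]_y u' y.
    have ia := int_nu _ (trigZ a hu); have i1 := int_nu _ hu.
    by rewrite RintegralD ?RintegralZl//; exact: int_nu.
  rewrite (_ : (fun N => \int[P]_w (a * u (X N w) + u' (X N w))) =
      fun N => a * \int[P]_w u (X N w) + \int[P]_w u' (X N w)).
    by apply: cvgD => //; apply: cvgM => //; exact: cvg_cst.
  apply/funext => N.
  have ia := int_T _ N (trigZ a hu); have i1 := int_T _ N hu.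
  by rewrite RintegralD ?RintegralZl//; exact: int_T.
Qed.

(** By Chebyshev's inequality the laws are tight, so a bounded continuous
    function may be replaced by a trigonometric sum that is close to it on a
    large interval and bounded everywhere. *)
Lemma weak_cvg_of_char : cvg_in_distribution P X nu.
Proof.
split=> // g cg bg.
have [B B0 gB] : exists2 B, 0 < B & forall x, `|g x| <= B.
  have [M [_ HM]] := bg; exists (`|M| + 1); first by rewrite ltr_wpDl.
  by move=> x; apply: HM => //; rewrite (le_lt_trans (ler_norm M))// ltrDl.
have C0 : 0 <= C.
  rewrite -lee_fin (le_trans _ nu2)//; apply: integral_ge0 => y _.
  by rewrite lee_fin sqr_ge0.
apply/cvgrPdist_le => /= e e0.
pose dl := e / 8; have dl0 : 0 < dl by rewrite divr_gt0.
pose A := 2 * B + dl; have A0 : 0 < A by rewrite /A; lra.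
pose K := 1 + A * C / dl.
have K1 : 1 <= K by rewrite lerDl divr_ge0 ?mulr_ge0// ltW.
have K0 : 0 < K by lra.
have [v hv [vK vB]] := trig_approx_itv cg K0 gB dl0.
(* Outside [-K, K], where only bounds on g and v are known, 1 <= x^2 / K^2. *)
have D x : `|g x - v x| <= dl + A / K ^+ 2 * x ^+ 2.
  have K20 : 0 < K ^+ 2 by rewrite exprn_gt0.
  have [xK|xK] := leP `|x| K.
    rewrite distrC (le_trans (vK _ xK))// lerDl mulr_ge0 ?sqr_ge0//.
    by rewrite divr_ge0 ?sqr_ge0// ltW.
  rewrite (le_trans (ler_normB _ _))//.
  have : A <= A / K ^+ 2 * x ^+ 2.
    rewrite mulrAC ler_pdivlMr// ler_wpM2l ?ltW//.
    rewrite -(real_normK (num_real x)) ltrXn2r//.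
    exact: ltW.
  by have := gB x; have := vB x; rewrite /A; lra.
have AC : A / K ^+ 2 * C <= dl.
  rewrite mulrAC ler_pdivrMr ?exprn_gt0//.
  have h : A * C <= dl * K by rewrite /K mulrDr mulr1 mulrC (mulrC dl) divfK ?gt_eqF//; lra.
  have hK : K <= K ^+ 2 by rewrite expr2; nra.
  by rewrite (le_trans h)// ler_wpM2l// ltW.
have b0 : 0 <= A / K ^+ 2 by rewrite divr_ge0 ?sqr_ge0// ltW.
have mg := continuous_measurable_fun cg.
have mv := trig_measurable hv.
have Hnu : `|\int[nu]_y g y - \int[nu]_y v y| <= dl + A / K ^+ 2 * C.
  have ig : nu.-integrable setT (EFin \o g) by apply: (@bounded_integrable _ _ _ nu _ B).
  have iv : nu.-integrable setT (EFin \o v) by apply: (@bounded_integrable _ _ _ nu _ (B + dl)).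
  rewrite -RintegralB//.
  apply: (@Rintegral_norm_le _ _ _ nu _ _ _ _ (fun y => y ^+ 2)) => //.
  - by have := integrableB measurableT ig iv; apply: eq_integrable.
  - by move=> y; exact: sqr_ge0.
have /cvgrPdist_le/(_ _ dl0) Hv := trig_weak_cvg hv.
near=> N.
have HN : `|\int[P]_w g (X N w) - \int[P]_w v (X N w)| <= dl + A / K ^+ 2 * C.
  have ig : P.-integrable setT (EFin \o (fun w => g (X N w))).
    apply: (@bounded_integrable _ _ _ _ _ B) => //.
    exact: measurableT_comp mg (mX N).
  have iv : P.-integrable setT (EFin \o (fun w => v (X N w))).
    apply: (@bounded_integrable _ _ _ _ _ (B + dl)) => //.
    exact: measurableT_comp mv (mX N).
  rewrite -RintegralB//.
  apply: (@Rintegral_norm_le _ _ _ P _ _ _ _ (fun w => X N w ^+ 2)) => //.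
  - by have := integrableB measurableT ig iv; apply: eq_integrable.
  - by apply: measurable_funX; exact: mX.
  - by move=> y; exact: sqr_ge0.
  - by near: N.
have Hm : `|\int[nu]_y v y - \int[P]_w v (X N w)| <= dl by near: N.
move: Hnu HN Hm; rewrite !ler_norml => /andP[? ?] /andP[? ?] /andP[? ?].
have : 8 * dl = e by rewrite /dl; field.
by move=> ?; apply/andP; split; lra.
Unshelve. all: by end_near. Qed.

End WeakConvergence.

(** * The standard Gaussian law *)

Section Gaussian.
Variable R : realType.
Let mu := @lebesgue_measure R.
Let nu : probability (measurableTypeR R) R := normal_prob 0 1.

Definition gdens (y : R) : R := normal_peak 1 * expR (- (y ^+ 2 / 2)).

Lemma gdensE : normal_pdf 0 1 = gdens.
Proof.
apply/funext => y; rewrite normal_pdfE ?oner_neq0// /gdens /normal_fun.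
by rewrite subr0 expr1n mulNr.
Qed.

Lemma gdens_ge0 y : 0 <= gdens y.
Proof. by rewrite mulr_ge0 ?expR_ge0 ?normal_peak_ge0. Qed.

Lemma gdens_continuous : continuous gdens.
Proof. by rewrite -gdensE; apply: continuous_normal_pdf; rewrite oner_neq0. Qed.

Lemma gdens_measurable : measurable_fun setT gdens.
Proof. exact: continuous_measurable_fun gdens_continuous. Qed.

Lemma ge0_integral_normal (f : R -> \bar R) : measurable_fun setT f ->
  (forall y, 0 <= f y)%E ->
  (\int[nu]_y f y = \int[mu]_y (f y * (gdens y)%:E))%E.
Proof.
move=> mf f0.
have dom : nu `<< mu by exact: normal_prob_dominates.
rewrite -(Radon_Nikodym_SigmaFinite.change_of_variables dom f0 measurableT mf).
have ih := Radon_Nikodym_SigmaFinite.f_integrable dom.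
apply: ae_eq_integral => //.
- by apply: emeasurable_funM => //; exact: measurable_int ih.
- by apply: emeasurable_funM => //; apply/measurable_EFinP; exact: gdens_measurable.
- apply: ae_eqe_mul2l => /=.
  apply: integral_ae_eq => //=.
  + by apply/measurable_EFinP; exact: gdens_measurable.
  + move=> E _ mE; rewrite -Radon_Nikodym_SigmaFinite.f_integral//.
    by rewrite -gdensE.
Qed.

Lemma gdens_int1 : (\int[mu]_y (gdens y)%:E = 1)%E.
Proof. by rewrite -gdensE integral_normal_pdf. Qed.

Lemma integrable_gdens : mu.-integrable setT (EFin \o gdens).
Proof. by rewrite -gdensE; exact: integrable_normal_pdf. Qed.

(** Domination by a centred Gaussian density of variance 2. *)
Lemma integrable_gdens_sqr :
  mu.-integrable setT (EFin \o (fun y => (1 + y ^+ 2) * gdens y)).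
Proof.
pose s : R := Num.sqrt 2.
have s0 : s != 0 by rewrite gt_eqF// sqrtr_gt0.
pose c := 4 * normal_peak 1 / normal_peak s.
have ip := @integrable_normal_pdf R 0 s.
have icp : mu.-integrable setT (EFin \o (fun y => c * normal_pdf 0 s y)).
  by have := integrableZl measurableT c ip; apply: eq_integrable.
apply: le_integrable icp => //.
  apply/measurable_EFinP; apply: measurable_funM; last exact: gdens_measurable.
  by apply: measurable_funD => //; exact: measurable_funX.
move=> y _ /=; rewrite lee_fin.
have y20 := sqr_ge0 y.
rewrite !ger0_norm; last 2 first.
- rewrite mulr_ge0 ?normal_pdf_ge0// /c divr_ge0 ?mulr_ge0 ?normal_peak_ge0//.
- by rewrite mulr_ge0 ?gdens_ge0// addr_ge0.
rewrite normal_pdfE// /gdens /normal_fun subr0 sqr_sqrtr//.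
have -> : c * (normal_peak s * expR (- y ^+ 2 / (2 *+ 2))) =
    normal_peak 1 * (4 * expR (- (y ^+ 2 / 4))).
  rewrite /c -(mulr_natr 2) -natrM mulNr; field.
  by rewrite gt_eqF// normal_peak_gt0.
rewrite mulrCA ler_wpM2l ?normal_peak_ge0//.
have -> : - (y ^+ 2 / 2) = - (y ^+ 2 / 4) - (y ^+ 2 / 4) by field.
rewrite expRD mulrA ler_wpM2r ?expR_ge0//.
rewrite expRN ler_pdivrMr ?expR_gt0//.
have := expR_ge1Dx (y ^+ 2 / 4); lra.
Qed.

Lemma gaussian_second_moment :
  exists C : R, (\int[nu]_y (y ^+ 2)%:E <= C%:E)%E.
Proof.
have /integrable_fin_num := integrable_gdens_sqr => /(_ measurableT) h.
exists (fine (\int[mu]_y ((1 + y ^+ 2) * gdens y)%:E)); rewrite fineK//.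
rewrite ge0_integral_normal//; last 2 first.
- by apply/measurable_EFinP; exact: measurable_funX.
- by move=> y; rewrite lee_fin sqr_ge0.
apply: ge0_le_integral => //.
- by move=> y _; rewrite -EFinM lee_fin mulr_ge0 ?sqr_ge0 ?gdens_ge0.
- apply/measurable_EFinP; apply: measurable_funM; last exact: gdens_measurable.
  exact: measurable_funX.
- apply/measurable_EFinP; apply: measurable_funM; last exact: gdens_measurable.
  by apply: measurable_funD => //; exact: measurable_funX.
- by move=> y _; rewrite -EFinM lee_fin ler_wpM2r ?gdens_ge0// lerDr.
Qed.

Lemma integrable_dom (u : R -> R) (c : R) : continuous u ->
  (forall y, `|u y| <= c * (1 + y ^+ 2)) ->
  mu.-integrable setT (EFin \o (fun y => u y * gdens y)).
Proof.
move=> cu uc.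
have ic : mu.-integrable setT (EFin \o (fun y => c * ((1 + y ^+ 2) * gdens y))).
  by have := integrableZl measurableT c integrable_gdens_sqr; apply: eq_integrable.
apply: le_integrable ic => //.
  apply/measurable_EFinP; apply: measurable_funM; last exact: gdens_measurable.
  exact: continuous_measurable_fun.
move=> y _ /=; rewrite lee_fin mulrA (normrM (u y)) (normrM (c * _)) (ger0_norm (gdens_ge0 y)).
by rewrite ler_wpM2r ?gdens_ge0// (le_trans (uc y))// ler_norm.
Qed.

Section phase.
Variable th : R.

Lemma cvg_cos_lin (t : R) : continuous (fun y : R => cos (t * y + th)).
Proof. exact: (trig_continuous (trig_cos (S := setT) _ I)). Qed.

Lemma cvg_sin_lin (t : R) : continuous (fun y : R => sin (t * y + th)).
Proof. exact: (trig_continuous (trig_sin (S := setT) _ I)). Qed.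

Let F t := \int[mu]_y (cos (t * y + th) * gdens y).

Let ider t := fun y : R => (t * cos (t * y + th) - y * sin (t * y + th)).

Let dom1 (y : R) : `|y| <= 1 + y ^+ 2.
Proof.
have := sqr_ge0 (`|y| - 1); rewrite sqrrB1 real_normK ?num_real//.
by have := sqr_ge0 y; lra.
Qed.

Let int_cos t : mu.-integrable setT (EFin \o (fun y => cos (t * y + th) * gdens y)).
Proof.
apply: (@integrable_dom _ 1); first exact: cvg_cos_lin.
move=> y; have := cos_max (t * y + th); have := sqr_ge0 y; lra.
Qed.

Let int_ysin t :
  mu.-integrable setT (EFin \o (fun y => y * sin (t * y + th) * gdens y)).
Proof.
apply: (@integrable_dom _ 1).
  by move=> y; apply: cvgM; [exact: cvg_id|exact: cvg_sin_lin].
move=> y; rewrite normrM mul1r (le_trans _ (dom1 y))// ler_piMr//.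
exact: sin_max.
Qed.

Let is_derive_lin (t y : R) : is_derive y 1 (fun y => t * y + th) t.
Proof.
by apply: is_derive_eq; rewrite /GRing.scale/= ; ring.
Qed.

Let is_derive_gdens (y : R) : is_derive y 1 gdens (- y * gdens y).
Proof.
have h : is_derive y 1 (fun y : R => - (y ^+ 2 / 2)) (- y).
  by apply: is_derive_eq; rewrite /GRing.scale/=; field.
have h2 := @is_derive1_comp _ expR _ y _ _ (is_derive_expR _) h.
rewrite /gdens; apply: is_derive_eq.
by rewrite /GRing.scale/=; ring.
Qed.

Let H t (y : R) := sin (t * y + th) * gdens y.

Let is_derive_H t (y : R) : is_derive y 1 (H t) (ider t y * gdens y).
Proof.
have h2 := @is_derive1_comp _ sin _ y _ _ (is_derive_sin _) (is_derive_lin t y).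
have h3 := is_deriveM h2 (is_derive_gdens y).
apply: (is_derive_eq h3).
have E (s g c a z : R) : s * (- z * g) + g * (c * a) = (a * c - z * s) * g by ring.
exact: E.
Qed.

Let H_le t (y : R) : `|H t y| <= gdens y.
Proof.
rewrite /H normrM (ger0_norm (gdens_ge0 y)) ler_piMl ?gdens_ge0//.
exact: sin_max.
Qed.

Let cvg_gdens (s : R) : `|s| = 1 -> gdens (s * n%:R) @[n --> \oo] --> 0.
Proof.
move=> s1; apply: (@squeeze_cvgr _ _ _ _ (cst 0) (fun n => normal_peak 1 * 2 * harmonic n)).
- near=> n; rewrite gdens_ge0/= /gdens -mulrA ler_wpM2l ?normal_peak_ge0//.
  rewrite expRN /harmonic/= ler_pdivlMr ?ltr0Sn// mulrC ler_pdivrMr ?expR_gt0//.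
  have := expR_ge1Dx ((s * n%:R) ^+ 2 / 2).
  rewrite exprMn -(real_normK (num_real s)) s1 expr1n mul1r.
  have := sqr_ge0 (n%:R - 1 : R); have : 0 <= n%:R :> R by []; rewrite sqrrB1 -(natr1 n); lra.
- exact: cvg_cst.
- rewrite -[X in _ --> X](mulr0 (normal_peak 1 * 2)).
  by apply: cvgM; [exact: cvg_cst|exact: cvg_harmonic].
Unshelve. all: by end_near. Qed.

Let int_ider t : mu.-integrable setT (EFin \o (fun y => ider t y * gdens y)).
Proof.
have h1 := integrableZl measurableT t (int_cos t).
have := integrableB measurableT h1 (int_ysin t).
apply: eq_integrable => // y _ /=; rewrite -EFinM -EFinB; congr EFin.
by rewrite /ider; ring.
Qed.

Let continuous_ider t : continuous (fun y => ider t y * gdens y).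
Proof.
move=> y; apply: cvgM; last exact: gdens_continuous.
apply: cvgB; first by apply: cvgM; [exact: cvg_cst|exact: cvg_cos_lin].
by apply: cvgM; [exact: cvg_id|exact: cvg_sin_lin].
Qed.

Let ftc t (n : nat) : (\int[mu]_(y in `[(- n.+1%:R : R)%R, (n.+1%:R : R)%R]) (ider t y * gdens y)%:E =
  (H t n.+1%:R)%:E - (H t (- n.+1%:R))%:E)%E.
Proof.
have dH y : derivable (H t) y 1 by have := is_derive_H t y => -[].
have cH y : {for y, continuous (H t)}.
  by apply: differentiable_continuous; exact/derivable1_diffP.
apply: continuous_FTC2.
- by rewrite -subr_gt0 opprK addr_gt0.
- by apply: continuous_subspaceT; exact: continuous_ider.
- split; first by move=> y _; exact: dH.
  + by apply: cvg_at_right_filter; exact: cH.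
  + by apply: cvg_at_left_filter; exact: cH.
- by move=> y _; rewrite derive1E; have /@derive_val := is_derive_H t y.
Qed.

(** The integrand is the derivative of [H t], which vanishes at infinity. *)
Let int_ider0 t : \int[mu]_y (ider t y * gdens y) = 0.
Proof.
pose h y := (ider t y * gdens y)%:E.
have h1 : (\int[mu]_(y in `[(- n.+1%:R : R)%R, (n.+1%:R : R)%R]) h y @[n --> \oo] --> \int[mu]_y h y)%E.
  under eq_fun do rewrite integral_mkcond.
  apply: (@dominated_cvg _ _ _ mu _ _ _ _ (fun y => `|h y|)%E) => //.
  - move=> n; apply/(measurable_restrictT h) => //.
    apply: measurable_funTS; exact: measurable_int (int_ider t).
  - move=> y _; apply: cvg_near_cst; near=> n.
    rewrite /= patchE mem_set//= in_itv/= -ler_norml.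
    near: n; exists (Num.truncn `|y|) => // n /= yn.
    by rewrite (le_trans (ltW (truncnS_gt _)))// ler_nat ltnS.
  - exact: integrable_abse (int_ider t).
  - move=> n y _; rewrite /= patchE; case: ifP => // _.
    by rewrite abse0.
have h2 : (\int[mu]_(y in `[(- n.+1%:R : R)%R, (n.+1%:R : R)%R]) h y @[n --> \oo] --> 0%:E)%E.
  under eq_fun do rewrite ftc -EFinB.
  apply: cvg_EFin; first exact: nearW.
  apply: norm_cvg0; apply: (@squeeze_cvgr _ _ _ _ (cst 0)
    (fun n => gdens (1 * n.+1%:R) + gdens (-1 * n.+1%:R))).
  + near=> n; rewrite normr_ge0/= mul1r mulN1r.
    by rewrite (le_trans (ler_normB _ _))// lerD// H_le.
  + exact: cvg_cst.
  + rewrite -[X in _ --> X](addr0 0).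
    have shift (s : R) : `|s| = 1 -> gdens (s * n.+1%:R) @[n --> \oo] --> 0.
      by move=> s1; have := cvg_gdens s1; rewrite -(cvg_shiftS (fun n => gdens (s * n%:R))).
    exact: cvgD (shift _ (normr1 R)) (shift _ (normrN1 R)).
have := cvg_unique _ h1 h2.
by rewrite /Rintegral => ->.
Unshelve. all: by end_near. Qed.

Let int_ysinE t : \int[mu]_y (y * sin (t * y + th) * gdens y) = t * F t.
Proof.
apply/eqP; rewrite eq_sym -subr_eq0 -(int_ider0 t) /F -RintegralZl//.
rewrite -RintegralB//.
  by apply/eqP; apply: eq_Rintegral => y _; rewrite /ider; ring.
by have := integrableZl measurableT t (int_cos t); apply: eq_integrable.
Qed.

Let d1 (t y : R) : is_derive t 1 (fun t => cos (t * y + th) * gdens y)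
  (- (y * sin (t * y + th) * gdens y)).
Proof.
have hl : is_derive t 1 (fun t : R => t * y + th) y.
  by apply: is_derive_eq; rewrite /GRing.scale/=; ring.
have h2 := @is_derive1_comp _ cos _ t _ _ (is_derive_cos _) hl.
have h3 := is_deriveM h2 (is_derive_cst (gdens y) t 1).
apply: (is_derive_eq h3).
have E (s g a c : R) : c * 0 + g * (- s * a) = - (a * s * g) by ring.
exact: E.
Qed.

Let is_derive_F (t : R) : is_derive t 1 F (- (t * F t)).
Proof.
have h : s^-1 *: (F (s + t) - F t) @[s --> 0^'] --> - (t * F t).
  have -> : - (t * F t) = \int[mu]_y (partial1of2 (fun t y => cos (t * y + th) * gdens y) t y).
    rewrite -int_ysinE -mulN1r -RintegralZl//; apply: eq_Rintegral => y _.
    by rewrite partial1of2E; have /@derive_val -> := d1 t y; rewrite mulN1r.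
  apply: (@cvg_differentiation_under_integral R _ _ mu
    (fun t y => cos (t * y + th) * gdens y) setT measurableT t (t - 1) (t + 1)
    _ _ _ (fun y => (1 + y ^+ 2) * gdens y)).
  - by rewrite /= in_itv/=; apply/andP; split; lra.
  - by move=> s _; exact: int_cos.
  - by move=> s y _ _; have := d1 s y => -[].
  - by move=> y; rewrite mulr_ge0 ?gdens_ge0// addr_ge0// sqr_ge0.
  - exact: integrable_gdens_sqr.
  - move=> s y _ _; rewrite partial1of2E; have /@derive_val -> := d1 s y.
    rewrite normrN normrM (ger0_norm (gdens_ge0 y)) ler_wpM2r ?gdens_ge0//.
    by rewrite normrM (le_trans _ (dom1 y))// ler_piMr// sin_max.
have h' : s^-1 *: (F (s *: 1 + t) - F t) @[s --> 0^'] --> - (t * F t).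
  by under eq_fun do rewrite scaler1.
apply: DeriveDef; first by apply/cvg_ex; exists (- (t * F t)).
exact/cvg_lim.
Qed.

(** Since [F' t = - t * F t], the product [F t * expR (t ^+ 2 / 2)] is
    constant. *)
Let FE t : F t = cos th * expR (- (t ^+ 2 / 2)).
Proof.
pose K t := F t * expR (t ^+ 2 / 2).
have dK (s : R) : is_derive s 1 K 0.
  have h : is_derive s 1 (fun y : R => y ^+ 2 / 2) s.
    by apply: is_derive_eq; rewrite /GRing.scale/=; field.
  have h2 := @is_derive1_comp _ expR _ s _ _ (is_derive_expR _) h.
  have h3 := is_deriveM (is_derive_F s) h2.
  apply: (is_derive_eq h3).
  have E (f e a : R) : f * (e * a) + e * (- (a * f)) = 0 by ring.
  exact: E.
have := is_derive_0_is_cst t 0 dK.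
rewrite /K expr0n /= mul0r expR0 mulr1 => FK.
have F0 : F 0 = cos th.
  rewrite /F; under eq_Rintegral do rewrite mul0r add0r.
  rewrite RintegralZl//; last exact: integrable_gdens.
  by rewrite /Rintegral gdens_int1 mulr1.
by rewrite -F0 -FK expRN mulfK// gt_eqF// expR_gt0.
Qed.

(** Differentiating the integral in [t] and integrating by parts gives the
    differential equation solved in [FE]. *)
Lemma gaussian_char t : \int[nu]_y cos (t * y + th) = cos th * expR (- (t ^+ 2 / 2)).
Proof.
have ic := int_cos t; have ig := integrable_gdens.
have mc : measurable_fun setT (fun y : R => cos (t * y + th)).
  by apply: continuous_measurable_fun; exact: cvg_cos_lin.
have bc : nu.-integrable setT (EFin \o (fun y => cos (t * y + th))).
  by apply: (@bounded_integrable _ _ _ nu _ 1) => // y; exact: cos_max.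
(* Adding 1 makes the integrand nonnegative, so that the change of density
   applies. *)
apply: (@addIr _ 1); rewrite -{1}(Rintegral_cst1 nu 1) -RintegralD//; last first.
  exact: finite_measure_integrable_cst.
rewrite -FE /Rintegral ge0_integral_normal.
- under eq_integral do rewrite -EFinM mulrDl mul1r EFinD.
  rewrite integralD//= fineD ?integrable_fin_num//.
  by rewrite gdens_int1.
- apply/measurable_EFinP; exact: measurable_funD.
- by move=> y; rewrite lee_fin; have := cos_geN1 (t * y + th); lra.
Qed.

End phase.
End Gaussian.

(** * Means of trigonometric sums over the circle *)

Section Circle.
Variable R : realType.
Implicit Types (u : R -> R) (S : set R).
Local Notation E u := (Rintegral (circle R) setT u).

Definition freqs (A : set int) : set R := [set 2 * pi * z%:~R | z in A].

Lemma circle_cos (z : int) th : z != 0 ->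
  \int[circle R]_x cos (2 * pi * z%:~R * x + th) = 0.
Proof.
move=> z0; pose w : R := 2 * pi * z%:~R.
have w0 : w != 0 by rewrite !mulf_neq0// ?intr_eq0// gt_eqF// pi_gt0.
have cc : continuous (fun x : R => cos (w * x + th)).
  exact: (trig_continuous (trig_cos (S := setT) th I)).
have mc := continuous_measurable_fun cc.
have ic : (circle R).-integrable setT (EFin \o (fun x => cos (w * x + th))).
  by apply: (@bounded_integrable _ _ _ (circle R) _ 1) => // x; exact: cos_max.
apply: (@addIr _ 1); rewrite add0r -[X in _ + X = _](Rintegral_cst1 (circle R) 1) -RintegralD//; last first.
  exact: finite_measure_integrable_cst.
rewrite /Rintegral /circle integral_uniform; last 2 first.
- by apply/measurable_EFinP; exact: measurable_funD.
- by move=> x; rewrite lee_fin; have := cos_geN1 (w * x + th); lra.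
rewrite subr0 invr1 mul1e.
pose G x := w^-1 * sin (w * x + th) + x.
have dG (x : R) : is_derive x 1 G (cos (w * x + th) + 1).
  have hl : is_derive x 1 (fun x : R => w * x + th) w.
    by apply: is_derive_eq; rewrite /GRing.scale/=; ring.
  have h2 := @is_derive1_comp _ sin _ x _ _ (is_derive_sin _) hl.
  have h3 := is_deriveD (is_deriveZ w^-1 h2) (is_derive_id x 1).
  apply: (is_derive_eq h3).
  have e (c : R) : w^-1 * (c * w) + 1 = c + 1 by field.
  exact: e.
have cG x : {for x, continuous G}.
  have dd : derivable G x 1 by have := dG x => -[].
  by apply: differentiable_continuous; exact/derivable1_diffP.
rewrite (@continuous_FTC2 R _ G 0 1)//.
- rewrite /G mulr1 mulr0 add0r addr0 -EFinB/=.
  suff -> : sin (w + th) = sin th by ring.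
  rewrite /w; case: z {z0 w w0 cc mc ic dG cG G} => k /=.
    have -> : 2 * pi * k%:R + th = th + pi *+ 2 *+ k.
      by rewrite -(mulr_natr (pi *+ 2)) -(mulr_natr pi); ring.
    exact: (periodicn (@sinD2pi R)).
  rewrite NegzE mulrNz -pmulrn.
  have <- := periodicn (@sinD2pi R) k.+1 (2 * pi * - k.+1%:R + th).
  by congr (sin _); rewrite -(mulr_natr (pi *+ 2)) -(mulr_natr pi); ring.
- apply: continuous_subspaceT => x.
  by apply: cvgD; [exact: cc|exact: cvg_cst].
- split; first by move=> x _; have := dG x => -[].
  + by apply: cvg_at_right_filter; exact: cG.
  + by apply: cvg_at_left_filter; exact: cG.
- by move=> x _; rewrite derive1E; have /@derive_val := dG x.
Qed.

Lemma trig_integrable S u : trig S u -> (circle R).-integrable setT (EFin \o u).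
Proof.
move=> hu; have [B uB] := trig_bounded hu.
by apply: (@bounded_integrable _ _ _ (circle R) _ B) => //; exact: trig_measurable hu.
Qed.

(** Every cosine of nonzero integer frequency has mean zero. *)
Lemma trig_Ezero u : trig (freqs [set z | z != 0]) u -> E u = 0.
Proof.
elim=> [|w th [z z0 <-]|a {}u v hu IHu hv IHv].
- by rewrite Rintegral_cst1.
- exact: circle_cos.
- have ia := trig_integrable (trigZ a hu).
  rewrite RintegralD//; last exact: trig_integrable hv.
  by rewrite RintegralZl ?IHu ?IHv ?mulr0 ?addr0//; exact: trig_integrable hu.
Qed.

Lemma trig_orth (A B : set int) u (v : R -> R) :
  (forall a b, A a -> B b -> a + b != 0 /\ a - b != 0) ->
  trig (freqs A) u -> trig (freqs B) v -> E (fun x => u x * v x) = 0.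
Proof.
move=> AB hu hv; apply: trig_Ezero; apply: trigM hu hv => _ _ [a Aa <-] [b Bb <-].
have [h1 h2] := AB _ _ Aa Bb.
by split; [exists (a + b)|exists (a - b)] => //; rewrite ?intrD ?intrB; ring.
Qed.

Lemma trig_E_sum S (I : Type) (s : seq I) (P : pred I) (F : I -> R -> R) :
  (forall i, P i -> trig S (F i)) ->
  E (fun x => \sum_(i <- s | P i) F i x) = \sum_(i <- s | P i) E (F i).
Proof.
move=> hF; elim: s => [|i s IH].
  under eq_Rintegral do rewrite big_nil.
  by rewrite Rintegral_cst1 big_nil.
under eq_Rintegral do rewrite big_cons.
rewrite big_cons; case: ifPn => // Pi.
rewrite RintegralD ?IH//; first exact: trig_integrable (hF i Pi).
exact: trig_integrable (trig_sum s hF).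
Qed.

Lemma trig_E_le S u c : trig S u -> (forall x, u x <= c) -> E u <= c.
Proof.
move=> hu uc; rewrite -[leRHS](Rintegral_cst1 (circle R)); apply: le_Rintegral => //.
- exact: trig_integrable hu.
- exact: finite_measure_integrable_cst.
Qed.

Definition wave (v : int) (P Q : R) (x : R) : R :=
  P * cos (2 * pi * v%:~R * x) + Q * sin (2 * pi * v%:~R * x).

Lemma trig_wave (A : set int) v P Q : A v -> trig (freqs A) (wave v P Q).
Proof.
move=> Av; have Sv : freqs A (2 * pi * v%:~R) by exists v.
apply: trig_lin.
  by apply: eq_trig (trig_cos 0 Sv) => x; rewrite addr0.
by apply: eq_trig (trigZ Q (trig_sin 0 Sv)) => x; rewrite addr0.
Qed.

Lemma wave_le v P Q x : `|wave v P Q x| <= `|P| + `|Q|.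
Proof.
rewrite (le_trans (ler_normD _ _))// !normrM lerD// ler_piMr//.
  exact: cos_max.
exact: sin_max.
Qed.

(** Two waves are orthogonal unless their frequencies agree up to sign, and a
    product of two waves is at most [W i * W i']. *)
Lemma E_waves_le (I : Type) (s : seq I) (v : I -> int) (P Q W : I -> R) :
  (forall i, `|P i| + `|Q i| <= W i) ->
  E (fun x => (\sum_(i <- s) wave (v i) (P i) (Q i) x) ^+ 2) <=
  \sum_(i <- s) \sum_(i' <- s) W i * W i' * (`|v i|%N == `|v i'|%N)%:R.
Proof.
move=> PQW.
pose S := freqs setT.
have tw i : trig S (wave (v i) (P i) (Q i)) by exact: trig_wave.
have tww i i' : trig S (fun x => wave (v i) (P i) (Q i) x * wave (v i') (P i') (Q i') x).
  apply: (trigM _ (tw i) (tw i')) => _ _ [a _ <-] [b _ <-].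
  by split; [exists (a + b)|exists (a - b)] => //; rewrite ?intrD ?intrB; ring.
have -> : E (fun x => (\sum_(i <- s) wave (v i) (P i) (Q i) x) ^+ 2) =
    E (fun x => \sum_(i <- s) \sum_(i' <- s)
      (wave (v i) (P i) (Q i) x * wave (v i') (P i') (Q i') x)).
  apply: eq_Rintegral => x _; rewrite expr2 mulr_suml; apply: eq_bigr => i _.
  by rewrite mulr_sumr.
rewrite (@trig_E_sum S); last by move=> i _; exact: trig_sum.
apply: ler_sum => i _.
rewrite (@trig_E_sum S)//.
apply: ler_sum => i' _; case: eqVneq => [_|vv].
  rewrite mulr1; apply: (trig_E_le (tww i i')) => x.
  rewrite (le_trans (ler_norm _))// normrM ler_pM//.
    exact: le_trans (wave_le _ _ _ _) (PQW i).
  exact: le_trans (wave_le _ _ _ _) (PQW i').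
rewrite mulr0 le_eqVlt; apply/orP; left; apply/eqP.
apply: (@trig_orth [set v i] [set v i']); [|exact: trig_wave|exact: trig_wave].
move=> _ _ -> ->; split; apply: contra_neqT vv; rewrite negbK.
  by rewrite addr_eq0 => /eqP ->; rewrite abszN.
by rewrite subr_eq0 => /eqP ->.
Qed.

End Circle.

(** * Dilation of periodic functions by integers *)

Section AffineChange.
Variable R : realType.
Let mu := @lebesgue_measure R.

Section affine.
Variables (a b : R) (a0 : 0 < a).
Let phi (x : measurableTypeR R) : measurableTypeR R := (a * x + b)%R.

Let mphi : measurable_fun [set: measurableTypeR R] phi.
Proof. by apply: measurable_funD => //; exact: measurable_funM. Qed.

Let pm : {measure set (measurableTypeR R) -> \bar R} :=
  measure_function_pushforward__canonical__measure_function_Measure mu mphi.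

Let m := mscale (NngNum (ltW a0)) pm.

Let mE A : measurable A -> mu A = m A.
Proof.
apply: lebesgue_measure_unique => _ [[x y] _ <-] /=.
rewrite /m /mscale /= /pm /= /pushforward.
have -> : phi @^-1` `]x, y] = `](x - b) / a, (y - b) / a]%classic.
  apply/seteqP; split=> z /=; rewrite !in_itv/= /phi.
    move=> /andP[h1 h2]; rewrite ltr_pdivrMr// ler_pdivlMr//; lra.
  rewrite ltr_pdivrMr// ler_pdivlMr// => /andP[h1 h2]; lra.
rewrite !lebesgue_measure_itv/= !lte_fin ltr_pM2r ?invr_gt0// ltrD2r.
case: ifP => _; last by rewrite mule0.
rewrite -!EFinD -EFinM; congr EFin; field.
by rewrite gt_eqF.
Qed.

Lemma ge0_integral_affine (h : R -> \bar R) : measurable_fun setT h ->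
  (forall x, 0 <= h x)%E ->
  (\int[mu]_x h x = a%:E * \int[mu]_x h (a * x + b)%R)%E.
Proof.
move=> mh h0.
rewrite (@eq_measure_integral _ _ _ _ m); last by move=> A mA _; exact: mE.
rewrite ge0_integral_mscale//=; congr (_ * _)%E.
by rewrite ge0_integral_pushforward.
Qed.

End affine.

(** The intervals from [i / n] to [(i + 1) / n] partition the unit interval. *)
Lemma scale_sum_indic (n : nat) (x : R) : (0 < n)%N ->
  \sum_(i < n) (0 <= n%:R * x - i%:R < 1)%R%:R = (0 <= x < 1)%R%:R :> R.
Proof.
move=> n0; have n0R : 0 < n%:R :> R by rewrite ltr0n.
have [/andP[x0 x1]|x01] := boolP (0 <= x < 1).
  have y0 : 0 <= n%:R * x by rewrite mulr_ge0// ltW.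
  have yn : n%:R * x < n%:R by rewrite gtr_pMr.
  have /andP[t1 t2] := truncn_itv y0.
  have tn : (Num.truncn (n%:R * x) < n)%N.
    by rewrite -(ltr_nat R) (le_lt_trans t1).
  rewrite (bigD1 (Ordinal tn))//= big1 ?addr0.
    rewrite subr_ge0 t1/= ltrBlDr addrC natr1 t2//.
  move=> i /eqP/val_eqP/= it; apply/eqP; rewrite pnatr_eq0 eqb0.
  apply: contra it => /andP[h1 h2]; apply/eqP/esym.
  apply/eqP; rewrite (truncn_eq _ y0) -natr1; apply/andP; split; lra.
rewrite big1// => i _; apply/eqP; rewrite pnatr_eq0 eqb0.
apply: contra x01 => /andP[h1 h2]; apply/andP; split.
  have : 0 <= n%:R * x by have : 0 <= i%:R :> R by []; lra.
  by rewrite pmulr_rge0.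
have : n%:R * x < n%:R.
  have : (i.+1%:R : R) <= n%:R by rewrite ler_nat ltn_ord.
  by rewrite -natr1; lra.
by rewrite gtr_pMr.
Qed.

Lemma periodic_sub (u : R -> R) (i : nat) x : periodic u 1 -> u (x - i%:R) = u x.
Proof. by move=> pu; rewrite -(periodicn pu i (x - i%:R)) subrK. Qed.

(** Cut the unit interval into [n] equal parts; on each of them an affine change
    of variable brings back a full period. *)
Lemma circle_scale (u : R -> R) (n : nat) : (0 < n)%N ->
  measurable_fun setT u -> (forall x, 0 <= u x) -> periodic u 1 ->
  (\int[circle R]_x (u (n%:R * x))%:E = \int[circle R]_x (u x)%:E)%E.
Proof.
move=> n0 mu_ u0 pu.
have n0R : 0 < n%:R :> R by rewrite ltr0n.
have mun : measurable_fun setT (fun x : R => u (n%:R * x)).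
  by apply: measurableT_comp => //; exact: measurable_funM.
pose I (x : R) : R := (0 <= x < 1)%R%:R.
have mI : measurable_fun setT I.
  rewrite (_ : I = \1_`[0, 1[); first exact: measurable_indic.
  apply/funext => x; rewrite /I indicE; congr (_%:R).
  have [|] := boolP (x \in `[0, 1[%classic).
    by rewrite inE/= in_itv/= => ->.
  by rewrite notin_setE/= in_itv/= => /negP/negbTE ->.
have toI (v : R -> R) : measurable_fun setT v -> (forall x, 0 <= v x) ->
    (\int[circle R]_x (v x)%:E = \int[mu]_x (v x * I x)%:E)%E.
  move=> mv v0; have mv' : measurable_fun setT (EFin \o v) by exact/measurable_EFinP.
  have v0' x : (0 <= (EFin \o v) x)%E by rewrite lee_fin.
  rewrite /circle (integral_uniform ltr01 mv' v0').
  rewrite subr0 invr1 mul1e -integral_itv_bndo_bndc; last exact/measurable_EFinP/measurable_funTS.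
  rewrite integral_mkcond; apply: eq_integral => x _; rewrite patchE /I.
  have [|] := boolP (x \in `[0, 1[%classic).
    by rewrite inE/= in_itv/= => ->; rewrite mulr1.
  by rewrite notin_setE/= in_itv/= => /negP/negbTE ->; rewrite mulr0.
rewrite !toI//.
pose h (x : R) := (u x * I x)%:E.
have mh : measurable_fun setT h by apply/measurable_EFinP; exact: measurable_funM.
have h0 x : (0 <= h x)%E by rewrite lee_fin mulr_ge0 ?u0 ?ler0n.
have -> : (\int[mu]_x (u (n%:R * x) * I x)%:E =
    \sum_(i < n) \int[mu]_x h (n%:R * x - i%:R)%R)%E.
  rewrite -ge0_integral_sum//.
    apply: eq_integral => x _; rewrite /I -(scale_sum_indic x n0) mulr_sumr sumEFin.
    congr EFin; apply: eq_bigr => i _.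
    by rewrite periodic_sub.
  move=> i; apply: measurableT_comp => //.
  by apply: measurable_funB => //; exact: measurable_funM.
have aff i : (\int[mu]_x h (n%:R * x - i%:R)%R = n%:R^-1%:E * \int[mu]_x h x)%E.
  rewrite (ge0_integral_affine (- i%:R) n0R mh h0) muleA -EFinM mulVf ?mul1e//.
  by rewrite gt_eqF.
under eq_bigr do rewrite aff.
rewrite -ge0_sume_distrl//.
rewrite sumEFin sumr_const card_ord -(mulr_natr n%:R^-1 n) mulVf ?mul1e//.
by rewrite gt_eqF.
Qed.

End AffineChange.

(** * Density of trigonometric polynomials in L2 *)

Section Density.
Variable R : realType.
Let mu := @lebesgue_measure R.
Let S : set R := freqs setT.

Lemma cvge0_le (h : nat -> \bar R) e : h @ \oo --> 0%E -> 0 < e ->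
  \forall n \near \oo, (h n <= e%:E)%E.
Proof.
move=> /fine_cvgP[hfin hc] e0.
have he := cvgr_lt 0 hc _ e0.
near=> n; have hn : h n \is a fin_num by near: n.
have hne : (fine \o h) n < e by near: n; exact: he.
by rewrite -(fineK hn) lee_fin ltW.
Unshelve. all: by end_near. Qed.

Lemma cvge0_ex (h : nat -> \bar R) e : h @ \oo --> 0%E -> 0 < e ->
  exists n, (h n <= e%:E)%E.
Proof. by move=> h0 e0; have /filter_ex := cvge0_le h0 e0. Qed.

Lemma continuous_fcomp (f1 f2 : R -> R) : continuous f1 -> continuous f2 ->
  continuous (fun x => f2 (f1 x)).
Proof. by move=> c1 c2 x; apply: (@continuous_comp _ _ _ f1 f2); [exact: c1|exact: c2]. Qed.

Lemma freqsTD (a b : R) : S a -> S b -> S (a + b) /\ S (a - b).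
Proof.
move=> [x _ <-] [y _ <-].
by split; [exists (x + y)|exists (x - y)] => //; rewrite ?intrD ?intrB; ring.
Qed.

Lemma freqsT0 : S 0.
Proof. by exists 0 => //; rewrite mulr0. Qed.

Definition uapprox (w : R -> R) := forall e, 0 < e ->
  exists2 v, trig S v & forall x, `|v x - w x| <= e.

Lemma uapproxM (B : R) w1 w2 : 0 < B -> (forall x, `|w1 x| <= B) ->
  (forall x, `|w2 x| <= B) ->
  uapprox w1 -> uapprox w2 -> uapprox (fun x => w1 x * w2 x).
Proof.
move=> B0 b1 b2 h1 h2 e e0.
pose d := Num.min B (e / (3 * B)).
have B30 : 0 < 3 * B by rewrite mulr_gt0.
have d0 : 0 < d by rewrite lt_min B0 divr_gt0.
have dB : d <= B by rewrite ge_min lexx.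
have de : 3 * B * d <= e.
  by rewrite mulrC -ler_pdivlMr// ge_min lexx orbT.
have [v1 t1 k1] := h1 _ d0; have [v2 t2 k2] := h2 _ d0.
exists (fun x => v1 x * v2 x); first exact: (trigM freqsTD t1 t2).
move=> x.
have -> : v1 x * v2 x - w1 x * w2 x =
  (v1 x - w1 x) * (v2 x - w2 x) + w1 x * (v2 x - w2 x) + (v1 x - w1 x) * w2 x by ring.
apply: le_trans (le_trans (ler_normD _ _) (lerD (ler_normD _ _) (lexx _))) _.
rewrite !normrM.
have := k1 x; have := k2 x; have := b1 x; have := b2 x.
have := normr_ge0 (v1 x - w1 x); have := normr_ge0 (v2 x - w2 x).
have := normr_ge0 (w1 x); have := normr_ge0 (w2 x).
nra.
Qed.

Lemma uapproxD w1 w2 : uapprox w1 -> uapprox w2 -> uapprox (fun x => w1 x + w2 x).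
Proof.
move=> h1 h2 e e0; have e20 : 0 < e / 2 by lra.
have [v1 t1 k1] := h1 _ e20; have [v2 t2 k2] := h2 _ e20.
exists (fun x => v1 x + v2 x); first exact: trigD.
move=> x; rewrite opprD addrACA (le_trans (ler_normD _ _))//.
by have := k1 x; have := k2 x; lra.
Qed.

Lemma uapprox_comp u (G : R -> R) : trig S u -> (forall x, 0 <= u x <= 1) ->
  continuous G -> uapprox (fun x => G (u x)).
Proof.
by move=> hu u01 cG e e0; exact: (trig_comp_approx freqsTD freqsT0 hu u01 cG e0).
Qed.

(** The integral is extended-real, so that the bound entails the square
    integrability of the difference. *)
Definition l2le (u v : R -> R) (e : R) :=
  (\int[circle R]_x ((u x - v x) ^+ 2)%:E <= e%:E)%E.

Definition l2approx (u : R -> R) := forall e, 0 < e ->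
  exists2 v, trig S v & l2le u v e.

Lemma l2le_trans (u v w : R -> R) (e1 e2 : R) : measurable_fun setT u ->
  measurable_fun setT v -> measurable_fun setT w ->
  l2le u v e1 -> l2le v w e2 -> l2le u w (2 * e1 + 2 * e2).
Proof.
move=> mu_ mv mw h1 h2; rewrite /l2le.
have m1 : measurable_fun setT (fun x => (u x - v x) ^+ 2).
  by apply: measurable_funX; exact: measurable_funB.
have m2 : measurable_fun setT (fun x => (v x - w x) ^+ 2).
  by apply: measurable_funX; exact: measurable_funB.
have m3 : measurable_fun setT (fun x => (u x - w x) ^+ 2).
  by apply: measurable_funX; exact: measurable_funB.
apply: (@le_trans _ _ (\int[circle R]_x (2%:E * ((u x - v x) ^+ 2)%:E + 2%:E * ((v x - w x) ^+ 2)%:E))%E).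
  apply: ge0_le_integral => //.
  - by move=> x _; rewrite lee_fin sqr_ge0.
  - exact/measurable_EFinP.
  - apply: emeasurable_funD; apply: emeasurable_funM => //; exact/measurable_EFinP.
  - move=> x _; rewrite -!EFinM -EFinD lee_fin.
    by have := sqr_ge0 ((u x - v x) - (v x - w x)); nra.
rewrite ge0_integralD//; last 4 first.
- by move=> x _; rewrite mule_ge0// lee_fin sqr_ge0.
- by apply: emeasurable_funM => //; exact/measurable_EFinP.
- by move=> x _; rewrite mule_ge0// lee_fin sqr_ge0.
- by apply: emeasurable_funM => //; exact/measurable_EFinP.
rewrite !ge0_integralZl//; last 4 first.
- exact/measurable_EFinP.
- by move=> x _; rewrite lee_fin sqr_ge0.
- exact/measurable_EFinP.
- by move=> x _; rewrite lee_fin sqr_ge0.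
have -> : (2 * e1 + 2 * e2)%:E = (2%:E * e1%:E + 2%:E * e2%:E)%E by [].
by rewrite leeD// lee_wpmul2l// lee_fin.
Qed.

Lemma l2approx_close (u : R -> R) : measurable_fun setT u ->
  (forall e, 0 < e -> exists w, [/\ measurable_fun setT w, l2approx w & l2le u w e]) ->
  l2approx u.
Proof.
move=> mu_ H e e0; have e40 : 0 < e / 4 by lra.
have [w [mw aw uw]] := H _ e40; have [v tv wv] := aw _ e40.
exists v => //; have := l2le_trans mu_ mw (trig_measurable tv) uw wv.
by rewrite (_ : 2 * (e / 4) + 2 * (e / 4) = e)//; field.
Qed.

Lemma uapprox_l2 w : measurable_fun setT w -> uapprox w -> l2approx w.
Proof.
move=> mw aw e e0; pose d := Num.min 1 e.
have d0 : 0 < d by rewrite lt_min ltr01.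
have [v tv vw] := aw _ d0; exists v => //; rewrite /l2le.
have mv := trig_measurable tv.
apply: (@le_trans _ _ (\int[circle R]_x (cst d%:E x))%E); last first.
  have p1 := @probability_setT _ _ _ (circle R).
  rewrite integral_cst//; set c := (X in (_ * X <= _)%E).
  have -> : c = 1%E by exact: p1.
  by rewrite mule1 lee_fin ge_min lexx orbT.
apply: ge0_le_integral => //.
- by move=> x _; rewrite lee_fin sqr_ge0.
- by apply/measurable_EFinP; apply: measurable_funX; exact: measurable_funB.
- move=> x _; rewrite lee_fin -(real_normK (num_real _)) distrC.
  have := vw x; have : d <= 1 by rewrite ge_min lexx.
  have := normr_ge0 (v x - w x); nra.
Qed.

Lemma circle_itv (h : R -> \bar R) : measurable_fun setT h -> (forall x, 0 <= h x)%E ->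
  (\int[circle R]_x h x = \int[mu]_(x in `](0:R)%R, (1:R)%R[) h x)%E.
Proof.
move=> mh h0; rewrite /circle (integral_uniform ltr01 mh h0) subr0 invr1 mul1e.
by rewrite integral_itv_bndoo//; exact: measurable_funTS.
Qed.

(** A point of the circle is not a function of its cosine alone:
    [acos (cos (2 * pi * x)) / (2 * pi)] is [x] on the first half of the period
    and [1 - x] on the second.  The two resulting expressions [G1] and [G2] of
    [g] are glued along the sign of [sin (2 * pi * x)], with a cut-off [C m] of
    slope [m]; clamps keep [acos] away from the ends of its domain.  The glued
    functions are uniform limits of trigonometric polynomials and converge
    boundedly to [g] on the unit interval, except at 0, 1/2 and 1. *)
Lemma l2approx_continuous (g : R -> R) (K : R) : continuous g -> 0 < K ->
  (forall x, `|g x| <= K) -> l2approx g.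
Proof.
move=> cg K0 gK.
have mg := continuous_measurable_fun cg.
pose a m : R := 1 - m.+2%:R^-1.
have a01 m : 0 < a m < 1.
  rewrite /a ltrBlDr ltrDl invr_gt0 ltr0n andbT subr_gt0 invf_lt1 ?ltr0n//.
  by rewrite ltr1n.
pose ac m (t : R) := acos (clamp (- a m) (a m) t).
have cac m : continuous (ac m).
  move=> y; apply: (@continuous_comp _ _ _ (clamp (- a m) (a m)) (@acos R)).
    exact: clamp_continuous.
  apply: continuous_acos.
  have /andP[? ?] := a01 m.
  by have /andP[] := @clamp_itv R (- a m) (a m) y ltac:(lra); lra.
pose G1 m (t : R) := g (ac m (2 * t - 1) / (2 * pi)).
pose G2 m (t : R) := g (1 - ac m (2 * t - 1) / (2 * pi)).
have clin : continuous (fun t : R => 2 * t - 1).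
  by move=> t; apply: cvgB; [apply: cvgM; [exact: cvg_cst|exact: cvg_id]|exact: cvg_cst].
have cacl m : continuous (fun t : R => ac m (2 * t - 1) / (2 * pi)).
  have h := continuous_fcomp clin (cac m).
  by move=> t; apply: cvgM; [exact: h|exact: cvg_cst].
have cG1 m : continuous (G1 m) by exact: continuous_fcomp (cacl m) cg.
have cG2 m : continuous (G2 m).
  apply: (@continuous_fcomp (fun t : R => 1 - ac m (2 * t - 1) / (2 * pi)) g) => // t.
  by apply: cvgB; [exact: cvg_cst|exact: cacl].
pose C m (t : R) := clamp 0 1 (m%:R * (2 * t - 1)).
have cC m : continuous (C m).
  apply: (@continuous_fcomp (fun t : R => m%:R * (2 * t - 1)) (clamp 0 1)).
    by move=> t; apply: cvgM; [exact: cvg_cst|exact: clin].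
  exact: clamp_continuous.
have C01 m t : 0 <= C m t <= 1 by exact: clamp_itv.
pose uc (x : R) := 2^-1 * cos (2 * pi * 1%:~R * x + 0) + 2^-1.
pose us (x : R) := 2^-1 * sin (2 * pi * 1%:~R * x + 0) + 2^-1.
have S1 : S (2 * pi * 1%:~R) by exists 1.
have tc : trig S uc.
  by apply: trig_lin; [exact: trig_cos|exact: trig_cst freqsT0].
have ts : trig S us.
  by apply: trig_lin; [exact: trig_sin|exact: trig_cst freqsT0].
have uc01 x : 0 <= uc x <= 1.
  rewrite /uc; set z := _ + 0; have := cos_geN1 z; have := cos_le1 z; lra.
have us01 x : 0 <= us x <= 1.
  rewrite /us; set z := _ + 0; have := sin_geN1 z; have := sin_le1 z; lra.
pose w m x := C m (us x) * G1 m (uc x) + (1 - C m (us x)) * G2 m (uc x).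
have aw m : uapprox (w m).
  have K1 : 0 < K + 1 by lra.
  apply: uapproxD; apply: (@uapproxM (K + 1)) => //.
  - by move=> x; have := C01 m (us x) => /andP[? ?]; rewrite ger0_norm//; lra.
  - by move=> x; rewrite (le_trans (gK _))//; lra.
  - exact: (uapprox_comp ts us01 (cC m)).
  - exact: (uapprox_comp tc uc01 (cG1 m)).
  - by move=> x; have := C01 m (us x) => /andP[? ?]; rewrite ger0_norm; lra.
  - by move=> x; rewrite (le_trans (gK _))//; lra.
  - apply: (@uapprox_comp us (fun t => 1 - C m t)) => // t.
    by apply: cvgB; [exact: cvg_cst|exact: cC].
  - exact: (uapprox_comp tc uc01 (cG2 m)).
have cw m : continuous (w m).
  have cus := trig_continuous ts; have cuc := trig_continuous tc.
  have h1 := continuous_fcomp cus (cC m).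
  have h2 := continuous_fcomp cuc (cG1 m).
  have h3 := continuous_fcomp cuc (cG2 m).
  move=> x; apply: cvgD; apply: cvgM; [exact: h1|exact: h2| |exact: h3].
  by apply: cvgB; [exact: cvg_cst|exact: h1].
have wK m x : `|w m x| <= K.
  have := gK (ac m (2 * uc x - 1) / (2 * pi)).
  have := gK (1 - ac m (2 * uc x - 1) / (2 * pi)).
  rewrite /w -/(G1 m (uc x)) -/(G2 m (uc x)) !ler_norml => /andP[? ?] /andP[? ?].
  have /andP[? ?] := C01 m (us x).
  by apply/andP; split; nra.
have itv_cos (y : R) : 0 < y < pi -> -1 < cos y < 1.
  move=> /andP[y0 y1]; have p0 := @pi_gt0 R; rewrite -cospi -cos0 !ltr_cos ?y0 ?y1//;
    by rewrite in_itv/=; lra.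
have acE (y : R) : 0 < y < pi -> \forall m \near \oo, ac m (cos y) = y.
  move=> y01; have /andP[c1 c2] := itv_cos _ y01; pose z := Num.max (cos y) (- cos y).
  have z1 : 0 < 1 - z by rewrite subr_gt0 gt_max c2/=; lra.
  apply: filterS (@nbhs_infty_gtr R (1 - z)^-1) => m h.
  have : z < a m.
    rewrite /a ltrBrDr -ltrBrDl invf_plt ?posrE ?ltr0n//.
    by apply: (lt_trans h); rewrite ltr_nat ltnS leqnSn.
  rewrite gt_max => /andP[? ?]; rewrite /ac clamp_id; last by apply/andP; split; lra.
  by rewrite cosK// in_itv/=; move: y01 => /andP[? ?]; lra.
have simp (y : R) : 2 * pi * y / (2 * pi) = y.
  have : (pi : R) != 0 by rewrite gt_eqF// pi_gt0.
  by move: pi => q q0; field.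
have wE x : 0 < x < 1 -> x != 2^-1 -> \forall m \near \oo, w m x = g x.
  move=> /andP[x0 x1] x2.
  have p0 := @pi_gt0 R.
  have ucE : 2 * uc x - 1 = cos (2 * pi * x) by rewrite /uc mulr1 addr0; field.
  have usE : 2 * us x - 1 = sin (2 * pi * x) by rewrite /us mulr1 addr0; field.
  have [xl|xl] := ltP x 2^-1.
    have y1 : 0 < 2 * pi * x < pi.
      by apply/andP; split; [rewrite !mulr_gt0|nra].
    have s0 := sin_gt0_pi y1.
    apply: filterS2 (acE _ y1) (@nbhs_infty_ger R (sin (2 * pi * x))^-1) => m am ms.
    have Cm : C m (us x) = 1.
      by rewrite /C usE /clamp min_l ?max_r// -ler_pdivrMr// mul1r.
    by rewrite /w Cm subrr mul0r addr0 mul1r /G1 ucE am simp.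
  have {}xl : 2^-1 < x by rewrite lt_neqAle eq_sym x2.
  have y1 : 0 < 2 * pi * (1 - x) < pi.
    by apply/andP; split; [rewrite !mulr_gt0// subr_gt0|nra].
  have cE : cos (2 * pi * x) = cos (2 * pi * (1 - x)).
    by rewrite -cosN -(cosD2pi (- _)); congr cos; rewrite -[pi *+ 2]mulr_natr; ring.
  have sE : sin (2 * pi * x) = - sin (2 * pi * (1 - x)).
    rewrite -sinN -(sinD2pi (- (2 * pi * (1 - x)))); congr sin.
    by rewrite -[pi *+ 2]mulr_natr; ring.
  have s0 := sin_gt0_pi y1.
  apply: filterS (acE _ y1) => m am.
  have Cm : C m (us x) = 0.
    rewrite /C usE sE /clamp; apply/max_l; rewrite ge_min; apply/orP; right.
    by rewrite mulrN oppr_le0 mulr_ge0// ltW.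
  by rewrite /w Cm subr0 mul0r add0r mul1r /G2 ucE cE am simp; congr g; ring.
apply: l2approx_close => // e e0.
have mwm m : measurable_fun setT (w m) by exact: continuous_measurable_fun.
pose h m (x : R) := ((g x - w m x) ^+ 2)%:E.
have mh m : measurable_fun setT (h m).
  by apply/measurable_EFinP; apply: measurable_funX; exact: measurable_funB.
have h0 : (\int[mu]_(x in `](0:R)%R, (1:R)%R[) h m x @[m --> \oo] --> 0)%E.
  have [] := @dominated_convergence _ _ _ mu `](0:R)%R, (1:R)%R[%classic _ h (cst 0%E)
    (cst ((2 * K) ^+ 2)%:E) => //.
  - by move=> m; apply: measurable_funTS; exact: mh.
  - exists [set 2^-1]; split => //; first by exact: lebesgue_measure_set1.
    move=> x /=; apply: contra_notP => /eqP x2; rewrite in_itv/= => x01.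
    apply: cvg_near_cst; apply: filterS (wE _ x01 x2) => m.
    by rewrite /h => ->; rewrite subrr expr0n.
  - apply/integrableP; split => //.
    rewrite integral_cst//= lebesgue_measure_itv/= lte_fin ltr01.
    by rewrite -EFinB -EFinM ltry.
  - apply: aeW => x m _; rewrite /h/= lee_fin ger0_norm ?sqr_ge0//.
    rewrite -(real_normK (num_real _)) ler_pXn2r ?nnegrE//; last by lra.
    rewrite (le_trans (ler_normB _ _))//.
    by have := gK x; have := wK m x; lra.
  by move=> _ _; rewrite integral0.
have [m hm] := cvge0_ex h0 e0.
exists (w m); split => //; first by apply: uapprox_l2 => //; exact: aw.
have h_ge0 x : (0 <= h m x)%E by rewrite lee_fin sqr_ge0.
by rewrite /l2le (circle_itv (mh m) h_ge0).
Unshelve. all: by end_near. Qed.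

Lemma mu01 : @lebesgue_measure R `[(0:R), (1:R)]%classic = 1%E.
Proof. by rewrite lebesgue_measure_itv/= lte_fin ltr01 oppr0 adde0. Qed.

(** Continuous functions are dense in L1; as [u] and the clamped approximant are
    bounded by [K], closeness in L1 implies closeness in L2. *)
Lemma l2approx_bounded (u : R -> R) (K : R) : measurable_fun setT u -> 0 < K ->
  (forall x, `|u x| <= K) -> l2approx u.
Proof.
move=> mu_ K0 uK; apply: l2approx_close => // e e0.
have fin1 : (mu `[(0:R)%R, (1:R)%R]%classic < +oo)%E.
  by have := mu01; rewrite -/mu => ->; rewrite ltry.
have iu : mu.-integrable `[0, 1] (EFin \o u).
  apply: measurable_bounded_integrable => //.
  - exact: measurable_funTS.
  - exists K; split; first exact: num_real.
    by move=> y Ky x _ /=; rewrite (le_trans (uK x))// ltW.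
have [g_ [cg ig gcv]] := approximation_continuous_integrable (measurable_itv _) fin1 iu.
have e'0 : 0 < e / (2 * K) by rewrite divr_gt0// mulr_gt0.
have [m hm] := cvge0_ex gcv e'0.
pose w x := clamp (- K) K (g_ m x).
have cw : continuous w.
  by apply: continuous_fcomp; [exact: cg|exact: clamp_continuous].
have wK x : `|w x| <= K.
  by rewrite ler_norml; apply: clamp_itv; lra.
exists w; split; first exact: continuous_measurable_fun.
  exact: (l2approx_continuous cw K0 wK).
have mw := continuous_measurable_fun cw.
have mg := continuous_measurable_fun (cg m).
have msq : measurable_fun setT (fun x => ((u x - w x) ^+ 2)%:E).
  by apply/measurable_EFinP; apply: measurable_funX; exact: measurable_funB.
have mab : measurable_fun setT (fun x => `|(u x - g_ m x)%:E|)%E.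
  by apply: measurableT_comp => //; apply/measurable_EFinP; exact: measurable_funB.
rewrite /l2le /circle integral_uniform//; last by move=> x; rewrite lee_fin sqr_ge0.
rewrite subr0 invr1 mul1e.
apply: (@le_trans _ _ (\int[mu]_(x in `[0%R, 1%R]) ((2 * K)%:E * `|(u x - g_ m x)%:E|))%E).
  apply: ge0_le_integral => //.
  - by move=> x _; rewrite lee_fin sqr_ge0.
  - exact: measurable_funTS.
  - by apply: measurable_funTS; exact: measurable_funeM.
  - move=> x _; rewrite abse_EFin -EFinM lee_fin.
    have h1 : `|u x - w x| <= `|u x - g_ m x|.
      have := uK x; rewrite ler_norml => /andP[u1 u2].
      rewrite /w /clamp; have [gK|gK] := leP K (g_ m x).
        rewrite max_r; last by lra.
        rewrite !ler0_norm; lra.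
      have [gK'|gK'] := leP (- K) (g_ m x) => //.
      rewrite !ger0_norm; lra.
    have h2 : `|u x - w x| <= 2 * K.
      by rewrite (le_trans (ler_normB _ _))//; have := uK x; have := wK x; lra.
    rewrite -(real_normK (num_real _)) expr2 ler_pM//.
rewrite ge0_integralZl//; last by rewrite lee_fin mulr_ge0// ltW.
  apply: (@le_trans _ _ ((2 * K)%:E * (e / (2 * K))%:E)%E).
    by rewrite lee_wpmul2l// lee_fin mulr_ge0// ltW.
  by rewrite -EFinM lee_fin mulrC divfK// mulf_neq0// gt_eqF.
exact: measurable_funTS.
Unshelve. all: by end_near. Qed.

(** The truncations of [f] at height [m] converge to it in L2 by dominated
    convergence. *)
Lemma l2approx_Lfun (f : R -> R) : f \in Lfun (circle R) 2%:E -> l2approx f.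
Proof.
move=> fL; have mf : measurable_fun setT f.
  by move: fL; rewrite inE => /andP[]; rewrite inE.
have if2 := Lfun2_integrable_sqr fL.
apply: l2approx_close => // e e0.
pose w (m : nat) x := clamp (- m.+1%:R) m.+1%:R (f x).
have mw m : measurable_fun setT (w m).
  apply: (@measurableT_comp _ _ _ _ _ _ (clamp (- m.+1%:R) m.+1%:R)) => //.
  exact: continuous_measurable_fun (@clamp_continuous R _ _).
have aw m : l2approx (w m).
  apply: (@l2approx_bounded _ m.+1%:R) => // x.
  by rewrite ler_norml; apply: clamp_itv; rewrite -subr_ge0 opprK addr_ge0.
pose h m (x : R) := ((f x - w m x) ^+ 2)%:E.
have mh m : measurable_fun setT (h m).
  by apply/measurable_EFinP; apply: measurable_funX; exact: measurable_funB.
have wle (m : nat) x : `|f x - w m x| <= `|f x|.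
  have m0 : (0 : R) <= m.+1%:R by [].
  rewrite /w /clamp; have [fm|fm] := leP m.+1%:R (f x).
    by rewrite max_r; [rewrite !ger0_norm; lra|lra].
  have [fm'|fm'] := leP (- m.+1%:R) (f x); first by rewrite subrr normr0.
  by rewrite !ler0_norm; lra.
have h0 : (\int[circle R]_x h m x @[m --> \oo] --> 0)%E.
  have [] := @dominated_convergence _ _ _ (circle R) setT measurableT h (cst 0%E)
    (EFin \o (fun x => f x ^+ 2)) => //.
  - apply: aeW => x _; apply: cvg_near_cst; near=> m.
    rewrite /h /w clamp_id ?subrr ?expr0n//.
    rewrite -ler_norml; near: m; exists (Num.truncn `|f x|) => // n /= fn.
    by rewrite (le_trans (ltW (truncnS_gt _)))// ler_nat ltnS.
  - apply: aeW => x m _; rewrite /h/= lee_fin ger0_norm ?sqr_ge0//.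
    rewrite -(real_normK (num_real (f x - _))) -(real_normK (num_real (f x))).
    by rewrite ler_pXn2r ?nnegrE.
  - by move=> _ _; rewrite integral0.
have [m hm] := cvge0_ex h0 e0.
by exists (w m); split.
Unshelve. all: by end_near. Qed.

End Density.

(** * Square-integrable functions and Fourier partial sums *)

Section SquareIntegrable.
Context d (T : measurableType d) (R : realType) (P : probability T R).
Implicit Types (u v : T -> R).
Local Notation E u := (Rintegral P setT u).

Definition sqint u := measurable_fun setT u /\
  P.-integrable setT (EFin \o (fun x => u x ^+ 2)).

Lemma sqint_bounded u B : measurable_fun setT u -> (forall x, `|u x| <= B) -> sqint u.
Proof.
move=> mu uB; split=> //; apply: (@bounded_integrable _ _ _ P _ (B ^+ 2)).
  exact: measurable_funX.
move=> x; rewrite ger0_norm ?sqr_ge0// -(real_normK (num_real (u x))).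
by rewrite ler_pXn2r// nnegrE// (le_trans _ (uB x)).
Qed.

Lemma sqint_integrableM u v : sqint u -> sqint v ->
  P.-integrable setT (EFin \o (fun x => u x * v x)).
Proof.
move=> [mu iu] [mv iv].
have iuv : P.-integrable setT (EFin \o (fun x => u x ^+ 2 + v x ^+ 2)).
  by have := integrableD measurableT iu iv; apply: eq_integrable.
apply: le_integrable iuv => //.
  by apply/measurable_EFinP; exact: measurable_funM.
move=> x _ /=; rewrite lee_fin [X in _ <= X]ger0_norm ?addr_ge0 ?sqr_ge0//.
have := sqr_ge0 (u x - v x); have := sqr_ge0 (u x + v x).
have := sqr_ge0 (u x); have := sqr_ge0 (v x).
by rewrite ler_norml => *; apply/andP; split; nra.
Qed.

Lemma sqint_integrable u : sqint u -> P.-integrable setT (EFin \o u).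
Proof.
move=> hu; have h1 : sqint (fun=> 1) by apply: (@sqint_bounded _ 1) => // x; rewrite normr1.
have := sqint_integrableM hu h1; apply: eq_integrable => // x _ /=.
by rewrite mulr1.
Qed.

Lemma sqintZ a u : sqint u -> sqint (fun x => a * u x).
Proof.
move=> [mu iu]; split; first exact: measurable_funM.
have := integrableZl measurableT (a ^+ 2) iu; apply: eq_integrable => // x _ /=.
by rewrite exprMn.
Qed.

Lemma sqintD u v : sqint u -> sqint v -> sqint (fun x => u x + v x).
Proof.
move=> hu hv; have [mu iu] := hu; have [mv iv] := hv.
split; first exact: measurable_funD.
have := integrableD measurableT (integrableD measurableT iu iv)
  (integrableZl measurableT 2 (sqint_integrableM hu hv)).
apply: eq_integrable => // x _ /=; rewrite -!EFinD; congr EFin; ring.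
Qed.

Lemma eq_sqint u v : u =1 v -> sqint u -> sqint v.
Proof. by move=> /funext->. Qed.

Lemma sqintB u v : sqint u -> sqint v -> sqint (fun x => u x - v x).
Proof.
move=> hu hv; apply: eq_sqint (sqintD hu (sqintZ (-1) hv)) => x.
by rewrite mulN1r.
Qed.

Lemma sqint_sum (I : Type) (s : seq I) (p : pred I) (F : I -> T -> R) :
  (forall i, p i -> sqint (F i)) -> sqint (fun x => \sum_(i <- s | p i) F i x).
Proof.
move=> hF; elim: s => [|i s IH].
  apply: (@eq_sqint (fun=> 0)); first by move=> x; rewrite big_nil.
  by apply: (@sqint_bounded _ 0) => // x; rewrite normr0.
have [pi|npi] := boolP (p i).
  by apply: eq_sqint (sqintD (hF i pi) IH) => x; rewrite big_cons pi.
by apply: eq_sqint IH => x; rewrite big_cons (negbTE npi).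
Qed.

Lemma E_sqrD u v : sqint u -> sqint v ->
  E (fun x => (u x + v x) ^+ 2) =
  E (fun x => u x ^+ 2) + E (fun x => v x ^+ 2) + 2 * E (fun x => u x * v x).
Proof.
move=> hu hv; have i3 := sqint_integrableM hu hv.
have [_ i1] := hu; have [_ i2] := hv.
have i32 : P.-integrable setT (EFin \o (fun x => 2 * (u x * v x))).
  by have := integrableZl measurableT 2 i3; apply: eq_integrable.
have i12 : P.-integrable setT (EFin \o (fun x => u x ^+ 2 + v x ^+ 2)).
  by have := integrableD measurableT i1 i2; apply: eq_integrable.
rewrite -RintegralZl// -RintegralD// -RintegralD//.
by apply: eq_Rintegral => x _; ring.
Qed.

Lemma E_sqr_ge0 u : 0 <= E (fun x => u x ^+ 2).
Proof. by apply: Rintegral_ge0 => x _; exact: sqr_ge0. Qed.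

Lemma E_sqrD_le u v : sqint u -> sqint v ->
  E (fun x => (u x + v x) ^+ 2) <= 2 * E (fun x => u x ^+ 2) + 2 * E (fun x => v x ^+ 2).
Proof.
move=> hu hv; have h := E_sqrD hu (sqintZ (-1) hv).
have h0 := E_sqr_ge0 (fun x => u x + -1 * v x).
have e1 : E (fun x => (-1 * v x) ^+ 2) = E (fun x => v x ^+ 2).
  by apply: eq_Rintegral => x _; rewrite mulN1r sqrrN.
have e2 : E (fun x => u x * (-1 * v x)) = - E (fun x => u x * v x).
  rewrite -[RHS]mulN1r -RintegralZl//; last exact: sqint_integrableM.
  by apply: eq_Rintegral => x _; ring.
by move: h0; rewrite h e1 e2 (E_sqrD hu hv); lra.
Qed.

Lemma E_sqr_EFin u : sqint u ->
  (\int[P]_x (u x ^+ 2)%:E = (E (fun x => u x ^+ 2))%:E)%E.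
Proof. by move=> [_ iu]; rewrite /Rintegral fineK//; exact: integrable_fin_num. Qed.

(** Pointwise, [`|u|] is at most [e] or at most [u ^+ 2 / e]. *)
Lemma E_norm_le u e : 0 < e -> sqint u ->
  E (fun x => `|u x|) <= e + E (fun x => u x ^+ 2) / e.
Proof.
move=> e0 hu; have [_ i2] := hu; have i1 := sqint_integrable hu.
have ia : P.-integrable setT (EFin \o (fun x => `|u x|)).
  by have := integrable_abse i1; apply: eq_integrable.
have i2e : P.-integrable setT (EFin \o (fun x => e^-1 * u x ^+ 2)).
  by have := integrableZl measurableT e^-1 i2; apply: eq_integrable.
have ic := @finite_measure_integrable_cst _ _ _ P setT e measurableT.
have i3 : P.-integrable setT (EFin \o (fun x => e + e^-1 * u x ^+ 2)).
  by have := integrableD measurableT ic i2e; apply: eq_integrable.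
apply: (@le_trans _ _ (E (fun x => e + e^-1 * u x ^+ 2))).
  apply: le_Rintegral => // x _; rewrite -(real_normK (num_real (u x))).
  have [ue|ue] := leP `|u x| e.
    by rewrite (le_trans ue)// lerDl mulr_ge0 ?sqr_ge0// invr_ge0 ltW.
  apply: (@le_trans _ _ (e^-1 * `|u x| ^+ 2)); last by rewrite lerDr ltW.
  by rewrite ler_pdivlMl// expr2 ler_wpM2r// ltW.
by rewrite RintegralD// Rintegral_cst1 RintegralZl// mulrC.
Qed.

End SquareIntegrable.

Section Fourier.
Variable R : realType.
Local Notation E u := (Rintegral (circle R) setT u).
Local Notation sqint := (sqint (circle R)).

Lemma trig_sqint (S : set R) u : trig S u -> sqint u.
Proof.
move=> hu; have [B uB] := trig_bounded hu.
by apply: (@sqint_bounded _ _ _ (circle R) _ B) => //; exact: trig_measurable hu.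
Qed.

Lemma waveM v v' (P Q P' Q' x : R) : wave v P Q x * wave v' P' Q' x =
  wave (v - v') ((P * P' + Q * Q') / 2) ((Q * P' - P * Q') / 2) x +
  wave (v + v') ((P * P' - Q * Q') / 2) ((P * Q' + Q * P') / 2) x.
Proof.
rewrite /wave intrB intrD.
have -> : 2 * pi * (v%:~R - v'%:~R) * x = 2 * pi * v%:~R * x - 2 * pi * v'%:~R * x by ring.
have -> : 2 * pi * (v%:~R + v'%:~R) * x = 2 * pi * v%:~R * x + 2 * pi * v'%:~R * x by ring.
by rewrite cosB sinB cosD sinD; field.
Qed.

Lemma E_wave v (P Q : R) : E (wave v P Q) = P * (v == 0)%:R.
Proof.
case: eqVneq => [->|v0].
  rewrite mulr1 -[RHS](Rintegral_cst1 (circle R)); apply: eq_Rintegral => x _.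
  by rewrite /wave mulr0 mul0r cos0 sin0 mulr1 mulr0 addr0.
rewrite mulr0; apply: trig_Ezero; apply: trig_wave => //=.
Qed.

Lemma E_waveM (j k : nat) (P Q P' Q' : R) : (0 < j)%N ->
  E (fun x => wave j P Q x * wave k P' Q' x) = (P * P' + Q * Q') / 2 * (j == k)%:R.
Proof.
move=> j0.
transitivity (E (fun x => wave (j%:Z - k%:Z) ((P * P' + Q * Q') / 2) ((Q * P' - P * Q') / 2) x +
  wave (j%:Z + k%:Z) ((P * P' - Q * Q') / 2) ((P * Q' + Q * P') / 2) x)).
  by apply: eq_Rintegral => x _; rewrite waveM.
rewrite RintegralD//; last 2 first.
- exact: trig_integrable (trig_wave (A := setT) _ _ I).
- exact: trig_integrable (trig_wave (A := setT) _ _ I).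
rewrite !E_wave subr_eq0 eqz_nat -PoszD eqz_nat addn_eq0 eqn0Ngt j0/=.
by rewrite mulr0 addr0.
Qed.

Definition fourier_sum (f : R -> R) (D : nat) (x : R) : R :=
  \sum_(1 <= j < D.+1) wave j (fourier_cos f j) (fourier_sin f j) x.

Definition freqs_le (D : nat) : set R := freqs [set z : int | (`|z| <= D)%N].

Lemma trig_fourier_sum f D : trig (freqs_le D) (fourier_sum f D).
Proof.
rewrite /fourier_sum.
apply: eq_trig (trig_sum (index_iota 1 D.+1) (P := fun j => (1 <= j < D.+1)%N) _).
  by move=> x; rewrite [RHS]big_nat_cond [LHS]big_seq_cond [RHS]big_seq_cond;
    apply: eq_bigl => j; rewrite mem_index_iota andbT andbb.
by move=> j /andP[_ jD]; exact: trig_wave.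
Qed.

Section f.
Variable f : R -> R.
Hypothesis hf : sqint f.
Hypothesis f0 : E f = 0.

Lemma E_f_wave (j : nat) P Q : (0 < j)%N ->
  E (fun x => f x * wave j P Q x) = (P * fourier_cos f j + Q * fourier_sin f j) / 2.
Proof.
move=> j0.
have S (th : R) : sqint (fun x => cos (2 * pi * j%:R * x + th)).
  exact: (trig_sqint (trig_cos (S := setT) _ I)).
have ic : (circle R).-integrable setT (EFin \o (fun x => f x * cos (2 * pi * j%:R * x))).
  by have := sqint_integrableM hf (S 0); apply: eq_integrable => // x _ /=; rewrite addr0.
have is_ : (circle R).-integrable setT (EFin \o (fun x => f x * sin (2 * pi * j%:R * x))).
  have := sqint_integrableM hf (S (- (pi / 2))); apply: eq_integrable => // x _ /=.
  by rewrite cosBpihalf.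
have icZ : (circle R).-integrable setT (EFin \o (fun x => P * (f x * cos (2 * pi * j%:R * x)))).
  by have := integrableZl measurableT P ic; apply: eq_integrable.
have isZ : (circle R).-integrable setT (EFin \o (fun x => Q * (f x * sin (2 * pi * j%:R * x)))).
  by have := integrableZl measurableT Q is_; apply: eq_integrable.
transitivity (E (fun x => P * (f x * cos (2 * pi * j%:R * x)) + Q * (f x * sin (2 * pi * j%:R * x)))).
  by apply: eq_Rintegral => x _; rewrite /wave; ring.
rewrite RintegralD// !RintegralZl// /fourier_cos /fourier_sin.
by field.
Qed.

Lemma E_sum_wave (D k : nat) P Q : (k <= D)%N -> (0 < k)%N ->
  E (fun x => fourier_sum f D x * wave k P Q x) =
  (P * fourier_cos f k + Q * fourier_sin f k) / 2.
Proof.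
move=> kD k0.
have -> : E (fun x => fourier_sum f D x * wave k P Q x) =
    E (fun x => \sum_(1 <= j < D.+1)
       (wave j (fourier_cos f j) (fourier_sin f j) x * wave k P Q x)).
  by apply: eq_Rintegral => x _; rewrite /fourier_sum mulr_suml.
rewrite (@trig_E_sum _ setT); last first.
  move=> j _; apply: (@trigM _ setT setT) => //.
    exact: trig_sub (trig_wave (A := setT) _ _ I).
  exact: trig_sub (trig_wave (A := setT) _ _ I).
rewrite (bigD1_seq k) ?iota_uniq ?mem_index_iota ?k0//=.
rewrite big_seq_cond big1; last first.
  move=> j /andP[]; rewrite mem_index_iota => /andP[j0 _] /negbTE jk.
  by rewrite E_waveM// jk mulr0.
by rewrite addr0 E_waveM// eqxx mulr1; field.
Qed.

(** The partial sum is the orthogonal projection of [f] on the trigonometric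
    polynomials of degree at most [D]. *)
Lemma residual_orth D t : trig (freqs_le D) t ->
  E (fun x => (f x - fourier_sum f D x) * t x) = 0.
Proof.
have hp := trig_sqint (trig_fourier_sum f D).
have hr := sqintB hf hp.
elim=> [|w th [z zD <-]|a u v hu IHu hv IHv].
- by under eq_Rintegral do rewrite mulr0; rewrite Rintegral_cst1.
- have [s sE] : exists s, forall x,
      cos (2 * pi * z%:~R * x + th) = wave `|z|%N (cos th) s x.
    case: z zD => k _ /=.
      by exists (- sin th) => x; rewrite /wave cosD; ring.
    exists (sin th) => x; rewrite /wave NegzE mulrNz cosD mulrN mulNr cosN sinN.
    by ring.
  have -> : E (fun x => (f x - fourier_sum f D x) * cos (2 * pi * z%:~R * x + th)) =
      E (fun x => f x * wave `|z|%N (cos th) s x - fourier_sum f D x * wave `|z|%N (cos th) s x).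
    by apply: eq_Rintegral => x _; rewrite sE; ring.
  have hw := trig_sqint (trig_wave (A := setT) (v := `|z|%N) (cos th) s I).
  rewrite RintegralB//; last 2 first.
  - exact: sqint_integrableM.
  - exact: sqint_integrableM.
  move: zD; rewrite /=; case: (posnP `|z|%N) => [-> _|z0 zD].
    have w0 x : wave 0%N (cos th) s x = cos th.
      by rewrite /wave mulr0 mul0r cos0 sin0 mulr1 mulr0 addr0.
    under eq_Rintegral do rewrite w0.
    rewrite RintegralZr ?f0 ?mul0r//; last exact: sqint_integrable.
    under eq_Rintegral do rewrite w0.
    rewrite RintegralZr//; last exact: sqint_integrable.
    suff -> : E (fourier_sum f D) = 0 by rewrite mul0r subr0.
    rewrite /fourier_sum (@trig_E_sum _ (freqs setT)); last by move=> j _; exact: trig_wave.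
    rewrite big_seq big1// => j; rewrite mem_index_iota => /andP[j0 _].
    by rewrite E_wave eqz_nat eqn0Ngt j0 mulr0.
  by rewrite E_f_wave// E_sum_wave// subrr.
- have hu' := trig_sqint hu; have hv' := trig_sqint hv.
  have iu := sqint_integrableM hr hu'; have iv := sqint_integrableM hr hv'.
  have iau : (circle R).-integrable setT
      (EFin \o (fun x => a * ((f x - fourier_sum f D x) * u x))).
    by have := integrableZl measurableT a iu; apply: eq_integrable.
  transitivity (E (fun x => a * ((f x - fourier_sum f D x) * u x) +
      (f x - fourier_sum f D x) * v x)).
    by apply: eq_Rintegral => x _; ring.
  by rewrite RintegralD// RintegralZl// IHu IHv mulr0 addr0.
Qed.

Lemma residual_pythagoras D t : trig (freqs_le D) t ->
  E (fun x => (f x - t x) ^+ 2) =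
  E (fun x => (f x - fourier_sum f D x) ^+ 2) + E (fun x => (fourier_sum f D x - t x) ^+ 2).
Proof.
move=> ht; have tp := trig_fourier_sum f D.
have hr := sqintB hf (trig_sqint tp); have hd := trigB tp ht.
have -> : E (fun x => (f x - t x) ^+ 2) =
    E (fun x => ((f x - fourier_sum f D x) + (fourier_sum f D x - t x)) ^+ 2).
  by apply: eq_Rintegral => x _; rewrite subrKA.
by rewrite (E_sqrD hr (trig_sqint hd)) (residual_orth hd) mulr0 addr0.
Qed.

Lemma freqs_le_exists t : trig (freqs setT) t -> exists D, trig (freqs_le D) t.
Proof.
elim=> [|w th [z _ <-]|a u v _ [D1 h1] _ [D2 h2]].
- by exists 0%N; exact: trig0.
- by exists `|z|%N; apply: trig_cos; exists z => /=.
- exists (maxn D1 D2); apply: trig_lin.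
    apply: trig_sub h1 => _ [z zD <-]; exists z => //=.
    by rewrite (leq_trans zD)// leq_maxl.
  apply: trig_sub h2 => _ [z zD <-]; exists z => //=.
  by rewrite (leq_trans zD)// leq_maxr.
Qed.

(** The partial sums are best approximations, so convergence follows from the
    density of trigonometric polynomials. *)
Lemma fourier_sum_cvg (fL : f \in Lfun (circle R) 2%:E) e : 0 < e ->
  exists D0, forall D, (D0 <= D)%N -> E (fun x => (f x - fourier_sum f D x) ^+ 2) <= e.
Proof.
move=> e0; have [t tt ft] := l2approx_Lfun fL e0.
have [D0 t0] := freqs_le_exists tt; exists D0 => D DD.
have tD : trig (freqs_le D) t.
  by apply: trig_sub t0 => _ [z zD <-]; exists z => //=; rewrite (leq_trans zD).
have : E (fun x => (f x - t x) ^+ 2) <= e.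
  have h := sqintB hf (trig_sqint tt).
  by move: ft; rewrite /l2le (E_sqr_EFin h) lee_fin.
rewrite (residual_pythagoras tD); have := E_sqr_ge0 (circle R) (fun x => fourier_sum f D x - t x).
lra.
Qed.

Lemma fourier_sum_norm D :
  E (fun x => f x ^+ 2) = E (fun x => (f x - fourier_sum f D x) ^+ 2) +
    E (fun x => fourier_sum f D x ^+ 2).
Proof.
have := residual_pythagoras (trig0 (freqs_le D)).
by under eq_Rintegral do rewrite subr0; move=> ->; under [X in _ + X = _]eq_Rintegral do rewrite subr0.
Qed.

End f.

Lemma Lfun_sqint (f : R -> R) : f \in Lfun (circle R) 2%:E -> sqint f.
Proof.
move=> fL; split; last exact: Lfun2_integrable_sqr.
by move: fL; rewrite inE => /andP[]; rewrite inE.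
Qed.

Lemma L2normE (f : R -> R) : sqint f -> L2norm f = Num.sqrt (E (fun x => f x ^+ 2)).
Proof.
move=> hf; rewrite /L2norm unlock /Lnorm.
rewrite (_ : (\int[circle R]_x _)%E = (E (fun x => f x ^+ 2))%:E).
  by rewrite poweR_EFin/= powR12_sqrt// E_sqr_ge0.
rewrite -E_sqr_EFin//; apply: eq_integral => x _ /=.
by rewrite powR_mulrn// real_normK ?num_real.
Qed.

End Fourier.

(** * Power tails and Schur's test *)

Section PowerTail.
Variable R : realType.

(** One step of the comparison with the integral: [- x ^ (- s) / s] is a
    primitive of the power. *)
Lemma powR_tail_step (s : R) (j : nat) : 0 < s -> (1 < j)%N ->
  j%:R `^ (- (s + 1)) <= s^-1 * (j.-1%:R `^ (- s) - j%:R `^ (- s)).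
Proof.
move=> s0 j1; have j0 : 0 < j%:R :> R by rewrite ltr0n (ltn_trans _ j1).
have p0 : 0 < j.-1%:R :> R by rewrite ltr0n -ltnS prednK// (ltn_trans _ j1).
have jE : j.-1%:R = j%:R * (1 - j%:R^-1) :> R.
  rewrite mulrBr mulfV ?gt_eqF// mulr1 -[in RHS](prednK (ltn_trans _ j1))//.
  by rewrite -natr1 addrK.
have u0 : 0 < 1 - j%:R^-1 :> R.
  by rewrite subr_gt0 invf_lt1// ltr1n.
rewrite ler_pdivlMl// jE powRM ?(ltW j0) ?(ltW u0)// opprD powRD; last by apply/implyP => _; rewrite gt_eqF.
rewrite powR_inv1; last exact: ltW.
have -> : (1 - j%:R^-1) `^ (- s) = expR (- s * ln (1 - j%:R^-1)) :> R.
  by rewrite /powR gt_eqF.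
have h1 : ln (1 - j%:R^-1) <= - j%:R^-1 :> R.
  by have := @le_ln1Dx R (- j%:R^-1); rewrite ltrNl opprK => -> //; rewrite invf_lt1// ltr1n.
have h2 := expR_ge1Dx (- s * ln (1 - j%:R^-1)).
have h3 : 0 < j%:R `^ (- s) :> R by rewrite powR_gt0.
set e := expR _ in h2 *; set L := ln _ in h1 h2; set u := _^-1 in h1 *.
have : 1 + s * u <= e by nra.
by move=> H; have := ler_wpM2l (ltW h3) H; lra.
Qed.

Lemma powR_tail (s : R) (D D' : nat) : 0 < s -> (0 < D)%N ->
  \sum_(D.+1 <= j < D'.+1) j%:R `^ (- (s + 1)) <= s^-1 * D%:R `^ (- s).
Proof.
move=> s0 D0.
have [DD|DD] := leqP D' D.
  rewrite big_geq//; first by rewrite mulr_ge0 ?powR_ge0// invr_ge0 ltW.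
suff : \sum_(D.+1 <= j < D'.+1) j%:R `^ (- (s + 1)) <=
   s^-1 * (D%:R `^ (- s) - D'%:R `^ (- s)).
  move=> /le_trans; apply; rewrite ler_wpM2l ?invr_ge0 ?(ltW s0)//.
  by rewrite lerBlDr lerDl powR_ge0.
elim: D' DD => // D' IH; rewrite ltnS leq_eqVlt => /predU1P[<-|DD].
  by rewrite big_nat1; exact: powR_tail_step.
rewrite big_nat_recr//=; last exact: ltnW.
have h := @powR_tail_step s D'.+1 s0 (ltn_trans D0 DD).
have := IH DD; rewrite /= in h; lra.
Qed.

Lemma powR_tail_small (s e : R) : 0 < s -> 0 < e ->
  exists2 D0, (0 < D0)%N & forall D D', (D0 <= D)%N ->
    \sum_(D.+1 <= j < D'.+1) j%:R `^ (- (s + 1)) <= e.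
Proof.
move=> s0 e0; pose X := (s * e)^-1.
have X0 : 0 < X by rewrite invr_gt0 mulr_gt0.
pose D0 := (Num.truncn (X `^ s^-1)).+1; exists D0 => // D D' DD.
have D_gt0 : (0 < D)%N by rewrite (leq_trans _ DD).
have XD : X `^ s^-1 <= D%:R.
  apply: (@le_trans _ _ D0%:R); first exact: ltW (truncnS_gt _).
  by rewrite ler_nat.
apply: (le_trans (powR_tail _ s0 D_gt0)).
rewrite ler_pdivrMl// powRN -[s * e]invrK lef_pV2 ?posrE ?powR_gt0 ?ltr0n//.
have XE : X = (X `^ s^-1) `^ s.
  by rewrite -powRrM mulVf ?gt_eqF// powRr1// ltW.
rewrite -/X [leLHS]XE.
by apply: ge0_ler_powR; rewrite ?nnegrE ?powR_ge0 ?(ltW s0) ?ler0n.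
Qed.

End PowerTail.

Section Schur.
Variable R : realType.

Lemma geom_le (th : R) (N : nat) : 0 <= th < 1 -> \sum_(i < N) th ^+ i <= (1 - th)^-1.
Proof.
move=> /andP[t0 t1]; have d0 : 0 < 1 - th by lra.
rewrite -[leRHS]mul1r ler_pdivlMr//.
have := @subrX1 _ th N; rewrite mulrC -opprB => h.
have : 0 <= th ^+ N by rewrite exprn_ge0.
by lra.
Qed.

Lemma schur_row (th : R) (k N : nat) : 0 <= th < 1 ->
  \sum_(l < N) th ^+ `|k - l| <= 2 / (1 - th).
Proof.
move=> /[dup] h /andP[t0 t1].
have -> : 2 / (1 - th) = (1 - th)^-1 + (1 - th)^-1 by ring.
have tn i : 0 <= th ^+ i by rewrite exprn_ge0.
rewrite (bigID (fun l : 'I_N => (l <= k)%N))/=; apply: lerD.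
  apply: le_trans (geom_le k.+1 h).
  rewrite [leRHS](reindex_inj rev_ord_inj)/=.
  under [leRHS]eq_bigr do rewrite subSS.
  rewrite -[leRHS](big_mkord xpredT (fun i => th ^+ (k - i))).
  rewrite -(big_mkord (fun l => (l <= k)%N) (fun l => th ^+ `|k - l|)).
  rewrite (@big_nat_widen _ _ _ 0 k.+1 (maxn N k.+1)) ?leq_maxr//.
  rewrite (@big_nat_widen _ _ _ 0 N (maxn N k.+1)) ?leq_maxl//.
  rewrite big_mkcond [leRHS]big_mkcond/=; apply: ler_sum => i _.
  rewrite ltnS; case ik: (i <= k)%N => //=; case: ifP => // _.
  by rewrite distnEl.
apply: le_trans (geom_le N h).
rewrite -[leRHS](big_mkord xpredT (fun i => th ^+ i)).
rewrite -(big_mkord (fun l => ~~ (l <= k)%N) (fun l => th ^+ `|k - l|)).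
have [Nk|kN] := leqP N k.
  rewrite big_nat_cond big1 ?sumr_ge0// => i /andP[/andP[_ iN]].
  by rewrite -ltnNge ltnNge (leq_trans (ltnW iN) Nk).
rewrite (big_cat_nat (n := k)) //=; last exact: ltnW.
rewrite big_nat_cond big1 ?add0r; last first.
  by move=> i /andP[/andP[_ ik]]; rewrite -ltnNge ltnNge (ltnW ik).
rewrite -{1}[k]add0n big_addn.
apply: (@le_trans _ _ (\sum_(0 <= i < N - k) th ^+ i)).
  rewrite big_mkcond/=; apply: ler_sum => i _; case: ifP => // _.
  by rewrite distnEr ?leq_addl// addnK.
rewrite [leRHS](big_cat_nat (n := N - k)) ?leq_subr//= lerDl.
by rewrite sumr_ge0.
Qed.

(** Since [2 * c k * c l <= c k ^+ 2 + c l ^+ 2], it suffices to sum the rows of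
    the kernel. *)
Lemma schur (th : R) (N : nat) (c : nat -> R) : 0 <= th < 1 ->
  \sum_(k < N) \sum_(l < N) c k * c l * th ^+ `|k - l| <=
  2 / (1 - th) * \sum_(k < N) c k ^+ 2.
Proof.
move=> h; have th0 : 0 <= th by case/andP: h.
apply: (@le_trans _ _ (\sum_(k < N) \sum_(l < N)
   (c k ^+ 2 / 2 * th ^+ `|k - l| + c l ^+ 2 / 2 * th ^+ `|k - l|))).
  apply: ler_sum => k _; apply: ler_sum => l _.
  rewrite -mulrDl ler_wpM2r ?exprn_ge0//.
  by have := sqr_ge0 (c k - c l); nra.
under eq_bigr do rewrite big_split/=.
rewrite big_split/= [X in _ + X]exchange_big/=.
rewrite mulr_sumr.
have row (k : 'I_N) : \sum_(l < N) c k ^+ 2 / 2 * th ^+ `|k - l| <=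
   (1 - th)^-1 * c k ^+ 2.
  rewrite -mulr_sumr; have := schur_row k N h.
  by have := sqr_ge0 (c k); nra.
have -> : \sum_(i < N) 2 / (1 - th) * c i ^+ 2 =
  \sum_(i < N) (1 - th)^-1 * c i ^+ 2 + \sum_(i < N) (1 - th)^-1 * c i ^+ 2.
  by rewrite -big_split/=; apply: eq_bigr => i _; ring.
apply: lerD; apply: ler_sum => k _; first exact: row.
by under eq_bigr do rewrite distnC; exact: row.
Qed.

End Schur.

(** * Almost orthogonality along a lacunary sequence *)

Section Lacunary.
Variable R : realType.
Local Notation E u := (Rintegral (circle R) setT u).

Lemma sum_le_unique (I : eqType) (s : seq I) (p : pred I) (F : I -> R) (X : R) :
  uniq s -> 0 <= X -> (forall i i', i \in s -> i' \in s -> p i -> p i' -> i = i') ->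
  (forall i, i \in s -> p i -> F i <= X) -> \sum_(i <- s) F i * (p i)%:R <= X.
Proof.
move=> us X0 pU FX.
have [[i is_ pi]|np] := pselect (exists2 i, i \in s & p i).
  rewrite (bigD1_seq i)//= pi mulr1 big_seq_cond big1 ?addr0 ?FX//.
  move=> j /andP[js ji]; case pj: (p j); last by rewrite mulr0.
  by rewrite (pU _ _ js is_ pj pi) eqxx in ji.
rewrite big_seq big1// => i is_; case pi: (p i); last by rewrite mulr0.
by case: np; exists i.
Qed.

Section pair.
Variables (q rho M : R) (q1 : 1 < q) (rho0 : 0 < rho) (M0 : 0 < M).
Let th := q `^ (- rho).
Let W (j : nat) := M * j%:R `^ (- rho).

Lemma theta01 : 0 <= th < 1.
Proof.
have q0 : 0 < q := lt_trans ltr01 q1.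
rewrite powR_ge0/= /th powRN invf_lt1 ?powR_gt0//.
have : 1 `^ rho < q `^ rho.
  by apply: gt0_ltr_powR => //; rewrite nnegrE// ltW.
by rewrite powR1.
Qed.

(** Each [j'] meets at most one [j], and then [q ^+ m * j' <= j]: the coefficient
    of index [j] is smaller by the factor [th ^+ m].  This is where correlations
    along a lacunary sequence decay. *)
Lemma coincidence_le (nk nl m D D' : nat) : (0 < nk)%N -> (0 < nl)%N ->
  q ^+ m * nk%:R <= nl%:R ->
  \sum_(D.+1 <= j < D'.+1) \sum_(D.+1 <= j' < D'.+1)
     W j * W j' * (j * nk == j' * nl)%N%:R <=
  th ^+ m * (M ^+ 2 * \sum_(D.+1 <= j < D'.+1) j%:R `^ (- (2 * rho))).
Proof.
move=> nk0 nl0 hq; have q0 : 0 < q := lt_trans ltr01 q1.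
rewrite exchange_big/= !mulr_sumr big_seq [leRHS]big_seq.
apply: ler_sum => j' j'D.
have j'0 : (0 < j')%N by move: j'D; rewrite mem_index_iota => /andP[] /(leq_trans _) ->.
have j'0R : 0 < j'%:R :> R by rewrite ltr0n.
have th0 : 0 <= th by case/andP: theta01.
apply: sum_le_unique.
- exact: iota_uniq.
- by rewrite !mulr_ge0 ?exprn_ge0 ?powR_ge0// ltW.
- by move=> i i' _ _ /eqP <- /eqP /eqP; rewrite eqn_pmul2r// => /eqP.
move=> j jD /eqP jE.
have j0 : (0 < j)%N by move: jD; rewrite mem_index_iota => /andP[] /(leq_trans _) ->.
have qj : q ^+ m * j'%:R <= j%:R.
  have nk0R : 0 < nk%:R :> R by rewrite ltr0n.
  rewrite -(ler_pM2r nk0R) -natrM jE natrM mulrAC mulrC.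
  by rewrite ler_wpM2l// ltW.
have thm : th ^+ m = (q ^+ m) `^ (- rho).
  by rewrite /th -!powR_mulrn ?powR_ge0 ?(ltW q0)// -!powRrM mulrC.
have hW : j%:R `^ (- rho) <= th ^+ m * j'%:R `^ (- rho).
  rewrite thm -powRM ?exprn_ge0 ?(ltW q0)//.
  have qj0 : 0 < q ^+ m * j'%:R by rewrite mulr_gt0 ?exprn_gt0.
  rewrite !powRN lef_pV2 ?posrE ?powR_gt0 ?ltr0n//.
  by apply: ge0_ler_powR => //; rewrite ?nnegrE ?(ltW rho0) ?(ltW qj0).
have e2 : j'%:R `^ (- (2 * rho)) = j'%:R `^ (- rho) * j'%:R `^ (- rho) :> R.
  rewrite -powRD; first by congr (_ `^ _); ring.
  by apply/implyP => _; rewrite gt_eqF.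
rewrite e2 /W.
have h := powR_ge0 (j'%:R : R) (- rho).
have -> : M * j%:R `^ (- rho) * (M * j'%:R `^ (- rho)) =
  (M ^+ 2 * j'%:R `^ (- rho)) * j%:R `^ (- rho) by ring.
have -> : th ^+ m * (M ^+ 2 * (j'%:R `^ (- rho) * j'%:R `^ (- rho))) =
  (M ^+ 2 * j'%:R `^ (- rho)) * (th ^+ m * j'%:R `^ (- rho)) by ring.
by rewrite ler_wpM2l// mulr_ge0// sqr_ge0.
Qed.

End pair.

Section lac.
Variables (n : nat -> nat) (K0 : nat) (q : R).
Hypothesis q1 : 1 < q.
Hypothesis n0 : forall k, (K0 <= k)%N -> (0 < n k)%N.
Hypothesis nq : forall k, (K0 <= k)%N -> q * (n k)%:R <= (n k.+1)%:R.

Lemma lac_growth k m : (K0 <= k)%N -> q ^+ m * (n k)%:R <= (n (k + m))%:R.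
Proof.
move=> Kk; elim: m => [|m IH]; first by rewrite expr0 mul1r addn0.
rewrite addnS exprS -mulrA; apply: le_trans (nq _); last exact: leq_trans (leq_addr _ _).
by rewrite ler_wpM2l// ltW// (lt_trans ltr01).
Qed.

Lemma wave_scale (v m : nat) (P Q x : R) : wave v P Q (m%:R * x) = wave (v * m)%N P Q x.
Proof.
rewrite /wave.
have -> : 2 * pi * v%:~R * (m%:R * x) = 2 * pi * (v * m)%N%:~R * x.
  by rewrite -!pmulrn natrM; ring.
by [].
Qed.

(** The [k]-th and the [l]-th terms have correlation at most [th ^+ `|k - l|]
    times the tail of the squared coefficients, so Schur's test applies. *)
Lemma lacunary_L2 (a b : nat -> R) (M rho : R) (c : nat -> R) (N D D' : nat) :
  0 < rho -> 0 < M ->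
  (forall j, (1 <= j)%N -> `|a j| + `|b j| <= M * j%:R `^ (- rho)) ->
  (forall k, 0 <= c k) -> (forall k, (k < K0)%N -> c k = 0) ->
  E (fun x => (\sum_(k < N) c k *
     \sum_(D.+1 <= j < D'.+1) wave j (a j) (b j) ((n k)%:R * x)) ^+ 2) <=
  2 / (1 - q `^ (- rho)) * M ^+ 2 *
    (\sum_(D.+1 <= j < D'.+1) j%:R `^ (- (2 * rho))) * \sum_(k < N) c k ^+ 2.
Proof.
move=> rho0 M0 hab c0 cK.
pose s := [seq (k, j) | k <- index_iota 0 N, j <- index_iota D.+1 D'.+1].
pose W (j : nat) := M * j%:R `^ (- rho).
have W0 j : 0 <= W j by rewrite mulr_ge0 ?powR_ge0// ltW.
pose P (i : nat * nat) := if (0 < i.2)%N then c i.1 * a i.2 else 0.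
pose Q (i : nat * nat) := if (0 < i.2)%N then c i.1 * b i.2 else 0.
pose V (i : nat * nat) := (i.2 * n i.1)%N.
have -> : E (fun x => (\sum_(k < N) c k *
     \sum_(D.+1 <= j < D'.+1) wave j (a j) (b j) ((n k)%:R * x)) ^+ 2) =
   E (fun x => (\sum_(i <- s) wave (V i) (P i) (Q i) x) ^+ 2).
  apply: eq_Rintegral => x _; congr (_ ^+ 2).
  rewrite big_allpairs_dep/= big_mkord; apply: eq_bigr => k _.
  rewrite mulr_sumr big_seq [RHS]big_seq; apply: eq_bigr => j.
  rewrite mem_index_iota => /andP[/(leq_trans _) j0 _].
  by rewrite wave_scale /V /P /Q/= j0// /wave; ring.
have hW i : `|P i| + `|Q i| <= c i.1 * W i.2.
  rewrite /P /Q; case: ifPn => j0.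
    by rewrite !normrM ger0_norm// -mulrDr ler_wpM2l// hab.
  by rewrite normr0 addr0 mulr_ge0.
apply: le_trans (E_waves_le s V hW) _.
rewrite big_allpairs_dep/= big_mkord.
set tau := \sum_(D.+1 <= j < D'.+1) j%:R `^ (- (2 * rho)).
have tau0 : 0 <= tau by apply: sumr_ge0 => j _; exact: powR_ge0.
have th01 := theta01 q1 rho0.
set th := q `^ (- rho) in th01 *.
have key (k l : nat) : c k * c l * \sum_(D.+1 <= j < D'.+1) \sum_(D.+1 <= j' < D'.+1)
     W j * W j' * (j * n k == j' * n l)%N%:R <=
     M ^+ 2 * tau * (c k * c l * th ^+ `|k - l|).
  wlog kl : k l / (k <= l)%N.
    move=> H; have [/H//|/ltnW/H] := leqP k l.
    rewrite distnC [c l * c k]mulrC exchange_big/=.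
    under eq_bigr do under eq_bigr do rewrite mulrC [W _ * W _]mulrC mulrC eq_sym.
    by [].
  have [kK|Kk] := ltnP k K0; first by rewrite cK// !mul0r mulr0.
  have h := @coincidence_le q rho M q1 rho0 M0 (n k) (n l) (l - k) D D' (n0 Kk)
    (n0 (leq_trans Kk kl)).
  rewrite distnEr//.
  have -> : M ^+ 2 * tau * (c k * c l * th ^+ (l - k)) =
     c k * c l * (th ^+ (l - k) * (M ^+ 2 * tau)) by ring.
  rewrite ler_wpM2l ?mulr_ge0//; apply: h.
  by have := lac_growth (l - k) Kk; rewrite subnKC.
move: tau tau0 key => tau tau0 key.
apply: (@le_trans _ _ (\sum_(k < N) \sum_(l < N)
    M ^+ 2 * tau * (c k * c l * th ^+ `|k - l|))).
  apply: ler_sum => k _.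
  under eq_bigr do rewrite big_allpairs_dep/= big_mkord.
  rewrite exchange_big/=; apply: ler_sum => l _.
  apply: le_trans (key k l); rewrite mulr_sumr; apply: ler_sum => j _.
  rewrite mulr_sumr; apply: ler_sum => j' _.
  by rewrite /V/= le_eqVlt; apply/orP; left; apply/eqP; ring.
have -> : \sum_(k < N) \sum_(l < N) M ^+ 2 * tau * (c k * c l * th ^+ `|k - l|) =
    M ^+ 2 * tau * \sum_(k < N) \sum_(l < N) c k * c l * th ^+ `|k - l|.
  by rewrite mulr_sumr; apply: eq_bigr => k _; rewrite mulr_sumr.
have h := @schur R th N c th01.
rewrite [leRHS](_ : _ = M ^+ 2 * tau * (2 / (1 - th) * \sum_(k < N) c k ^+ 2)).
  by rewrite ler_wpM2l// mulr_ge0// sqr_ge0.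
by ring.
Qed.

End lac.
End Lacunary.

(** * Riesz products *)

Section RieszProduct.
Variable R : realType.
Implicit Types (y : nat -> R) (x th : R).

Lemma MVT0 (f df : R -> R) (x : R) : 0 <= x ->
  (forall z : R, is_derive z 1 f (df z)) -> exists2 c, 0 <= c <= x & f x - f 0 = df c * x.
Proof.
move=> x0 hd.
have cf : {within `[0, x], continuous f}.
  apply: continuous_subspaceT => z.
  have dd : derivable f z 1 by have := hd z => -[].
  by apply: differentiable_continuous; exact/derivable1_diffP.
have [c] := MVT_segment x0 (fun z _ => hd z) cf.
by rewrite in_itv/= subr0 => cx ->; exists c.
Qed.

Lemma cos_ge x : 1 - x ^+ 2 / 2 <= cos x.
Proof.
wlog x0 : x / 0 <= x.
  move=> H; have [/H//|x0] := leP 0 x.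
  by rewrite -cosN -sqrrN; apply: H; lra.
have sin_le (z : R) : 0 <= z -> sin z <= z.
  move=> z0; have [c /andP[c0 cz]] := MVT0 z0 (@is_derive_sin R).
  by rewrite sin0 subr0 => ->; have := cos_le1 c; nra.
have hd (z : R) : is_derive z 1 (fun z : R => cos z + z ^+ 2 / 2) (z - sin z).
  by apply: is_derive_eq; rewrite /GRing.scale/=; field.
have [c /andP[c0 cx]] := MVT0 x0 hd.
rewrite cos0 expr0n/= mul0r addr0 => h.
by have := sin_le _ c0; nra.
Qed.

Lemma sin_cubic x : `|sin x - x| <= `|x| ^+ 3.
Proof.
wlog x0 : x / 0 <= x.
  move=> H; have [/H//|x0] := leP 0 x.
  have := H (- x); rewrite sinN normrN -opprD normrN; apply; lra.
have hd (z : R) : is_derive z 1 (fun z : R => sin z - z) (cos z - 1).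
  by apply: is_derive_eq.
have [c /andP[c0 cx]] := MVT0 x0 hd.
rewrite sin0 subrr subr0 => ->; rewrite normrM (ger0_norm x0).
have h1 := cos_ge c; have h2 := cos_le1 c.
rewrite ler0_norm; last by lra.
rewrite exprSr ler_wpM2r//.
have : c ^+ 2 <= x ^+ 2 by rewrite ler_pXn2r.
by have := sqr_ge0 c; lra.
Qed.

Lemma cos_quartic x : `|cos x - 1 + x ^+ 2 / 2| <= `|x| ^+ 4.
Proof.
wlog x0 : x / 0 <= x.
  move=> H; have [/H//|x0] := leP 0 x.
  have := H (- x); rewrite cosN normrN sqrrN; apply; lra.
have hd (z : R) : is_derive z 1 (fun z : R => cos z - 1 + z ^+ 2 / 2) (z - sin z).
  by apply: is_derive_eq; rewrite /GRing.scale/=; field.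
have [c /andP[c0 cx]] := MVT0 x0 hd.
rewrite cos0 expr0n/= mul0r subrr addr0 subr0 => ->; rewrite normrM (ger0_norm x0).
rewrite exprSr ler_wpM2r//.
have := sin_cubic c; rewrite distrC => /le_trans; apply.
by rewrite ler_pXn2r ?nnegrE// ger0_norm.
Qed.

Lemma expR_quad (u : R) : 0 <= u -> 0 <= expR (- u) - 1 + u <= u ^+ 2.
Proof.
move=> u0; have h1 := expR_ge1Dx (- u); have h2 := expR_ge1Dx u.
apply/andP; split; first by lra.
have e0 := expR_gt0 u.
have h : expR (- u) * expR u = 1 by rewrite -expRD addNr expR0.
have e1 := expR_gt0 (- u).
have : expR (- u) * (1 + u) <= 1 by nra.
nra.
Qed.

Lemma expR_lip (x y : R) : 0 <= x -> 0 <= y -> `|expR (- x) - expR (- y)| <= `|x - y|.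
Proof.
wlog xy : x y / x <= y.
  move=> hw x0 y0; have [h|/ltW h] := leP x y; first exact: hw.
  by rewrite distrC [leRHS]distrC; exact: hw.
move=> x0 y0.
have -> : expR (- y) = expR (- x) * expR (- (y - x)).
  by rewrite -expRD; congr expR; ring.
have := expR_ge1Dx (- (y - x)).
have e1 : expR (- x) <= 1 by rewrite -[leRHS]expR0 ler_expR oppr_le0.
have e2 : expR (- (y - x)) <= 1 by rewrite -[leRHS]expR0 ler_expR oppr_le0 subr_ge0.
have e0 := expR_gt0 (- x).
move=> h; rewrite [leRHS]ler0_norm ?subr_le0//.
have -> : expR (- x) - expR (- x) * expR (- (y - x)) =
  expR (- x) * (1 - expR (- (y - x))) by ring.
have z0 : 0 <= 1 - expR (- (y - x)) by rewrite subr_ge0.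
rewrite ger0_norm; last by rewrite mulr_ge0// ltW.
apply: (@le_trans _ _ (1 - expR (- (y - x)))); last by lra.
by rewrite ler_piMl.
Qed.

(** Real and imaginary parts of
    [exp (i x) = (1 + i x) exp (- x^2 / 2) + O(|x|^3)]. *)
Lemma riesz_step x : `|x| <= 1 ->
  `|cos x - expR (- (x ^+ 2 / 2))| + `|sin x - x * expR (- (x ^+ 2 / 2))| <= 4 * `|x| ^+ 3.
Proof.
move=> x1; have x20 : 0 <= x ^+ 2 / 2 by rewrite divr_ge0// sqr_ge0.
have /andP[e1 e2] := expR_quad x20.
set g := expR _ in e1 e2 *.
have xe : x ^+ 2 = `|x| ^+ 2 by rewrite real_normK// num_real.
have a0 := normr_ge0 x; set a := `|x| in x1 xe a0 *.
have g1 : g <= 1 by rewrite /g -[leRHS]expR0 ler_expR oppr_le0.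
have h1 : `|cos x - g| <= 2 * a ^+ 3.
  have -> : cos x - g = (cos x - 1 + x ^+ 2 / 2) - (g - 1 + x ^+ 2 / 2) by ring.
  rewrite (le_trans (ler_normB _ _))//.
  have := cos_quartic x; rewrite -/a => hc.
  rewrite [`|g - _ + _|]ger0_norm//.
  have h4 : a ^+ 4 <= a ^+ 3 by rewrite exprS ler_piMl// exprn_ge0.
  have : (x ^+ 2 / 2) ^+ 2 <= a ^+ 4.
    rewrite xe exprMn -exprM; have : 0 <= a ^+ 4 by rewrite exprn_ge0.
    by lra.
  by lra.
have h2 : `|sin x - x * g| <= 2 * a ^+ 3.
  have -> : sin x - x * g = (sin x - x) + x * (1 - g) by ring.
  rewrite (le_trans (ler_normD _ _))// normrM -/a.
  have := sin_cubic x; rewrite -/a => hs.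
  rewrite [`|1 - g|]ger0_norm; last by lra.
  have : a * (1 - g) <= a ^+ 3.
    rewrite exprS ler_wpM2l// -xe; have := sqr_ge0 x; lra.
  by lra.
by lra.
Qed.

(** Real and imaginary parts of the product of the [1 + i y_j] for [j < i]. *)
Fixpoint riesz y (i : nat) : R * R :=
  if i is i'.+1 then
    ((riesz y i').1 - y i' * (riesz y i').2, (riesz y i').2 + y i' * (riesz y i').1)
  else (1, 0).

(** The modulus of [1 + i y] squared is [1 + y^2 <= exp (y^2)]. *)
Lemma riesz_norm y i :
  (riesz y i).1 ^+ 2 + (riesz y i).2 ^+ 2 <= expR (\sum_(j < i) y j ^+ 2).
Proof.
elim: i => [|i IH]; first by rewrite big_ord0 expR0 /= expr1n expr0n addr0.
rewrite big_ord_recr/= expRD.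
set A := (riesz y i).1 in IH *; set B := (riesz y i).2 in IH *.
have -> : (A - y i * B) ^+ 2 + (B + y i * A) ^+ 2 = (A ^+ 2 + B ^+ 2) * (1 + y i ^+ 2) by ring.
apply: ler_pM => //; rewrite ?addr_ge0 ?sqr_ge0//.
exact: expR_ge1Dx.
Qed.

(** The left-hand side is the real part of [(a + i b) exp (i th)]. *)
Lemma rotation_le (a b r th : R) : 0 <= r -> a ^+ 2 + b ^+ 2 <= r ^+ 2 ->
  `|a * cos th - b * sin th| <= r.
Proof.
move=> r0 h; rewrite -(ler_pXn2r (n := 2))// ?nnegrE// real_normK ?num_real//.
apply: le_trans h.
have := sqr_ge0 (a * sin th + b * cos th); have := cos2Dsin2 th; move=> h1 h2.
have -> : a ^+ 2 + b ^+ 2 = (a ^+ 2 + b ^+ 2) * (cos th ^+ 2 + sin th ^+ 2) by rewrite h1 mulr1.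
by lra.
Qed.

(** A bound on the modulus of
    [exp (i sum y_j) - prod (1 + i y_j) exp (- sum y_j^2 / 2)], read on the real
    part after each rotation by [th].  The induction exchanges one factor at a
    time: the last angle [y i] joins the rotation, and the earlier factors have
    modulus at most 1 once multiplied by their Gaussian weight. *)
Lemma riesz_approx y (dl : R) (i : nat) th : dl <= 1 ->
  (forall j, (j < i)%N -> `|y j| <= dl) ->
  `|cos (\sum_(j < i) y j + th) -
    ((riesz y i).1 * cos th - (riesz y i).2 * sin th) *
      expR (- ((\sum_(j < i) y j ^+ 2) / 2))| <= 4 * dl * \sum_(j < i) y j ^+ 2.
Proof.
move=> dl1; elim: i th => [|i IH] th hy.
  by rewrite !big_ord0 /= !mul0r oppr0 expR0 add0r addr0 mul1r mulr1 subrr normr0 mulr0.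
have hyi : `|y i| <= dl by exact: hy.
have {}IH := IH _ (fun j ji => hy j (ltnW ji)).
rewrite !big_ord_recr/=.
have -> : (\sum_(j < i) y j ^+ 2 + y i ^+ 2) / 2 =
  (\sum_(j < i) y j ^+ 2) / 2 + y i ^+ 2 / 2 by rewrite mulrDl.
have hn := riesz_norm y i.
set A := (riesz y i).1 in IH hn *; set B := (riesz y i).2 in IH hn *.
set S := \sum_(j < i) y j in IH *; set V := \sum_(j < i) y j ^+ 2 in IH hn *.
rewrite opprD expRD.
set G := expR (- (V / 2)) in IH *; set g := expR (- (y i ^+ 2 / 2)).
have hG : G ^+ 2 * expR V = 1.
  by rewrite /G expr2 -!expRD -[RHS]expR0; congr expR; field.
have hAB : (A * G) ^+ 2 + (B * G) ^+ 2 <= 1 ^+ 2.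
  have -> : (A * G) ^+ 2 + (B * G) ^+ 2 = G ^+ 2 * (A ^+ 2 + B ^+ 2) by ring.
  by rewrite expr1n -hG ler_wpM2l// sqr_ge0.
have h1 := IH (y i + th).
have h2 := rotation_le th ler01 hAB.
(* A rotation by pi / 2 turns the imaginary part into a real part. *)
have h3 := rotation_le (th + pi / 2) ler01 hAB.
have hs := riesz_step (le_trans hyi dl1).
have hc3 : `|y i| ^+ 3 <= dl * y i ^+ 2.
  by rewrite exprS real_normK ?num_real// ler_wpM2r// sqr_ge0.
rewrite addrA in h1.
have -> : cos (S + y i + th) - ((A - y i * B) * cos th - (B + y i * A) * sin th) * (G * g) =
  (cos (S + y i + th) - (A * cos (y i + th) - B * sin (y i + th)) * G)
  + ((cos (y i) - g) * ((A * G) * cos th - (B * G) * sin th)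
  + (sin (y i) - y i * g) * ((A * G) * cos (th + pi / 2) - (B * G) * sin (th + pi / 2))).
  by rewrite cosDpihalf sinDpihalf cosD sinD; ring.
rewrite [leRHS]mulrDr (le_trans (ler_normD _ _))// lerD//.
rewrite (le_trans (ler_normD _ _))// !normrM.
have u0 := normr_ge0 (cos (y i) - g); have v0 := normr_ge0 (sin (y i) - y i * g).
apply: (@le_trans _ _ (`|cos (y i) - g| + `|sin (y i) - y i * g|)).
  by rewrite lerD// ler_piMr.
by rewrite (le_trans hs)//; lra.
Qed.

End RieszProduct.

(** * Characteristic function of a sum of separated blocks *)

Lemma abszD_le (z z' : int) : (`|(z + z')%R| <= `|z| + `|z'|)%N.
Proof. by rewrite -lez_nat PoszD !abszE ler_normD. Qed.

Lemma abszB_le (z z' : int) : (`|(z - z')%R| <= `|z| + `|z'|)%N.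
Proof. by rewrite -(abszN z'); exact: abszD_le. Qed.

Section Blocks.
Variable R : realType.
Local Notation E u := (Rintegral (circle R) setT u).
Local Notation sqint := (sqint (circle R)).

Lemma sqr_sum_le (I : Type) (r : seq I) (p : pred I) (u : I -> R) :
  (\sum_(i <- r | p i) u i) ^+ 2 <=
  (\sum_(i <- r | p i) 1) * \sum_(i <- r | p i) u i ^+ 2.
Proof.
set s := \sum_(i <- r | p i) 1; set q := \sum_(i <- r | p i) u i ^+ 2.
have -> : (\sum_(i <- r | p i) u i) ^+ 2 =
    \sum_(i <- r | p i) \sum_(j <- r | p j) u i * u j.
  by rewrite expr2 mulr_suml; apply: eq_bigr => i _; rewrite mulr_sumr.
apply: (@le_trans _ _ (\sum_(i <- r | p i) \sum_(j <- r | p j) (u i ^+ 2 / 2 + u j ^+ 2 / 2))).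
  apply: ler_sum => i _; apply: ler_sum => j _.
  by have := sqr_ge0 (u i - u j); nra.
under eq_bigr do rewrite big_split/=.
rewrite big_split/= [X in X + _]exchange_big/=.
rewrite (_ : \sum_(j <- r | p j) \sum_(i <- r | p i) u i ^+ 2 / 2 = s * (q / 2)).
  by rewrite -mulrDr -splitr.
rewrite /s mulr_suml; apply: eq_bigr => j _.
by rewrite mul1r /q mulr_suml.
Qed.

Variables (D : nat) (a b : nat -> R) (B : R).
Hypothesis hab : forall j, `|a j| + `|b j| <= B.
Hypothesis B0 : 0 <= B.
Variables (n : nat -> nat) (N : nat) (c : nat -> R) (K : pred nat).
Variables (be : nat -> nat) (m nb : nat).
Hypothesis c0 : forall k, 0 <= c k.
Hypothesis c1 : forall k, c k <= 1.
Hypothesis cK : forall k, ~~ K k -> c k = 0.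
Hypothesis be_lt : forall k, (k < N)%N -> K k -> (be k < nb)%N.
(* [K] is the set of indices that are kept, [be k] the block of [k].  Each n k
   exceeds D times the sum of the n k' of all earlier blocks, a bound for the
   frequencies of the Riesz product over these blocks. *)
Hypothesis sep : forall k, (k < N)%N -> K k ->
  (D * \sum_(0 <= k' < N | K k' && (be k' < be k)) n k' < n k)%N.
Hypothesis size : forall i, (\sum_(0 <= k < N | K k && (be k == i)) 1 <= m)%N.

Definition tpoly (x : R) : R := \sum_(1 <= j < D.+1) wave j (a j) (b j) x.

Definition block_sum (i : nat) (x : R) : R :=
  \sum_(0 <= k < N | be k == i) c k * tpoly ((n k)%:R * x).

Local Notation Y := block_sum.

(** [Fq i] bounds the frequencies of the product of the factors before the
    [i]-th one, and [Gq i] those of the [i]-th block. *)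
Let Fq i := (D * \sum_(0 <= k < N | K k && (be k < i)) n k)%N.
Let Gq i := (D * \sum_(0 <= k < N | K k && (be k == i)) n k)%N.

Let FqS i : Fq i.+1 = (Fq i + Gq i)%N.
Proof.
rewrite /Fq /Gq -mulnDr; congr (_ * _)%N.
rewrite (bigID (fun k => be k < i)%N)/=; congr (_ + _)%N.
  apply: eq_bigl => k; case: (K k) => //=; rewrite ltnS.
  by case: (ltngtP (be k) i).
apply: eq_bigl => k; case: (K k) => //=; rewrite ltnS.
by case: (ltngtP (be k) i).
Qed.

Lemma tpoly_scale k x : tpoly (k%:R * x) = \sum_(1 <= j < D.+1) wave (j * k)%N (a j) (b j) x.
Proof. by apply: eq_bigr => j _; rewrite wave_scale. Qed.

Lemma trig_tpoly (A : set int) k : (forall j, (1 <= j <= D)%N -> A (j * k)%N%:Z) ->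
  trig (freqs A) (fun x => tpoly (k%:R * x)).
Proof.
move=> hA; apply: (@eq_trig _ _ (fun x => \sum_(1 <= j < D.+1 | (1 <= j <= D)%N)
    wave (j * k)%N (a j) (b j) x)).
  by move=> x; rewrite tpoly_scale [RHS]big_nat_cond [LHS]big_nat_cond;
    apply: eq_bigl => j; rewrite ltnS andbT andbb.
by apply: trig_sum => j hj; apply: trig_wave; exact: hA.
Qed.

Lemma trig_block i :
  trig (freqs [set z : int | (Fq i < `|z|)%N && (`|z| <= Gq i)%N]) (Y i).
Proof.
apply: (@eq_trig _ _ (fun x => \sum_(0 <= k < N | [&& (k < N)%N, K k & be k == i])
    c k * tpoly ((n k)%:R * x))).
  move=> x; rewrite /block_sum [LHS]big_nat_cond [RHS]big_nat_cond.
  rewrite [RHS](bigID K)/= [X in _ = _ + X]big1 ?addr0.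
    by apply: eq_bigl => k; case: (k < N)%N => //=; case: (K k); rewrite ?andbT ?andbF.
  by move=> k /andP[_ /cK ->]; rewrite mul0r.
apply: trig_sum => k /and3P[kN Kk /eqP bk]; apply: trigZ; apply: trig_tpoly => j /andP[j1 jD].
rewrite /= -bk; apply/andP; split.
  apply: (leq_trans (sep kN Kk)).
  by rewrite -{1}[n k]mul1n leq_mul2r j1 orbT.
apply: (@leq_trans (D * n k)); first by rewrite leq_mul2r jD orbT.
rewrite leq_mul2l; apply/orP; right.
rewrite (big_rem k) ?mem_index_iota//= Kk bk eqxx/=.
exact: leq_addr.
Qed.

Variable tau : R.
Let ys (x : R) (i : nat) : R := tau * Y i x.

Lemma riesz_trig i : trig (freqs_le (R := R) (Fq i)) (fun x => (riesz (ys x) i).1) /\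
  trig (freqs_le (R := R) (Fq i)) (fun x => (riesz (ys x) i).2).
Proof.
have f00 F : freqs_le (R := R) F 0 by exists 0 => //=; rewrite ?mulr0.
elim: i => [|i [IH1 IH2]] /=; first by split; exact: trig_cst.
have sub u : trig (freqs_le (Fq i)) u -> trig (freqs_le (R := R) (Fq i.+1)) u.
  apply: trig_sub => _ [z zF <-]; exists z => //=.
  by rewrite FqS (leq_trans zF)// leq_addr.
have mul u : trig (freqs_le (Fq i)) u ->
    trig (freqs_le (R := R) (Fq i.+1)) (fun x => ys x i * u x).
  move=> hu; have hy := trigZ tau (trig_block i).
  apply: (trigM _ hy hu) => _ _ [z /andP[_ zG] <-] [z' zF <-].
  rewrite FqS; split.
    exists (z + z'); last by rewrite intrD; ring.
    by rewrite /= addnC (leq_trans (abszD_le _ _))// leq_add.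
  exists (z - z'); last by rewrite intrB; ring.
  by rewrite /= addnC (leq_trans (abszB_le _ _))// leq_add.
by split; [apply: trigB|apply: trigD]; [exact: sub|exact: mul|exact: sub|exact: mul].
Qed.

(** The frequencies of [Y i] exceed those of the product of the earlier factors,
    so the term that the new factor adds is orthogonal to constants. *)
Lemma riesz_mean i : E (fun x => (riesz (ys x) i).1) = 1 /\ E (fun x => (riesz (ys x) i).2) = 0.
Proof.
elim: i => [|i [IH1 IH2]] /=; first by rewrite !Rintegral_cst1.
have [h1 h2] := riesz_trig i.
have hy := trigZ tau (trig_block i).
have orth u : trig (freqs_le (Fq i)) u -> E (fun x => ys x i * u x) = 0.
  move=> hu; apply: (trig_orth _ hy hu) => z z' /= /andP[zF _] z'F.
  split; apply/eqP.
    by move/eqP; rewrite addr_eq0 => /eqP zE; move: zF; rewrite zE abszN ltnNge z'F.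
  by move/eqP; rewrite subr_eq0 => /eqP zE; move: zF; rewrite zE ltnNge z'F.
have int u : trig (freqs_le (R := R) (Fq i)) u ->
    (circle R).-integrable setT (EFin \o (fun x => ys x i * u x)).
  move=> hu; exact: (sqint_integrableM (trig_sqint hy) (trig_sqint hu)).
split.
  rewrite RintegralB ?IH1 ?orth ?subr0//; first exact: trig_integrable h1.
  exact: int.
rewrite RintegralD ?IH2 ?orth ?addr0//; first exact: trig_integrable h2.
exact: int.
Qed.

(* The pair (k, j) indexes the wave of frequency j * n k. *)
Let s0 := [seq (k, j) | k <- index_iota 0 N, j <- index_iota 1 D.+1].
Let v (al : nat * nat) : int := (al.2 * n al.1)%N.
Let Tm (al : nat * nat) x := c al.1 * wave (v al) (a al.2) (b al.2) x.
Let same (al al' : nat * nat) : R := (be al.1 == be al'.1)%:R.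

Let sum_s0 (F : nat * nat -> R) :
  \sum_(al <- s0) F al = \sum_(0 <= k < N) \sum_(1 <= j < D.+1) F (k, j).
Proof. by rewrite big_allpairs_dep. Qed.

Let mem_s0 al : al \in s0 -> (al.1 < N)%N /\ (1 <= al.2 <= D)%N.
Proof.
move=> /allpairsP[[k j] /= [kN jD ->]] /=.
by move: kN jD; rewrite !mem_index_iota /= ltnS.
Qed.

Let block_sumE i x : Y i x = \sum_(al <- s0) Tm al x * (be al.1 == i)%:R.
Proof.
rewrite sum_s0 /block_sum big_mkcond/=; apply: eq_bigr => k _.
case: eqP => _; last by rewrite big1// => j _; rewrite mulr0.
rewrite tpoly_scale mulr_sumr; apply: eq_bigr => j _.
by rewrite mulr1.
Qed.

Let Tm0 al x : ~~ K al.1 -> Tm al x = 0.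
Proof. by move=> /cK h; rewrite /Tm h mul0r. Qed.

Let sum_sqr x : \sum_(i < nb) Y i x ^+ 2 =
  \sum_(al <- s0) \sum_(al' <- s0) Tm al x * Tm al' x * same al al'.
Proof.
transitivity (\sum_(i < nb) \sum_(al <- s0) \sum_(al' <- s0)
    Tm al x * Tm al' x * ((be al.1 == i)%:R * (be al'.1 == i)%:R)).
  apply: eq_bigr => i _; rewrite block_sumE expr2 mulr_suml.
  apply: eq_bigr => al _; rewrite mulr_sumr; apply: eq_bigr => al' _.
  by ring.
rewrite exchange_big/= big_seq [RHS]big_seq; apply: eq_bigr => al als.
rewrite exchange_big/=; apply: eq_bigr => al' _.
rewrite -mulr_sumr.
have [Ka|nKa] := boolP (K al.1); last by rewrite Tm0// !mul0r.
have bl : (be al.1 < nb)%N by apply: be_lt => //; case: (mem_s0 als).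
congr (_ * _); rewrite (bigD1 (Ordinal bl))//= eqxx mul1r big1 ?addr0.
  by rewrite /same eq_sym.
move=> i /eqP/val_eqP/= ib; case: eqP => [bi|_]; last by rewrite mul0r.
by rewrite bi eqxx in ib.
Qed.

Let w (om : (nat * nat) * (nat * nat)) : R := c om.1.1 * c om.2.1 * same om.1 om.2.
Let Pm (al al' : nat * nat) : R := (a al.2 * a al'.2 + b al.2 * b al'.2) / 2.
Let Qm (al al' : nat * nat) : R := (b al.2 * a al'.2 - a al.2 * b al'.2) / 2.
Let Pp (al al' : nat * nat) : R := (a al.2 * a al'.2 - b al.2 * b al'.2) / 2.
Let Qp (al al' : nat * nat) : R := (a al.2 * b al'.2 + b al.2 * a al'.2) / 2.
Let s := [seq (al, al') | al <- s0, al' <- s0].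
Let sum_s (F : (nat * nat) * (nat * nat) -> R) :
  \sum_(om <- s) F om = \sum_(al <- s0) \sum_(al' <- s0) F (al, al').
Proof. by rewrite [LHS]big_allpairs_dep. Qed.

Let off (om : (nat * nat) * (nat * nat)) : R := (om.1 != om.2)%:R.

(** The constant that the pairs of equal indices contribute to the sum of the
    squares of the blocks: the variance of the limit law. *)
Definition diag_sum : R :=
  \sum_(0 <= k < N) c k ^+ 2 * (\sum_(1 <= j < D.+1) (a j ^+ 2 + b j ^+ 2) / 2).

(* The waves at differences of frequencies, without the pairs of equal indices
   that make up [diag_sum], and the waves at sums of frequencies. *)
Let Ud x := \sum_(om <- s) wave (v om.1 - v om.2)
  (w om * off om * Pm om.1 om.2) (w om * off om * Qm om.1 om.2) x.
Let Up x := \sum_(om <- s) wave (v om.1 + v om.2)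
  (w om * Pp om.1 om.2) (w om * Qp om.1 om.2) x.

Let uniq_s0 : uniq s0.
Proof.
apply: allpairs_uniq; rewrite ?iota_uniq//.
by move=> [k j] [k' j'] _ _ /= [-> ->].
Qed.

Let U_split x : \sum_(i < nb) Y i x ^+ 2 - diag_sum = Ud x + Up x.
Proof.
rewrite sum_sqr /Ud /Up !sum_s/=.
have -> : diag_sum = \sum_(al <- s0) \sum_(al' <- s0)
    w (al, al') * (1 - off (al, al')) * wave (v al - v al') (Pm al al') (Qm al al') x.
  rewrite [RHS](_ : _ = \sum_(al <- s0) c al.1 ^+ 2 * ((a al.2 ^+ 2 + b al.2 ^+ 2) / 2)).
    rewrite sum_s0; apply: eq_bigr => k _; rewrite mulr_sumr; apply: eq_bigr => j _ /=.
    by rewrite mulrA.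
  rewrite big_seq [RHS]big_seq; apply: eq_bigr => al als.
  rewrite (bigD1_seq al als uniq_s0)/= big1 ?addr0; last first.
    by move=> al' /negbTE ne; rewrite /off/= eq_sym ne subrr mulr0 mul0r.
  rewrite /off/= eqxx subr0 /w /same/= eqxx /wave subrr mulr0 mul0r cos0 sin0 /Pm.
  by rewrite -[true%:R]/(1 : R); ring.
rewrite -sumrB -big_split/=; apply: eq_bigr => al _.
rewrite -sumrB -big_split/=; apply: eq_bigr => al' _.
rewrite /Tm.
have -> : c al.1 * wave (v al) (a al.2) (b al.2) x *
  (c al'.1 * wave (v al') (a al'.2) (b al'.2) x) * same al al' =
  w (al, al') * (wave (v al) (a al.2) (b al.2) x * wave (v al') (a al'.2) (b al'.2) x).
  by rewrite /w/=; ring.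
by rewrite waveM -/(Pm al al') -/(Qm al al') -/(Pp al al') -/(Qp al al') /wave; ring.
Qed.

Let w_ge0 om : 0 <= w om.
Proof. by rewrite /w /same !mulr_ge0// ler0n. Qed.

Let coef_le (al al' : nat * nat) :
  `|Pm al al'| + `|Qm al al'| <= B ^+ 2 /\ `|Pp al al'| + `|Qp al al'| <= B ^+ 2.
Proof.
have h1 := hab al.2; have h2 := hab al'.2.
have a1 := normr_ge0 (a al.2); have b1 := normr_ge0 (b al.2).
have a2 := normr_ge0 (a al'.2); have b2 := normr_ge0 (b al'.2).
have half (x y : R) : `|(x + y) / 2| <= (`|x| + `|y|) / 2.
  by rewrite normrM [`|2^-1|]ger0_norm// ler_wpM2r// ler_normD.
have hh : (`|a al.2| + `|b al.2|) * (`|a al'.2| + `|b al'.2|) <= B ^+ 2.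
  by rewrite expr2 ler_pM// addr_ge0.
split; rewrite (le_trans (lerD (half _ _) (half _ _)))// ?normrN !normrM; nra.
Qed.

Let H := \sum_(0 <= k < N) c k ^+ 2.

Let H0 : 0 <= H.
Proof. by apply: sumr_ge0 => k _; exact: sqr_ge0. Qed.

(** A block has at most [m] indices, and [2 * c k * c l <= c k ^+ 2 + c l ^+ 2]. *)
Let sum_w : \sum_(om <- s) w om <= D%:R ^+ 2 * (m%:R * H).
Proof.
rewrite sum_s/=.
have -> : \sum_(al <- s0) \sum_(al' <- s0) w (al, al') =
   D%:R ^+ 2 * \sum_(0 <= k < N) \sum_(0 <= l < N) c k * c l * (be k == be l)%:R.
  rewrite sum_s0 mulr_sumr; apply: eq_bigr => k _.
  under eq_bigr => j _.
    rewrite sum_s0.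
    under eq_bigr => l _ do rewrite /w /same/= sumr_const_nat subn1/= -(mulr_natl _ D).
    over.
  rewrite sumr_const_nat subn1/= -[LHS]mulr_natl !mulr_sumr.
  by apply: eq_bigr => l _; ring.
rewrite ler_wpM2l ?sqr_ge0//.
have row k : \sum_(0 <= l < N) c k ^+ 2 * ((K l && (be l == be k))%:R / 2) <= m%:R * (c k ^+ 2 / 2).
  rewrite -mulr_sumr -mulr_suml.
  have -> : \sum_(0 <= l < N) (K l && (be l == be k))%:R =
     (\sum_(0 <= l < N | K l && (be l == be k)) 1)%N%:R :> R.
    by rewrite natr_sum [RHS]big_mkcond/=; apply: eq_bigr => l _; case: ifP.
  have : (\sum_(0 <= l < N | K l && (be l == be k)) 1)%N%:R <= m%:R :> R.
    by rewrite ler_nat size.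
  by have := sqr_ge0 (c k); nra.
apply: (@le_trans _ _ (\sum_(0 <= k < N) \sum_(0 <= l < N)
   (c k ^+ 2 * ((K l && (be l == be k))%:R / 2) + c l ^+ 2 * ((K k && (be k == be l))%:R / 2)))).
  apply: ler_sum => k _; apply: ler_sum => l _.
  rewrite (eq_sym (be l)); have [Kk|/cK ->] := boolP (K k); last first.
    by rewrite !mul0r addr_ge0// mulr_ge0 ?sqr_ge0// divr_ge0.
  have [Kl|/cK ->] := boolP (K l); last first.
    by rewrite mulr0 mul0r addr_ge0// mulr_ge0 ?sqr_ge0// divr_ge0.
  rewrite /=; case: eqP => _; last by rewrite !mulr0 !mul0r !mulr0 addr0.
  by rewrite -[true%:R]/(1 : R); have := sqr_ge0 (c k - c l); nra.
under eq_bigr do rewrite big_split/=.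
rewrite big_split/= [X in _ + X]exchange_big/=.
have -> : m%:R * H = \sum_(0 <= k < N) m%:R * (c k ^+ 2 / 2) + \sum_(0 <= k < N) m%:R * (c k ^+ 2 / 2).
  rewrite /H mulr_sumr -big_split/=; apply: eq_bigr => k _.
  by rewrite -mulrDr -splitr.
by apply: lerD; apply: ler_sum => k _; exact: row.
Qed.

Variable Lam : R.
(* Weighted number of pairs of distinct waves in the whole sum whose frequencies
   differ by z. *)
Hypothesis dio : forall z : nat,
  \sum_(al <- s0) \sum_(al' <- s0)
    c al.1 * c al'.1 * (al != al')%:R * (`|v al - v al'|%N == z)%:R <= Lam.

Let Ud_sqr : E (fun x => Ud x ^+ 2) <= B ^+ 2 * D%:R ^+ 2 * m%:R * H * (B ^+ 2 * Lam).
Proof.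
have hW om : `|w om * off om * Pm om.1 om.2| + `|w om * off om * Qm om.1 om.2| <=
    w om * off om * B ^+ 2.
  have o0 : 0 <= w om * off om by rewrite mulr_ge0// /off ler0n.
  rewrite normrM (normrM _ (Qm _ _)) ger0_norm// -mulrDr ler_wpM2l//.
  by case: (coef_le om.1 om.2).
apply: (le_trans (E_waves_le s (fun om => v om.1 - v om.2) hW)).
have L0 : 0 <= Lam.
  apply: le_trans (dio 0); apply: sumr_ge0 => al _; apply: sumr_ge0 => al' _.
  by rewrite !mulr_ge0// ler0n.
apply: (@le_trans _ _ (\sum_(om <- s) w om * (B ^+ 2 * (B ^+ 2 * Lam)))); last first.
  rewrite -mulr_suml.
  have -> : B ^+ 2 * D%:R ^+ 2 * m%:R * H * (B ^+ 2 * Lam) =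
    D%:R ^+ 2 * (m%:R * H) * (B ^+ 2 * (B ^+ 2 * Lam)) by ring.
  by rewrite ler_wpM2r// !mulr_ge0// ?sqr_ge0.
apply: ler_sum => om _.
have -> : \sum_(i' <- s) w om * off om * B ^+ 2 * (w i' * off i' * B ^+ 2) *
    (`|v om.1 - v om.2|%N == `|v i'.1 - v i'.2|%N)%:R =
    w om * (off om * B ^+ 2) * (B ^+ 2 * \sum_(i' <- s) w i' * off i' *
      (`|v om.1 - v om.2|%N == `|v i'.1 - v i'.2|%N)%:R).
  by rewrite !mulr_sumr; apply: eq_bigr => i' _; ring.
rewrite -mulrA ler_wpM2l//.
apply: ler_pM.
- by rewrite mulr_ge0 ?sqr_ge0// /off ler0n.
- rewrite mulr_ge0 ?sqr_ge0// sumr_ge0// => i' _.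
  by rewrite !mulr_ge0 ?ler0n.
- by rewrite ler_piMl ?sqr_ge0// /off; case: eqP.
rewrite ler_wpM2l ?sqr_ge0//.
apply: le_trans (dio `|v om.1 - v om.2|%N).
rewrite sum_s/=; apply: ler_sum => al _; apply: ler_sum => al' _.
rewrite /w /off/= (eq_sym `|v om.1 - v om.2|%N).
rewrite ler_wpM2r ?ler0n// ler_wpM2r ?ler0n// ler_piMr ?mulr_ge0//.
by rewrite /same; case: eqP.
Qed.

(** By separation the sum of two frequencies of a block determines the block. *)
Let v_block al al' al0 al0' : al \in s0 -> al' \in s0 -> al0 \in s0 -> al0' \in s0 ->
  K al.1 -> K al'.1 -> K al0.1 -> K al0'.1 ->
  be al.1 = be al'.1 -> be al0.1 = be al0'.1 -> (be al.1 < be al0.1)%N ->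
  (v al + v al')%R != (v al0 + v al0')%R.
Proof.
move=> i1 i2 i3 i4 k1 k2 k3 k4 b1 b2 lt.
have key p q : p \in s0 -> q \in s0 -> K p.1 -> K q.1 -> (be p.1 < be q.1)%N ->
    (p.2 * n p.1 < q.2 * n q.1)%N.
  move=> ip iq kp kq pq.
  have [pN /andP[_ pD]] := mem_s0 ip; have [qN /andP[q1 _]] := mem_s0 iq.
  apply: (@leq_ltn_trans (D * n p.1)); first by rewrite leq_mul2r pD orbT.
  apply: (@leq_trans (n q.1)); last by rewrite leq_pmull.
  apply: leq_ltn_trans (sep qN kq); rewrite leq_mul2l; apply/orP; right.
  by rewrite (big_rem p.1) ?mem_index_iota//= kp pq leq_addr.
have h1 := key _ _ i1 i3 k1 k3 lt.
have h2 : (al'.2 * n al'.1 < al0'.2 * n al0'.1)%N by apply: key => //; rewrite -b1 -b2.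
rewrite /v -!PoszD eqz_nat neq_ltn; apply/orP; left.
by rewrite -addSn leq_add// ltnW.
Qed.

(** For each pair, coincidences of sums occur within its block, among at most
    [(D * m) ^+ 2] pairs. *)
Let Up_sqr : E (fun x => Up x ^+ 2) <=
  B ^+ 2 * D%:R ^+ 2 * m%:R * H * (B ^+ 2 * (D%:R * m%:R) ^+ 2).
Proof.
have hW om : `|w om * Pp om.1 om.2| + `|w om * Qp om.1 om.2| <= w om * B ^+ 2.
  rewrite normrM (normrM _ (Qp _ _)) ger0_norm// -mulrDr ler_wpM2l//.
  by case: (coef_le om.1 om.2).
apply: (le_trans (E_waves_le s (fun om => v om.1 + v om.2) hW)).
apply: (@le_trans _ _ (\sum_(om <- s) w om * (B ^+ 2 * (B ^+ 2 * (D%:R * m%:R) ^+ 2)))); last first.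
  rewrite -mulr_suml.
  have -> : B ^+ 2 * D%:R ^+ 2 * m%:R * H * (B ^+ 2 * (D%:R * m%:R) ^+ 2) =
    D%:R ^+ 2 * (m%:R * H) * (B ^+ 2 * (B ^+ 2 * (D%:R * m%:R) ^+ 2)) by ring.
  by rewrite ler_wpM2r// !mulr_ge0// ?sqr_ge0.
rewrite big_seq [leRHS]big_seq; apply: ler_sum => om oms.
have -> : \sum_(i' <- s) w om * B ^+ 2 * (w i' * B ^+ 2) *
    (`|(v om.1 + v om.2)%R|%N == `|(v i'.1 + v i'.2)%R|%N)%:R =
    w om * (B ^+ 2 * (B ^+ 2 * \sum_(i' <- s) w i' *
      (`|(v om.1 + v om.2)%R|%N == `|(v i'.1 + v i'.2)%R|%N)%:R)).
  by rewrite !mulr_sumr; apply: eq_bigr => i' _; ring.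
have [w0|w0] := eqVneq (w om) 0; first by rewrite w0 !mul0r.
have [K1 K2 b12] : [/\ K om.1.1, K om.2.1 & be om.1.1 = be om.2.1].
  move: w0; rewrite /w /same; split.
  - by apply: contraNT w0 => /cK ->; rewrite !mul0r.
  - by apply: contraNT w0 => /cK ->; rewrite mulr0 mul0r.
  - by apply/eqP; apply: contraNT w0 => /negbTE ->; rewrite mulr0.
have [mo1 mo2] : om.1 \in s0 /\ om.2 \in s0.
  by move: oms => /allpairsP[[p q] /= [? ? ->]].
rewrite ler_wpM2l// ler_wpM2l ?sqr_ge0// ler_wpM2l ?sqr_ge0//.
pose ind (al : nat * nat) : R := (K al.1 && (be al.1 == be om.1.1))%:R.
apply: (@le_trans _ _ ((\sum_(al <- s0) ind al) ^+ 2)).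
  rewrite sum_s/= expr2 mulr_suml big_seq [leRHS]big_seq.
  apply: ler_sum => al als; rewrite mulr_sumr big_seq [leRHS]big_seq.
  apply: ler_sum => al' als'; rewrite /w/= /ind.
  have [Ka|/cK ->] := boolP (K al.1); last by rewrite !mul0r.
  have [Ka'|/cK ->] := boolP (K al'.1); last by rewrite mulr0 !mul0r mulr0.
  rewrite /same/=; have [bb|_] := eqVneq (be al.1) (be al'.1); last first.
    by rewrite mulr0 mul0r mulr_ge0 ?ler0n.
  rewrite -bb; have [_|ne] := eqVneq (be al.1) (be om.1.1).
    rewrite !mulr1 -[leRHS]mulr1 ler_pM ?mulr_ge0 ?ler0n//; last by case: eqP.
    by rewrite -[leRHS]mulr1 ler_pM.
  suff vne : (`|(v om.1 + v om.2)%R|%N == `|(v al + v al')%R|%N) = false.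
    by rewrite vne mulr0 mulr_ge0 ?ler0n.
  apply/negbTE; rewrite /v -!PoszD !absz_nat.
  have := ne; rewrite neq_ltn => /orP[lt|lt].
    have := v_block als als' mo1 mo2 Ka Ka' K1 K2 bb b12 lt.
    by rewrite /v -!PoszD eqz_nat eq_sym.
  have := v_block mo1 mo2 als als' K1 K2 Ka Ka' b12 bb lt.
  by rewrite /v -!PoszD eqz_nat.
rewrite ler_pXn2r ?nnegrE ?mulr_ge0//; last by rewrite sumr_ge0// => al _; rewrite ler0n.
rewrite sum_s0 /ind/=.
under eq_bigr do rewrite sumr_const_nat subn1/= -(mulr_natl _ D).
rewrite -mulr_sumr ler_wpM2l//.
rewrite -natr_sum ler_nat; apply: leq_trans (size (be om.1.1)).
by rewrite [leqRHS]big_mkcond/=; apply: leq_sum => k _; case: ifP.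
Qed.

(** The fluctuation is the sum of the waves in [Ud] and [Up], to which
    [E_waves_le] applies. *)
Lemma square_sum_variance :
  E (fun x => (\sum_(i < nb) Y i x ^+ 2 - diag_sum) ^+ 2) <=
  2 * (B ^+ 2 * D%:R ^+ 2 * m%:R * H * (B ^+ 2 * (Lam + (D%:R * m%:R) ^+ 2))).
Proof.
have tU : sqint Ud.
  apply: (@trig_sqint _ (freqs setT)); apply: trig_sum => om _; exact: trig_wave.
have tP : sqint Up.
  apply: (@trig_sqint _ (freqs setT)); apply: trig_sum => om _; exact: trig_wave.
under eq_Rintegral do rewrite U_split.
apply: le_trans (E_sqrD_le tU tP) _.
by have := Ud_sqr; have := Up_sqr; lra.
Qed.

Lemma tpoly_le x : `|tpoly x| <= D%:R * B.
Proof.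
rewrite (le_trans (ler_norm_sum _ _ _))//.
have -> : D%:R * B = \sum_(1 <= j < D.+1) B.
  by rewrite sumr_const_nat subn1/= mulr_natl.
by apply: ler_sum => j _; rewrite (le_trans (wave_le _ _ _ _)).
Qed.

Let blockK (F : nat -> R) i : (forall k, ~~ K k -> F k = 0) ->
  \sum_(0 <= k < N | be k == i) F k = \sum_(0 <= k < N | K k && (be k == i)) F k.
Proof.
move=> hF; rewrite (bigID K)/= [X in _ + X]big1 ?addr0.
  by apply: eq_bigl => k; rewrite andbC.
by move=> k /andP[_ /hF].
Qed.

Let card_block i : \sum_(0 <= k < N | K k && (be k == i)) (1 : R) <= m%:R.
Proof.
rewrite (_ : \sum_(0 <= k < N | _) 1 =
  (\sum_(0 <= k < N | K k && (be k == i)) 1)%N%:R); first by rewrite ler_nat size.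
by rewrite natr_sum.
Qed.

Let DB0 : 0 <= D%:R * B.
Proof. by rewrite mulr_ge0. Qed.

Lemma block_sum_le i x : `|Y i x| <= m%:R * (D%:R * B).
Proof.
rewrite /block_sum blockK; last by move=> k /cK ->; rewrite mul0r.
rewrite (le_trans (ler_norm_sum _ _ _))//.
apply: (@le_trans _ _ (\sum_(0 <= k < N | K k && (be k == i)) 1 * (D%:R * B))).
  apply: ler_sum => k _; rewrite normrM ler_pM//; last exact: tpoly_le.
  by rewrite ger0_norm.
by rewrite -mulr_suml ler_wpM2r.
Qed.

Lemma block_sqr_sum_le x : \sum_(i < nb) Y i x ^+ 2 <= m%:R * (D%:R * B) ^+ 2 * H.
Proof.
apply: (@le_trans _ _ (\sum_(i < nb) \sum_(0 <= k < N | K k && (be k == i))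
   (m%:R * (D%:R * B) ^+ 2) * c k ^+ 2)).
  apply: ler_sum => i _; rewrite /block_sum blockK; last by move=> k /cK ->; rewrite mul0r.
  apply: le_trans (sqr_sum_le _ _ _) _.
  rewrite -mulr_sumr -mulrA ler_pM//.
  - by rewrite sumr_ge0.
  - by rewrite sumr_ge0// => k _; exact: sqr_ge0.
  rewrite mulr_sumr; apply: ler_sum => k _.
  rewrite exprMn mulrC ler_wpM2r ?sqr_ge0//.
  rewrite -[X in X <= _]real_normK ?num_real// ler_pXn2r ?nnegrE//.
  exact: tpoly_le.
under eq_bigr do rewrite -mulr_sumr big_mkcond.
rewrite -mulr_sumr ler_wpM2l ?mulr_ge0 ?sqr_ge0//.
rewrite exchange_big/= /H; apply: ler_sum => k _.
have [Kk|nK] := boolP (K k); last first.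
  by rewrite /= big1// sqr_ge0.
rewrite /= -big_mkcond/=.
have [bl|bl] := ltnP (be k) nb; last first.
  rewrite big_pred0 ?sqr_ge0// => i; apply/negbTE; apply: contraL bl => /eqP ->.
  by rewrite -ltnNge.
rewrite (bigD1 (Ordinal bl))//= big1 ?addr0// => i /andP[/eqP bi /eqP ni].
by case: ni; apply: val_inj => /=.
Qed.

Lemma block_total x :
  \sum_(i < nb) Y i x = \sum_(0 <= k < N) c k * tpoly ((n k)%:R * x).
Proof.
rewrite /block_sum; under eq_bigr do rewrite big_mkcond.
rewrite exchange_big/= big_nat [RHS]big_nat; apply: eq_bigr => k kN.
have [Kk|nK] := boolP (K k); last first.
  by rewrite cK// mul0r big1// => i _; case: ifP.
have bl : (be k < nb)%N by apply: be_lt => //; case/andP: kN.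
by rewrite -big_mkcond/= (big_pred1 (Ordinal bl)).
Qed.

Lemma diag_sum_ge0 : 0 <= diag_sum.
Proof.
apply: sumr_ge0 => k _; rewrite mulr_ge0 ?sqr_ge0// sumr_ge0// => j _.
by rewrite divr_ge0// addr_ge0 ?sqr_ge0.
Qed.

(** The first error term replaces the cosine by a Riesz product with Gaussian
    weight ([riesz_approx]); the second one replaces the sum of squares in the
    weight by [diag_sum] ([square_sum_variance]).  The Riesz product that
    remains has mean 1. *)
Lemma block_char (th dl e : R) : dl <= 1 -> 0 < e ->
  `|tau| * (m%:R * (D%:R * B)) <= dl ->
  `|E (fun x => cos (tau * (\sum_(0 <= k < N) c k * tpoly ((n k)%:R * x)) + th)) -
     cos th * expR (- (tau ^+ 2 * diag_sum / 2))| <=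
  4 * dl * (tau ^+ 2 * (m%:R * (D%:R * B) ^+ 2 * H)) +
  expR (tau ^+ 2 * (m%:R * (D%:R * B) ^+ 2 * H) / 2) * (tau ^+ 2 / 2) *
  (e + 2 * (B ^+ 2 * D%:R ^+ 2 * m%:R * H * (B ^+ 2 * (Lam + (D%:R * m%:R) ^+ 2))) / e).
Proof.
move=> dl1 e0 hdl.
set QH := m%:R * (D%:R * B) ^+ 2 * H.
set VV := 2 * _.
have QH0 : 0 <= QH by rewrite !mulr_ge0// sqr_ge0.
have t20 : 0 <= tau ^+ 2 by exact: sqr_ge0.
have dl0 : 0 <= dl by apply: le_trans hdl; rewrite !mulr_ge0.
pose S2 x := \sum_(i < nb) Y i x ^+ 2.
have S20 x : 0 <= S2 x by apply: sumr_ge0 => i _; exact: sqr_ge0.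
have yS2 x : \sum_(i < nb) ys x i ^+ 2 = tau ^+ 2 * S2 x.
  by rewrite /S2 mulr_sumr; apply: eq_bigr => i _; rewrite /ys exprMn.
have yS x : \sum_(i < nb) ys x i = tau * (\sum_(0 <= k < N) c k * tpoly ((n k)%:R * x)).
  by rewrite -block_total mulr_sumr.
pose X x := tau * (\sum_(0 <= k < N) c k * tpoly ((n k)%:R * x)).
pose Rv x := (riesz (ys x) nb).1 * cos th - (riesz (ys x) nb).2 * sin th.
pose G0 := expR (- (tau ^+ 2 * diag_sum / 2)).
have [t1 t2] := riesz_trig nb; have [m1 m2] := riesz_mean nb.
have tRv : trig (freqs_le (R := R) (Fq nb)) Rv.
  apply: (eq_trig _ (trig_lin (cos th) t1 (trigZ (- sin th) t2))) => x.
  by rewrite /Rv; ring.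
have ERv : E Rv = cos th.
  have i1 := trig_integrable (trigZ (cos th) t1).
  have i2 := trig_integrable (trigZ (- sin th) t2).
  transitivity (E (fun x => cos th * (riesz (ys x) nb).1 + - sin th * (riesz (ys x) nb).2)).
    by apply: eq_Rintegral => x _; rewrite /Rv; ring.
  rewrite RintegralD// RintegralZl//; last exact: trig_integrable t1.
  rewrite RintegralZl//; last exact: trig_integrable t2.
  by rewrite m1 m2 mulr1 mulr0 addr0.
have tX : trig (freqs (R := R) setT) X.
  by apply: trigZ; apply: trig_sum => k _; apply: trigZ; exact: trig_tpoly.
have mX := trig_measurable tX.
have icos : (circle R).-integrable setT (EFin \o (fun x => cos (X x + th))).
  apply: (@bounded_integrable _ _ _ (circle R) _ 1); last by move=> x; exact: cos_max.
  apply: measurableT_comp; first exact: continuous_measurable_fun (@continuous_cos R).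
  exact: measurable_funD.
have iRv : (circle R).-integrable setT (EFin \o (fun x => G0 * Rv x)).
  exact: trig_integrable (trigZ G0 tRv).
have -> : E (fun x => cos (X x + th)) - cos th * G0 = E (fun x => cos (X x + th) - G0 * Rv x).
  rewrite RintegralB// RintegralZl//; last exact: trig_integrable tRv.
  by rewrite ERv mulrC.
have tU : sqint (fun x => S2 x - diag_sum).
  have h : trig (freqs (R := R) setT) (fun x => Ud x + Up x).
    by apply: trigD; apply: trig_sum => om _; exact: trig_wave.
  have := trig_sqint h; rewrite (_ : (fun x => Ud x + Up x) = (fun x => S2 x - diag_sum))//.
  by apply/funext => x; rewrite -U_split.
have iU := sqint_integrable tU.
have iaU : (circle R).-integrable setT (EFin \o (fun x => `|S2 x - diag_sum|)).
  by have := integrable_abse iU; apply: eq_integrable.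
have EU : E (fun x => `|S2 x - diag_sum|) <= e + VV / e.
  apply: (le_trans (E_norm_le e0 tU)); rewrite lerD2l ler_wpM2r ?invr_ge0 ?(ltW e0)//.
  exact: square_sum_variance.
set KK := expR (tau ^+ 2 * QH / 2).
apply: (@Rintegral_norm_le _ _ _ (circle R) _ (4 * dl * (tau ^+ 2 * QH)) (KK * (tau ^+ 2 / 2))
  (e + VV / e) (fun x => `|S2 x - diag_sum|)).
- by have := integrableB measurableT icos iRv; apply: eq_integrable.
- by rewrite mulr_ge0 ?expR_ge0// divr_ge0.
- by case: tU => mU _; exact: measurableT_comp.
- by move=> x.
- have -> : (\int[circle R]_x (`|S2 x - diag_sum|)%:E =
      (E (fun x => `|S2 x - diag_sum|))%:E)%E.
    by rewrite /Rintegral fineK//; exact: integrable_fin_num.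
  by rewrite lee_fin.
move=> x.
pose G := expR (- ((\sum_(i < nb) ys x i ^+ 2) / 2)).
have -> : cos (X x + th) - G0 * Rv x = (cos (X x + th) - Rv x * G) + Rv x * (G - G0) by ring.
have hS2 : S2 x <= QH by exact: block_sqr_sum_le.
rewrite (le_trans (ler_normD _ _))// lerD//.
  have hy j : (j < nb)%N -> `|ys x j| <= dl.
    move=> _; rewrite /ys normrM (le_trans _ hdl)// ler_wpM2l//.
    exact: block_sum_le.
  have := riesz_approx th dl1 hy; rewrite yS => /le_trans; apply.
  by rewrite yS2 ler_wpM2l ?mulr_ge0// ler_wpM2l.
rewrite normrM -mulrA ler_pM//.
  have hn := riesz_norm (ys x) nb.
  apply: rotation_le; first exact: expR_ge0.
  apply: (le_trans hn); rewrite yS2 (expr2 KK) /KK -expRD -splitr ler_expR.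
  by rewrite ler_wpM2l.
rewrite /G /G0 yS2 (le_trans (expR_lip _ _))//.
- by rewrite divr_ge0// mulr_ge0.
- by rewrite divr_ge0// mulr_ge0// diag_sum_ge0.
rewrite -mulrBl -mulrBr normrM normrM (ger0_norm t20) [`|2^-1|]ger0_norm//.
by rewrite mulrAC.
Qed.

End Blocks.

(** * Cutting the indices into blocks and gaps *)

Section Windows.
Variables (r s a : nat).
Hypotheses (r0 : (0 < r)%N) (s1 : (1 < s)%N).

(** Windows of [r] consecutive indices are numbered and shifted by [a]; the last
    window in each group of [s] is a gap, and the others form a block. *)
Definition gap (k : nat) : bool := ((k %/ r + a) %% s == s.-1)%N.
Definition block (k : nat) : nat := ((k %/ r + a) %/ s)%N.

Lemma block_gap k k' : ~~ gap k' -> (block k' < block k)%N -> (k' + r < k)%N.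
Proof.
rewrite /gap /block; set w := (k %/ r + a)%N; set w' := (k' %/ r + a)%N.
move=> g lt.
have s0 : (0 < s)%N by exact: ltnW.
have m' : (w' %% s < s.-1)%N.
  by rewrite ltn_neqAle g -ltnS prednK// ltn_mod.
have e := divn_eq w s; have e' := divn_eq w' s.
have h : ((w' %/ s).+1 * s <= w %/ s * s)%N by rewrite leq_mul2r lt orbT.
have ww : (w' + 2 <= w)%N by rewrite mulSn in h; lia.
have kk : (k' %/ r + 2 <= k %/ r)%N by rewrite /w /w' in ww; lia.
have e1 := divn_eq k r; have e2 := divn_eq k' r.
have l2 : (k' %% r < r)%N by rewrite ltn_mod.
have h2 : ((k' %/ r + 2) * r <= k %/ r * r)%N by rewrite leq_mul2r kk orbT.
rewrite mulnDl in h2; lia.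
Qed.

Lemma block_size (N i : nat) (P : pred nat) :
  (\sum_(0 <= k < N | P k && (block k == i)) 1 <= r * s)%N.
Proof.
rewrite sum1_count -size_filter -(size_iota (i * s * r - a * r) (r * s)).
apply: uniq_leq_size; first by rewrite filter_uniq// iota_uniq.
move=> k; rewrite mem_filter mem_iota => /andP[/andP[_ /eqP bi] _].
rewrite /block in bi.
have s0 : (0 < s)%N by exact: ltnW.
have e := divn_eq (k %/ r + a) s; have e1 := divn_eq k r.
have l1 : (k %% r < r)%N by rewrite ltn_mod.
have l2 : ((k %/ r + a) %% s < s)%N by rewrite ltn_mod.
rewrite bi in e; set w := (k %/ r)%N in e e1.
have u1 : (i * s <= w + a)%N by rewrite e leq_addr.
have u2 : (w + a < i * s + s)%N by rewrite e ltn_add2l.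
have v1 : (i * s * r <= (w + a) * r)%N by rewrite leq_mul2r u1 orbT.
have v2 : ((w + a).+1 * r <= (i * s + s) * r)%N by rewrite leq_mul2r u2 orbT.
rewrite mulSn !mulnDl in v1 v2.
rewrite (mulnC r s).
by apply/andP; split; lia.
Qed.

End Windows.

Section Pigeonhole.
Variable R : realType.

Lemma gap_sum_le1 (r s : nat) k : (1 < s)%N -> \sum_(a < s) (gap r s a k)%:R <= 1 :> R.
Proof.
move=> s1; have s0 : (0 < s)%N by exact: ltnW.
under eq_bigr do rewrite -[_%:R]mul1r.
apply: sum_le_unique => //; first exact: index_enum_uniq.
move=> i i' _ _ /eqP h /eqP h'; apply: val_inj => /=.
have : (k %/ r + i = k %/ r + i' %[mod s])%N by rewrite h h'.
by move/eqP; rewrite eqn_modDl !modn_small// => /eqP.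
Qed.

(** For different shifts the gaps are disjoint, so one of the [s] shifts carries
    at most the average. *)
Lemma gap_choice (r s N : nat) (c : nat -> R) : (1 < s)%N ->
  exists2 a, (a < s)%N & \sum_(0 <= k < N) c k ^+ 2 * (gap r s a k)%:R <=
     (\sum_(0 <= k < N) c k ^+ 2) / s%:R.
Proof.
move=> s1; apply: contrapT => hn.
have s0 : (0 < s)%N by exact: ltnW.
have h (a : 'I_s) : (\sum_(0 <= k < N) c k ^+ 2) / s%:R <
    \sum_(0 <= k < N) c k ^+ 2 * (gap r s a k)%:R.
  by rewrite ltNge; apply/negP => hle; apply: hn; exists a.
have : \sum_(a < s) ((\sum_(0 <= k < N) c k ^+ 2) / s%:R) <
    \sum_(a < s) \sum_(0 <= k < N) c k ^+ 2 * (gap r s a k)%:R.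
  apply: ltr_sum => //; apply/hasP; exists (Ordinal s0) => //.
rewrite sumr_const card_ord -[X in X < _]mulr_natr divfK ?pnatr_eq0 -?lt0n// exchange_big/=.
apply/negP; rewrite -leNgt; apply: ler_sum => k _.
by rewrite -mulr_sumr ler_piMr ?sqr_ge0// gap_sum_le1.
Qed.

Section sep.
Variables (n : nat -> nat) (K0 : nat) (q : R).
Hypothesis q1 : 1 < q.
Hypothesis n0 : forall k, (K0 <= k)%N -> (0 < n k)%N.
Hypothesis nq : forall k, (K0 <= k)%N -> q * (n k)%:R <= (n k.+1)%:R.

Lemma lac_prefix_sum (r k : nat) (P : pred nat) (N : nat) : (K0 <= k)%N ->
  (forall k', P k' -> (K0 <= k')%N /\ (k' + r <= k)%N) ->
  (\sum_(0 <= k' < N | P k') n k')%N%:R <= q^-1 ^+ r * (1 - q^-1)^-1 * (n k)%:R.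
Proof.
move=> Kk hP; have q0 : 0 < q by exact: lt_trans q1.
have th01 : 0 <= q^-1 < 1 by rewrite invr_ge0 (ltW q0)/= invf_lt1.
have th0 : 0 <= q^-1 by case/andP: th01.
have grow k' : P k' -> (n k')%:R <= q^-1 ^+ (k - k') * (n k)%:R.
  move=> /hP[Kk' k'k].
  have kk : (k' <= k)%N by rewrite (leq_trans _ k'k)// leq_addr.
  have := lac_growth q1 nq (k - k') Kk'; rewrite subnKC// => h.
  by rewrite exprVn ler_pdivlMl ?exprn_gt0.
rewrite natr_sum.
apply: (@le_trans _ _ (\sum_(0 <= k' < N | P k') q^-1 ^+ (k - k') * (n k)%:R)).
  by apply: ler_sum => k' /grow.
rewrite -mulr_suml ler_wpM2r//.
apply: (@le_trans _ _ (\sum_(0 <= k' < N | (k' + r <= k)%N) q^-1 ^+ (k - k'))).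
  rewrite big_mkcond [leRHS]big_mkcond/=; apply: ler_sum => k' _.
  case: ifP => [/hP[_ ->]//|_]; case: ifP => // _.
  by rewrite exprn_ge0.
have [rk|kr] := leqP r k; last first.
  rewrite big_pred0; last first.
    by move=> k'; apply/negbTE; rewrite -ltnNge (leq_trans kr)// leq_addl.
  rewrite mulr_ge0 ?exprn_ge0// invr_ge0 subr_ge0.
  by case/andP: th01 => _ /ltW.
apply: (@le_trans _ _ (\sum_(0 <= k' < (k - r).+1) q^-1 ^+ (k - k'))).
  rewrite (@big_nat_widen _ _ _ 0 (k - r).+1 (maxn N (k - r).+1)) ?leq_maxr//.
  rewrite (@big_nat_widen _ _ _ 0 N (maxn N (k - r).+1)) ?leq_maxl//.
  rewrite big_mkcond [leRHS]big_mkcond/=; apply: ler_sum => k' _.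
  rewrite ltnS; case: ifP => [/andP[h _]|_].
    by rewrite ifT// leq_subRL// addnC.
  by case: ifP => // _; rewrite exprn_ge0.
rewrite big_nat_rev/= add0n.
have -> : \sum_(0 <= i < (k - r).+1) q^-1 ^+ (k - ((k - r).+1 - i.+1)) =
   q^-1 ^+ r * \sum_(0 <= i < (k - r).+1) q^-1 ^+ i.
  rewrite mulr_sumr big_nat [RHS]big_nat; apply: eq_bigr => i /andP[_ ik].
  rewrite -exprD; congr (_ ^+ _); rewrite subSS ltnS in ik *; lia.
by rewrite ler_wpM2l ?exprn_ge0// big_mkord geom_le.
Qed.

Lemma gap_exists (D : nat) : exists2 r, (0 < r)%N &
  D%:R * (q^-1 ^+ r * (1 - q^-1)^-1) < 1.
Proof.
have q0 : 0 < q by exact: lt_trans q1.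
have th0 : 0 <= q^-1 by rewrite invr_ge0 ltW.
have th1 : q^-1 < 1 by rewrite invf_lt1.
have th' : `|q^-1| < 1 by rewrite ger0_norm.
have hc := cvg_geometric (D%:R * (1 - q^-1)^-1) th'.
have he : \forall i \near \oo, geometric (D%:R * (1 - q^-1)^-1) q^-1 i < 1.
  by apply: (cvgr_lt 0 hc).
have [r [h1 h2]] : exists r, geometric (D%:R * (1 - q^-1)^-1) q^-1 r < 1 /\ (0 < r)%N.
  have := filter_ex (filterI he (nbhs_infty_gt 0%N)).
  by move=> [r [? ?]]; exists r.
exists r => //.
by move: h1; rewrite /geometric/=; rewrite mulrAC mulrA.
Qed.

End sep.
End Pigeonhole.

(** * Growth and Diophantine bounds *)

Section Hypotheses.
Variable R : realType.

(** Any ratio strictly between 1 and the lower limit is eventually exceeded. *)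
Lemma lacunary_growth (n : nat -> nat) : (forall k, (1 <= k)%N -> (0 < n k)%N) ->
  lacunary R n -> exists q : R, exists K0 : nat, [/\ 1 < q, (0 < K0)%N &
    forall k, (K0 <= k)%N -> q * (n k)%:R <= (n k.+1)%:R].
Proof.
move=> n0 [q q1]; set u := fun k => _; rewrite limn_einf_lim.
have /cvg_lim -> // := @cvg_einfs_sup R u.
pose p := (1 + q) / 2.
have p1 : 1 < p by rewrite /p; lra.
have pq : p < q by rewrite /p; lra.
move=> hq; have : (p%:E < ereal_sup (range (einfs u)))%E by rewrite (lt_le_trans _ hq)// lte_fin.
move=> /ereal_sup_gt[_ [k0 _ <-]] hk.
exists p, k0.+1; split => // k k0k.
have : (p%:E <= u k)%E.
  apply: (le_trans (ltW hk)); apply: ereal_inf_lbound; exists k => //=.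
  exact: ltnW.
rewrite lee_fin ler_pdivlMr// ltr0n n0//.
exact: leq_ltn_trans k0k.
Qed.

Lemma array_le1 (c : nat -> nat -> R) : (array_sup c <= 1%:E)%E ->
  forall k N, (1 <= k <= N)%N -> c k N <= 1.
Proof.
move=> h k N kN; rewrite -lee_fin; apply: le_trans h.
apply: (@le_trans _ _ (ereal_sup [set (c k N)%:E | k in [set k : nat | (1 <= k <= N)%N]])).
  by apply: ereal_sup_ubound; exists k.
by apply: ereal_sup_ubound; exists N.
Qed.

Section dio.
Variables (n : nat -> nat) (c : nat -> nat -> R) (N D : nat).
Hypothesis n0 : forall k, (1 <= k)%N -> (0 < n k)%N.
Hypothesis c0 : forall k, (1 <= k <= N)%N -> 0 <= c k N.

Let mem k : k \in index_iota 1 N.+1 -> (1 <= k <= N)%N.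
Proof. by rewrite mem_index_iota ltnS. Qed.

Lemma dioph_sum_ub v : dioph_sum n c N D v <=
  \sum_(1 <= k < N.+1) \sum_(1 <= l < N.+1)
    \sum_(1 <= j < D.+1) \sum_(1 <= j' < D.+1) c k N * c l N.
Proof.
rewrite /dioph_sum big_seq [leRHS]big_seq; apply: ler_sum => k /mem /c0 ck.
rewrite big_seq [leRHS]big_seq; apply: ler_sum => l /mem /c0 cl.
apply: ler_sum => j _; apply: ler_sum => j' _.
by rewrite ler_piMr ?mulr_ge0//; case: eqP.
Qed.

Lemma dioph_sum_ge0 v : 0 <= dioph_sum n c N D v.
Proof.
rewrite /dioph_sum big_seq; apply: sumr_ge0 => k /mem /c0 ck.
rewrite big_seq; apply: sumr_ge0 => l /mem /c0 cl.
by apply: sumr_ge0 => j _; apply: sumr_ge0 => j' _; rewrite !mulr_ge0 ?ler0n.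
Qed.

Lemma dioph_sum0_ge0 : 0 <= dioph_sum0 n c N D.
Proof.
rewrite /dioph_sum0 big_seq; apply: sumr_ge0 => k /mem /c0 ck.
rewrite big_seq_cond; apply: sumr_ge0 => l /andP[/mem /c0 cl _].
by apply: sumr_ge0 => j _; apply: sumr_ge0 => j' _; rewrite !mulr_ge0 ?ler0n.
Qed.

Lemma dioph_sum_le v : 0 < v -> dioph_sum n c N D v <= Lsup n c N D.
Proof.
move=> v0; apply: ub_le_sup; last by exists v.
by eexists => _ [w _ <-]; exact: dioph_sum_ub.
Qed.

Lemma Lsup_ge0 : 0 <= Lsup n c N D.
Proof. exact: le_trans (dioph_sum_ge0 1) (dioph_sum_le ltr01). Qed.

Variables (cA : nat -> R).
Hypothesis cA0 : forall k, 0 <= cA k.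
Hypothesis cA_out : cA 0%N = 0.
Hypothesis cA_le : forall k, (1 <= k <= N)%N -> cA k <= c k N.

Let s0 := [seq (k, j) | k <- index_iota 0 N.+1, j <- index_iota 1 D.+1].
Let v (al : nat * nat) : int := (al.2 * n al.1)%N.

(** An absolute difference [z > 0] is a difference [z] or [- z], whence the
    factor 2.  For [z = 0] two distinct pairs have [k != l], because
    [j * n k = j' * n k] forces [j = j']. *)
Lemma correlation_le_Lstar (z : nat) :
  \sum_(al <- s0) \sum_(al' <- s0)
    cA al.1 * cA al'.1 * (al != al')%:R * (`|v al - v al'|%N == z)%:R <=
  2 * Lstar n c N D.
Proof.
have L0 := Lsup_ge0; have D0 := dioph_sum0_ge0.
pose F (k j l j' : nat) : R := cA k * cA l * ((k, j) != (l, j'))%:R *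
   (`|(j * n k)%N%:Z - (j' * n l)%N%:Z|%N == z)%:R.
have -> : \sum_(al <- s0) \sum_(al' <- s0)
    cA al.1 * cA al'.1 * (al != al')%:R * (`|v al - v al'|%N == z)%:R =
  \sum_(1 <= k < N.+1) \sum_(1 <= l < N.+1)
    \sum_(1 <= j < D.+1) \sum_(1 <= j' < D.+1) F k j l j'.
  rewrite big_allpairs_dep/= big_nat_recl//= [X in X + _]big1 ?add0r; last first.
    by move=> j _; rewrite big1// => al' _; rewrite cA_out !mul0r.
  rewrite [RHS]big_add1/=; apply: eq_bigr => k _.
  rewrite exchange_big/= big_allpairs_dep/= big_nat_recl//= [X in X + _]big1 ?add0r; last first.
    by move=> j _; rewrite big1// => al' _; rewrite cA_out mulr0 !mul0r.
  rewrite [RHS]big_add1/=; apply: eq_bigr => l _.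
  by rewrite exchange_big.
have int_eq (x y w : nat) : (`|x%:Z - y%:Z|%N == w) =
    (x%:R - y%:R == w%:R :> R) || (y%:R - x%:R == w%:R :> R).
  rewrite !subr_eq -!natrD !eqr_nat.
  have [xy|/ltnW xy] := leqP x y; first by rewrite distnEr//; lia.
  by rewrite distnEl//; lia.
have [z0|z0] := posnP z.
  apply: (@le_trans _ _ (dioph_sum0 n c N D)); last by rewrite /Lstar; lra.
  rewrite /dioph_sum0 big_seq [leRHS]big_seq; apply: ler_sum => k /mem kN.
  rewrite [leRHS]big_mkcond big_seq [leRHS]big_seq; apply: ler_sum => l /mem lN.
  have kcase := boolP (k != l).
  have [kl|/negPn/eqP kl] := kcase.
    apply: ler_sum => j _; apply: ler_sum => j' _; rewrite /F z0.
    rewrite int_eq (_ : (_%:R - _ == _) || _ = ((j * n k)%N%:R - (j' * n l)%N%:R == 0 :> R)); last first.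
      by rewrite !subr_eq !add0r [X in _ || X]eq_sym orbb.
    rewrite ler_wpM2r ?ler0n//.
    apply: (@le_trans _ _ (cA k * cA l)); first by rewrite ler_piMr ?mulr_ge0//; case: eqP.
    by rewrite ler_pM// cA_le.
  rewrite big1// => j _; rewrite big1// => j' _; rewrite /F kl z0.
  have [//|ne] := eqVneq (l, j) (l, j'); first by rewrite mulr0 mul0r.
  suff -> : (`|(j * n l)%N%:Z - (j' * n l)%N%:Z|%N == 0%N) = false by rewrite mulr0.
  apply/negbTE; rewrite absz_eq0 subr_eq0 eqz_nat eqn_pmul2r; last first.
    by apply: n0; case/andP: lN.
  by apply: contra ne => /eqP ->.
apply: (@le_trans _ _ (dioph_sum n c N D z%:R + dioph_sum n c N D z%:R)); last first.
  have h : dioph_sum n c N D z%:R <= Lsup n c N D by apply: dioph_sum_le; rewrite ltr0n.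
  by rewrite /Lstar; lra.
have sym : dioph_sum n c N D z%:R = \sum_(1 <= k < N.+1) \sum_(1 <= l < N.+1)
    \sum_(1 <= j < D.+1) \sum_(1 <= j' < D.+1)
      c k N * c l N * ((j' * n l)%N%:R - (j * n k)%N%:R == z%:R :> R)%:R.
  rewrite /dioph_sum exchange_big/=; apply: eq_bigr => k _; apply: eq_bigr => l _.
  rewrite exchange_big/=; apply: eq_bigr => j _; apply: eq_bigr => j' _.
  by rewrite [c l N * _]mulrC.
rewrite {2}sym /dioph_sum -big_split/= big_seq [leRHS]big_seq; apply: ler_sum => k /mem kN.
rewrite -big_split/= big_seq [leRHS]big_seq; apply: ler_sum => l /mem lN.
rewrite -big_split/=; apply: ler_sum => j _.
rewrite -big_split/=; apply: ler_sum => j' _.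
rewrite /F int_eq -mulrDr.
have cc : 0 <= c k N * c l N by rewrite mulr_ge0// c0.
apply: ler_pM.
- by rewrite !mulr_ge0// ler0n.
- by rewrite ler0n.
- apply: (@le_trans _ _ (cA k * cA l)); first by rewrite ler_piMr ?mulr_ge0//; case: eqP.
  by rewrite ler_pM// cA_le.
by case: eqP => _; case: eqP => _ /=; rewrite ?addr0 ?add0r ?lerDl ?ler01.
Qed.

Lemma Lstar_ge0 : 0 <= Lstar n c N D.
Proof. by rewrite addr_ge0 ?Lsup_ge0 ?dioph_sum0_ge0. Qed.

End dio.
End Hypotheses.

(** * L2 errors of the Fourier truncation *)

Section Tail.
Variable R : realType.
Local Notation E u := (Rintegral (circle R) setT u).
Local Notation sqint := (sqint (circle R)).

Lemma measurable_scale (u : R -> R) (a : R) : measurable_fun setT u ->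
  measurable_fun setT (fun x : R => u (a * x)).
Proof.
move=> mu; apply: (measurableT_comp mu).
exact: measurable_funM.
Qed.

Lemma sqint_scale (u : R -> R) k : (0 < k)%N -> periodic u 1 -> sqint u ->
  sqint (fun x => u (k%:R * x)) /\
  E (fun x => u (k%:R * x) ^+ 2) = E (fun x => u x ^+ 2).
Proof.
move=> k0 pu hu; have [mu iu] := hu.
have mk := measurable_scale k%:R mu.
have e : (\int[circle R]_x (u (k%:R * x) ^+ 2)%:E = \int[circle R]_x (u x ^+ 2)%:E)%E.
  apply: (@circle_scale _ (fun y => u y ^+ 2)) => //.
  - exact: measurable_funX.
  - by move=> x; exact: sqr_ge0.
  - by move=> x; rewrite pu.
split; last by rewrite /Rintegral e.
split=> //; apply: (@ge0_integrable _ _ _ (circle R) _ (E (fun x => u x ^+ 2))).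
- exact: measurable_funX.
- by move=> x; exact: sqr_ge0.
- by rewrite e (E_sqr_EFin hu).
Qed.

Section sums.
Variables (n : nat -> nat) (u : R -> R).
Hypotheses (pu : periodic u 1) (hu : sqint u).

Lemma sqint_sum_scale N (P : pred nat) (c : nat -> R) :
  (forall k, P k -> (0 < n k)%N) ->
  sqint (fun x => \sum_(0 <= k < N | P k) c k * u ((n k)%:R * x)).
Proof.
move=> n0; apply: sqint_sum => k /n0 k0; apply: sqintZ.
by have [] := sqint_scale k0 pu hu.
Qed.

(** The factor [N] is harmless for a fixed number of terms, or if [u] can be made
    small after [N] has been fixed. *)
Lemma E_sum_scale N (P : pred nat) (c : nat -> R) :
  (forall k, P k -> (0 < n k)%N) ->
  E (fun x => (\sum_(0 <= k < N | P k) c k * u ((n k)%:R * x)) ^+ 2) <=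
  N%:R * (\sum_(0 <= k < N | P k) c k ^+ 2) * E (fun x => u x ^+ 2).
Proof.
move=> n0; have [_ i1] := sqint_sum_scale N c n0.
have ik k : P k -> (circle R).-integrable setT
    (EFin \o (fun x => (c k * u ((n k)%:R * x)) ^+ 2)).
  by move=> /n0 k0; have [] := sqintZ (c k) (sqint_scale k0 pu hu).1.
have EE (s : seq nat) :
    (circle R).-integrable setT (EFin \o (fun x => \sum_(k <- s | P k) (c k * u ((n k)%:R * x)) ^+ 2)) /\
    E (fun x => \sum_(k <- s | P k) (c k * u ((n k)%:R * x)) ^+ 2) =
    \sum_(k <- s | P k) c k ^+ 2 * E (fun x => u x ^+ 2).
  elim: s => [|k s [IH1 IH2]].
    split; last by rewrite big_nil; under eq_Rintegral do rewrite big_nil; rewrite Rintegral_cst1.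
    have := @finite_measure_integrable_cst _ _ _ (circle R) setT 0 measurableT.
    by apply: eq_integrable => // x _ /=; rewrite big_nil.
  rewrite big_cons; have [pk|npk] := boolP (P k); last first.
    split; first by move: IH1; apply: eq_integrable => // x _ /=; rewrite big_cons (negbTE npk).
    by rewrite -IH2; apply: eq_Rintegral => x _; rewrite big_cons (negbTE npk).
  split.
    have := integrableD measurableT (ik k pk) IH1; apply: eq_integrable => // x _ /=.
    by rewrite big_cons pk EFinD.
  rewrite -IH2 -(sqint_scale (n0 k pk) pu hu).2 -RintegralZl//; last first.
    by have [[]] := sqint_scale (n0 k pk) pu hu.
  rewrite -RintegralD//; last first.
    by move: (ik k pk); apply: eq_integrable => // x _ /=; rewrite exprMn.
  by apply: eq_Rintegral => x _; rewrite big_cons pk exprMn.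
have [i2 e2] := EE (index_iota 0 N).
rewrite -mulrA mulr_suml -e2 -RintegralZl//.
apply: le_Rintegral => //.
  by have := integrableZl measurableT N%:R i2; apply: eq_integrable.
move=> x _; apply: (le_trans (sqr_sum_le _ _ _)); rewrite ler_wpM2r//.
  by apply: sumr_ge0 => k _; exact: sqr_ge0.
rewrite (@le_trans _ _ (\sum_(0 <= k < N) 1))//.
  by rewrite big_mkcond; apply: ler_sum => k _; case: ifP.
by rewrite sumr_const_nat subn0.
Qed.

End sums.

Section tail.
Variables (f : R -> R) (n : nat -> nat) (q M rho : R) (K0 : nat).
Hypotheses (q1 : 1 < q) (n0 : forall k, (K0 <= k)%N -> (0 < n k)%N).
Hypothesis nq : forall k, (K0 <= k)%N -> q * (n k)%:R <= (n k.+1)%:R.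
Hypotheses (pf : periodic f 1) (fL : f \in Lfun (circle R) 2%:E) (f0 : E f = 0).
Hypotheses (M0 : 0 < M) (rho0 : 0 < rho).
Hypothesis f_coef : forall j, (1 <= j)%N ->
  `|fourier_cos f j| + `|fourier_sin f j| <= M * (j%:R `^ (- rho)).

Let hf : sqint f := Lfun_sqint fL.

Definition tail_const : R := 2 / (1 - q `^ (- rho)) * M ^+ 2.

Lemma tail_const_ge0 : 0 <= tail_const.
Proof.
have /andP[_ h] := theta01 q1 rho0.
by rewrite mulr_ge0 ?sqr_ge0// divr_ge0// subr_ge0 ltW.
Qed.

Lemma periodic_fourier_sum D : periodic (fourier_sum f D) 1.
Proof.
move=> x; apply: eq_bigr => j _; rewrite /wave mulrDr mulr1.
have -> : 2 * pi * (j%:Z)%:~R = pi *+ 2 *+ j :> R.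
  by rewrite [2 * pi]mulr_natl; exact: mulr_natr.
by rewrite (periodicn (@cosD2pi R)) (periodicn (@sinD2pi R)).
Qed.

(** Coefficients of index between [D] and [D'] are covered by [lacunary_L2]; for
    fixed [N] the remainder beyond [D'] vanishes as [D'] tends to infinity. *)
Lemma tail_L2 (c : nat -> R) N D e : (forall k, 0 <= c k) ->
  (forall k, (k < K0)%N -> c k = 0) ->
  (forall D', \sum_(D.+1 <= j < D'.+1) j%:R `^ (- (2 * rho)) <= e) ->
  E (fun x => (\sum_(0 <= k < N) c k * (f ((n k)%:R * x) - fourier_sum f D ((n k)%:R * x))) ^+ 2) <=
  2 * (tail_const * e * \sum_(0 <= k < N) c k ^+ 2).
Proof.
move=> c0 cK he; set H := \sum_(0 <= k < N) c k ^+ 2.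
have H0 : 0 <= H by apply: sumr_ge0 => k _; exact: sqr_ge0.
apply/ler_addgt0Pr => dl dl0.
have NH : 0 < 2 * (N%:R * H + 1) by rewrite mulr_gt0// ltr_wpDl// mulr_ge0.
have [D0 hD] := fourier_sum_cvg hf f0 fL (divr_gt0 dl0 NH).
pose D' := maxn D D0; have := hD D' (leq_maxr _ _).
have DD' : (D <= D')%N by exact: leq_maxl.
move: D' DD' => D' DD' hD'.
pose p x := \sum_(0 <= k < N | (K0 <= k)%N) c k * (f ((n k)%:R * x) - fourier_sum f D' ((n k)%:R * x)).
pose g x := \sum_(k < N) c k * \sum_(D.+1 <= j < D'.+1)
   wave j (fourier_cos f j) (fourier_sin f j) ((n k)%:R * x).
pose r y := f y - fourier_sum f D' y.
have pr : periodic r 1 by move=> x; rewrite /r pf periodic_fourier_sum.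
have hr : sqint r by exact: sqintB hf (trig_sqint (trig_fourier_sum f D')).
have n0' k : (K0 <= k)%N -> (0 < n k)%N by exact: n0.
have hp : sqint p by exact: (sqint_sum_scale (n := n) pr hr N c n0').
have hp2 : E (fun x => p x ^+ 2) <= N%:R * H * (dl / (2 * (N%:R * H + 1))).
  apply: (le_trans (E_sum_scale (n := n) pr hr N c n0')).
  rewrite ler_pM ?mulr_ge0 ?E_sqr_ge0//.
    by apply: sumr_ge0 => k _; exact: sqr_ge0.
  rewrite ler_wpM2l// /H big_mkcond/=; apply: ler_sum => k _.
  by case: ifP; rewrite ?sqr_ge0.
have hg : sqint g.
  apply: (@trig_sqint _ (freqs setT)); apply: trig_sum => k _; apply: trigZ.
  apply: (@eq_trig _ _ (fun x => \sum_(D.+1 <= j < D'.+1)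
     wave (j * n k)%N (fourier_cos f j) (fourier_sin f j) x)).
    by move=> x; apply: eq_bigr => j _; rewrite wave_scale.
  by apply: trig_sum => j _; exact: trig_wave.
have hg2 : E (fun x => g x ^+ 2) <= tail_const * e * H.
  apply: (le_trans (lacunary_L2 q1 n0 nq N D D' rho0 M0 f_coef c0 cK)).
  rewrite -/tail_const /H big_mkord ler_wpM2r//.
    by apply: sumr_ge0 => k _; exact: sqr_ge0.
  by rewrite ler_wpM2l// tail_const_ge0.
have -> : E (fun x => (\sum_(0 <= k < N) c k * (f ((n k)%:R * x) - fourier_sum f D ((n k)%:R * x))) ^+ 2) =
   E (fun x => (g x + p x) ^+ 2).
  apply: eq_Rintegral => x _; congr (_ ^+ 2).
  rewrite /g /p [X in _ + X]big_mkcond/= -(big_mkord xpredT (fun k => c k * \sum_(D.+1 <= j < D'.+1)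
   wave j (fourier_cos f j) (fourier_sin f j) ((n k)%:R * x))) -big_split/=.
  apply: eq_bigr => k _; case: leqP => [Kk|kK]; last by rewrite cK// !mul0r addr0.
  rewrite -mulrDr; congr (_ * _).
  rewrite [in RHS]/fourier_sum (@big_cat_nat _ _ _ D.+1 1 D'.+1)//= /fourier_sum.
  by ring.
apply: (le_trans (E_sqrD_le hg hp)); apply: lerD; first by rewrite ler_wpM2l.
apply: (@le_trans _ _ (2 * (N%:R * H * (dl / (2 * (N%:R * H + 1)))))).
  by rewrite ler_wpM2l.
have NH0 : 0 <= N%:R * H by exact: mulr_ge0.
move: (N%:R * H) NH0 {NH hD hD' hp2} => y y0.
have -> : 2 * (y * (dl / (2 * (y + 1)))) = dl * (y / (y + 1)) by field; apply/eqP; lra.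
by rewrite ler_piMr ?(ltW dl0)// ler_pdivrMr; lra.
Qed.

End tail.
End Tail.

(** * The normalized sums *)

Section Assembly.
Variable R : realType.
Local Notation E u := (Rintegral (circle R) setT u).
Local Notation sqint := (sqint (circle R)).

(** Parseval's identity for the partial sums. *)
Lemma fourier_sum_sqr (f : R -> R) D : sqint f -> E f = 0 ->
  E (fun x => fourier_sum f D x ^+ 2) =
  \sum_(1 <= j < D.+1) (fourier_cos f j ^+ 2 + fourier_sin f j ^+ 2) / 2.
Proof.
move=> hf f0.
transitivity (E (fun x => \sum_(1 <= j < D.+1)
    (fourier_sum f D x * wave j (fourier_cos f j) (fourier_sin f j) x))).
  by apply: eq_Rintegral => x _; rewrite expr2 {2}/fourier_sum mulr_sumr.
rewrite (@trig_E_sum _ setT); last first.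
  move=> j _; apply: (@trigM _ setT setT) => //.
    exact: trig_sub (trig_fourier_sum f D).
  exact: trig_sub (trig_wave (A := setT) _ _ I).
rewrite big_seq [RHS]big_seq; apply: eq_bigr => j.
rewrite mem_index_iota => /andP[j0 jD].
by rewrite E_sum_wave//; congr (_ / 2); ring.
Qed.

Lemma cos_lip (x y : R) : `|cos x - cos y| <= `|x - y|.
Proof.
wlog yx : x y / y <= x.
  by move=> H; have [/H//|/ltW/H] := leP y x; rewrite distrC [leRHS]distrC.
have hd (z : R) : is_derive z 1 (fun z : R => cos (y + z)) (- sin (y + z)).
  have hl : is_derive z 1 (fun z : R => y + z) 1 by apply: is_derive_eq; rewrite /GRing.scale/=; ring.
  have := is_derive1_comp (is_derive_cos (y + z)) hl.
  by rewrite mulr1.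
have xy : 0 <= x - y by rewrite subr_ge0.
have [u _] := MVT0 xy hd.
rewrite addr0 (addrC y) subrK => ->; rewrite normrM normrN ler_piMl//.
by rewrite ler_norml sin_geN1 sin_le1.
Qed.

Lemma E_cos_perturb (u v : R -> R) (tau th e : R) : 0 < e ->
  measurable_fun setT u -> sqint v ->
  `|E (fun x => cos (tau * (u x + v x) + th)) - E (fun x => cos (tau * u x + th))| <=
  `|tau| * (e + E (fun x => v x ^+ 2) / e).
Proof.
move=> e0 mu hv; have [mv _] := hv.
have ic (w : R -> R) : measurable_fun setT w ->
    (circle R).-integrable setT (EFin \o (fun x => cos (tau * w x + th))).
  move=> mw; apply: (@bounded_integrable _ _ _ (circle R) _ 1); last by move=> x; exact: cos_max.
  apply: measurableT_comp; first exact: continuous_measurable_fun (@continuous_cos R).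
  by apply: measurable_funD => //; exact: measurable_funM.
have i1 := ic _ (measurable_funD mu mv); have i2 := ic _ mu.
have iv := sqint_integrable hv.
have iav : (circle R).-integrable setT (EFin \o (fun x => `|v x|)).
  by have := integrable_abse iv; apply: eq_integrable.
rewrite -RintegralB// -[leRHS]add0r.
apply: (@Rintegral_norm_le _ _ _ (circle R) _ 0 `|tau| _ (fun x => `|v x|)) => //.
- by have := integrableB measurableT i1 i2; apply: eq_integrable.
- exact: measurableT_comp.
- have -> : (\int[circle R]_x (`|v x|)%:E = (E (fun x => `|v x|))%:E)%E.
    by rewrite /Rintegral fineK//; exact: integrable_fin_num.
  by rewrite lee_fin; exact: E_norm_le.
move=> x; rewrite add0r -normrM (le_trans (cos_lip _ _))//.
by rewrite le_eqVlt; apply/orP; left; apply/eqP; congr `|_|; ring.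
Qed.

Lemma natr_above (x : R) : exists2 s, (1 < s)%N & x <= s%:R.
Proof.
have [s [s1 xs]] := filter_ex (filterI (nbhs_infty_gt 1) (@nbhs_infty_gtr R x)).
by exists s => //; exact: ltW.
Qed.

Variables (n : nat -> nat) (c : nat -> nat -> R) (f : R -> R) (M rho q : R) (K0 : nat).
Hypotheses (n_gt0 : forall k, (1 <= k)%N -> (0 < n k)%N).
Hypotheses (q1 : 1 < q) (K00 : (0 < K0)%N).
Hypothesis nq : forall k, (K0 <= k)%N -> q * (n k)%:R <= (n k.+1)%:R.
Hypothesis c_ge0 : forall k N, (1 <= k <= N)%N -> 0 <= c k N.
Hypothesis c_le1 : forall k N, (1 <= k <= N)%N -> c k N <= 1.
Hypotheses (pf : periodic f 1) (fL : f \in Lfun (circle R) 2%:E) (f0 : E f = 0).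
Hypotheses (M0 : 0 < M) (rho_gt : 1 / 2 < rho).
Hypothesis f_coef : forall j, (1 <= j)%N ->
  `|fourier_cos f j| + `|fourier_sin f j| <= M * (j%:R `^ (- rho)).

Let hf : sqint f := Lfun_sqint fL.
Let E0 := E (fun x => f x ^+ 2).
Hypothesis E00 : 0 < E0.
Let C0 := tail_const q M rho.

Let rho0 : 0 < rho.
Proof. by move: rho_gt; lra. Qed.

Let C00 : 0 <= C0 := tail_const_ge0 M q1 rho0.

Let n0 k : (K0 <= k)%N -> (0 < n k)%N.
Proof. by move=> Kk; apply: n_gt0; exact: leq_trans Kk. Qed.

Section fixed.
Variables (N D r s a : nat).
Hypotheses (r0 : (0 < r)%N) (s1 : (1 < s)%N).
Hypothesis gapD : D%:R * (q^-1 ^+ r / (1 - q^-1)) < 1.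
Hypothesis K0N : (K0 <= N)%N.

(** Entries outside [1 <= k <= N] are arbitrary, and are replaced by zero. *)
Definition weight k : R := if (0 < k <= N)%N then c k N else 0.
Definition kept k := (K0 <= k)%N && ~~ gap r s a k.
Definition kept_weight k : R := weight k * (kept k)%:R.
Definition gap_weight k : R := weight k * ((K0 <= k)%N && gap r s a k)%:R.

Lemma weight01 k : 0 <= weight k <= 1.
Proof.
by rewrite /weight; case: ifPn => [h|_]; rewrite ?c_ge0 ?c_le1// lexx ler01.
Qed.

Let wA := kept_weight.
Let wG := gap_weight.

Let wAle k : 0 <= wA k <= weight k.
Proof.
have /andP[h _] := weight01 k; rewrite mulr_ge0//=.
by rewrite ler_piMr//; case: kept.
Qed.

Let wGle k : 0 <= wG k <= weight k.
Proof.
have /andP[h _] := weight01 k; rewrite mulr_ge0//=.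
by rewrite ler_piMr//; case: andb.
Qed.

Lemma weight_sqr : \sum_(0 <= k < N.+1) weight k ^+ 2 = sum_sqr c N.
Proof.
rewrite big_nat_recl// /weight/= expr0n/= add0r /sum_sqr big_add1/=.
by rewrite big_nat [RHS]big_nat; apply: eq_bigr => k /andP[_ kN]; rewrite kN.
Qed.

Let HA := \sum_(0 <= k < N.+1) wA k ^+ 2.
Let HG := \sum_(0 <= k < N.+1) wG k ^+ 2.

Lemma kept_sqr_le : HA <= sum_sqr c N.
Proof.
rewrite -weight_sqr; apply: ler_sum => k _; have /andP[h1 h2] := wAle k.
by rewrite !expr2 ler_pM.
Qed.

Lemma gap_sqr_le : HG <= \sum_(0 <= k < N.+1) weight k ^+ 2 * (gap r s a k)%:R.
Proof.
apply: ler_sum => k _; rewrite /wG /gap_weight exprMn ler_wpM2l ?sqr_ge0//.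
by case: gap; case: (K0 <= k)%N; rewrite /= ?expr1n ?expr0n.
Qed.

Lemma kept_sqr_ge : sum_sqr c N - HG - K0%:R <= HA.
Proof.
rewrite -weight_sqr; have : \sum_(0 <= k < N.+1) weight k ^+ 2 <= HA + HG + K0%:R.
  have -> : K0%:R = \sum_(0 <= k < N.+1 | (k < K0)%N) 1 :> R.
    rewrite -[K0 in LHS]subn0 -(@sumr_const_nat R K0 0 1) (big_nat_widen _ _ N.+1) ?leqW//.
  rewrite [X in _ + X]big_mkcond/= /HA /HG -!big_split/=; apply: ler_sum => k _.
  have /andP[w0 w1] := weight01 k.
  rewrite /wA /wG /kept_weight /gap_weight /kept; case: leqP => kK /=.
    by case: gap; rewrite /= !(mulr1, mulr0) expr0n/= ?add0r !addr0.
  by rewrite !mulr0 expr0n/= !add0r expr_le1.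
lra.
Qed.

Lemma array_sum_weight x : \sum_(1 <= k < N.+1) c k N * f ((n k)%:R * x) =
  \sum_(0 <= k < N.+1) weight k * f ((n k)%:R * x).
Proof.
rewrite [RHS]big_nat_recl// [in RHS]/weight/= mul0r add0r big_add1/=.
by rewrite big_nat [RHS]big_nat; apply: eq_bigr => k /andP[_ kN]; rewrite kN.
Qed.

Definition kept_sum x := \sum_(0 <= k < N.+1) wA k * fourier_sum f D ((n k)%:R * x).

(** The sum over the gaps, the Fourier tail over the blocks, and the indices at
    which lacunary growth has not begun.  Subtracting the Fourier sum of order
    0, which is zero, makes the first sum an instance of [tail_L2]. *)
Definition remainder x :=
  (\sum_(0 <= k < N.+1) wG k * (f ((n k)%:R * x) - fourier_sum f 0 ((n k)%:R * x)) +
  \sum_(0 <= k < N.+1) wA k * (f ((n k)%:R * x) - fourier_sum f D ((n k)%:R * x))) +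
  \sum_(0 <= k < K0 | (0 < k)%N) weight k * f ((n k)%:R * x).

Lemma array_sum_split x : \sum_(1 <= k < N.+1) c k N * f ((n k)%:R * x) =
  kept_sum x + remainder x.
Proof.
rewrite array_sum_weight /kept_sum /remainder.
rewrite [X in _ + (_ + X)](big_nat_widen _ _ N.+1) ?leqW//.
rewrite [X in _ + (_ + X)]big_mkcond/= -!big_split/=; apply: eq_bigr => k _.
have f00 y : fourier_sum f 0 y = 0 by rewrite /fourier_sum big_nil.
rewrite f00 /wA /wG /kept_weight /gap_weight /kept; case: (ltnP k K0) => kK /=.
  have [->|k0] := posnP k; last by rewrite /= !(mulr0, mul0r, add0r).
  by rewrite /weight/= !(mulr0, mul0r, add0r).
by rewrite andbF; case: gap => /=; ring.
Qed.

Let wK k : (k < K0)%N -> wA k = 0 /\ wG k = 0.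
Proof.
by move=> kK; rewrite /wA /wG /kept_weight /gap_weight /kept leqNgt kK/= !mulr0.
Qed.

Lemma sqint_tail D0 (w : nat -> R) : (forall k, (k < K0)%N -> w k = 0) ->
  sqint (fun x => \sum_(0 <= k < N.+1) w k * (f ((n k)%:R * x) - fourier_sum f D0 ((n k)%:R * x))).
Proof.
move=> w0; pose u y := f y - fourier_sum f D0 y.
have pu : periodic u 1 by move=> x; rewrite /u pf periodic_fourier_sum.
have hu : sqint u by exact: sqintB hf (trig_sqint (trig_fourier_sum f D0)).
apply: eq_sqint (sqint_sum_scale (n := n) pu hu N.+1 w n0) => x.
rewrite big_mkcond/=; apply: eq_bigr => k _; case: leqP => // kK.
by rewrite w0// mul0r.
Qed.

Lemma sqint_remainder : sqint remainder.
Proof.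
apply: sqintD; first by apply: sqintD; apply: sqint_tail => k /wK[].
exact: sqint_sum_scale.
Qed.

Lemma remainder_L2 e0 eD :
  (forall D', \sum_(1 <= j < D'.+1) j%:R `^ (- (2 * rho)) <= e0) ->
  (forall D', \sum_(D.+1 <= j < D'.+1) j%:R `^ (- (2 * rho)) <= eD) ->
  E (fun x => remainder x ^+ 2) <=
  8 * (C0 * (e0 * HG + eD * sum_sqr c N)) + 2 * (K0%:R ^+ 2 * E0).
Proof.
move=> he0 heD.
have sG := sqint_tail 0 (fun k kK => (wK kK).2).
have sA := sqint_tail D (fun k kK => (wK kK).1).
have sI := sqint_sum_scale pf hf K0 weight n_gt0.
apply: (le_trans (E_sqrD_le (sqintD sG sA) sI)).
have hGA := E_sqrD_le sG sA.
have hG := tail_L2 q1 n0 nq pf fL f0 M0 rho0 f_coef N.+1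
  (fun k => proj1 (andP (wGle k))) (fun k kK => (wK kK).2) he0.
have hA := tail_L2 q1 n0 nq pf fL f0 M0 rho0 f_coef N.+1
  (fun k => proj1 (andP (wAle k))) (fun k kK => (wK kK).1) heD.
have hI := E_sum_scale pf hf K0 weight n_gt0.
have hI2 : K0%:R * (\sum_(0 <= k < K0 | (0 < k)%N) weight k ^+ 2) * E (fun x => f x ^+ 2) <=
    K0%:R ^+ 2 * E0.
  rewrite ler_wpM2r ?E_sqr_ge0// expr2 ler_wpM2l//.
  apply: (@le_trans _ _ (\sum_(0 <= k < K0) 1)); last by rewrite sumr_const_nat subn0.
  rewrite big_mkcond; apply: ler_sum => k _; case: ifP => // _.
  by have /andP[w0 w1] := weight01 k; rewrite expr_le1.
have hAH := kept_sqr_le.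
have eD0 : 0 <= eD.
  by apply: le_trans (heD 0%N); apply: sumr_ge0 => j _; exact: powR_ge0.
have hA2 : C0 * eD * HA <= C0 * eD * sum_sqr c N.
  by rewrite ler_wpM2l// mulr_ge0.
rewrite /HG; move: hI2 hI hGA hG hA hA2; rewrite -/HA -/HG -/C0 -/E0; lra.
Qed.

Lemma kept_clt (tau th dl e : R) : dl <= 1 -> 0 < e ->
  `|tau| * ((r * s)%:R * (D%:R * M)) <= dl ->
  `|E (fun x => cos (tau * kept_sum x + th)) -
     cos th * expR (- (tau ^+ 2 * (HA * E (fun x => fourier_sum f D x ^+ 2)) / 2))| <=
  4 * dl * (tau ^+ 2 * ((r * s)%:R * (D%:R * M) ^+ 2 * HA)) +
  expR (tau ^+ 2 * ((r * s)%:R * (D%:R * M) ^+ 2 * HA) / 2) * (tau ^+ 2 / 2) *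
  (e + 2 * (M ^+ 2 * D%:R ^+ 2 * (r * s)%:R * HA *
    (M ^+ 2 * (2 * Lstar n c N D + (D%:R * (r * s)%:R) ^+ 2))) / e).
Proof.
move=> dl1 e0 hdl.
(* The coefficient bound only holds from j = 1 on. *)
pose A j := if (0 < j)%N then fourier_cos f j else 0.
pose B j := if (0 < j)%N then fourier_sin f j else 0.
have AB j : `|A j| + `|B j| <= M.
  rewrite /A /B; case: posnP => j0; first by rewrite normr0 addr0 ltW.
  apply: (le_trans (f_coef j0)); rewrite ler_piMr ?(ltW M0)//.
  have : 1 `^ rho <= j%:R `^ rho :> R.
    by apply: ge0_ler_powR; rewrite ?nnegrE ?(ltW rho0)// ler1n.
  by rewrite powR1 powRN invf_le1 ?powR_gt0 ?ltr0n.
have tpE y : tpoly D A B y = fourier_sum f D y.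
  rewrite /tpoly /fourier_sum big_nat [RHS]big_nat; apply: eq_bigr => j /andP[j0 _].
  by rewrite /A /B j0.
have w0 k : 0 <= wA k by have /andP[] := wAle k.
have w1 k : wA k <= 1.
  by have /andP[_ h] := wAle k; have /andP[_ h'] := weight01 k; exact: le_trans h'.
have wout k : ~~ kept k -> wA k = 0.
  by move=> /negbTE h; rewrite /wA /kept_weight h mulr0.
have be_lt k : (k < N.+1)%N -> kept k -> (block r s a k < N.+1 + a)%N.
  move=> kN _; rewrite /block (leq_ltn_trans (leq_div _ _))// ltn_add2r.
  exact: leq_ltn_trans (leq_div _ _) kN.
have sep k : (k < N.+1)%N -> kept k ->
    (D * \sum_(0 <= k' < N.+1 | kept k' && (block r s a k' < block r s a k)) n k' < n k)%N.
  move=> _ /andP[Kk _].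
  have h := @lac_prefix_sum R n K0 q q1 nq r k
    (fun k' => kept k' && (block r s a k' < block r s a k)%N) N.+1 Kk.
  rewrite -(ltr_nat R) natrM.
  have nk : 0 < (n k)%:R :> R by rewrite ltr0n n0.
  apply: (@le_lt_trans _ _ (D%:R * (q^-1 ^+ r / (1 - q^-1)) * (n k)%:R)).
    rewrite -[leRHS]mulrA ler_wpM2l// h// => k' /andP[/andP[Kk' ng] bb]; split=> //.
    exact/ltnW/(block_gap r0 s1 ng bb).
  by rewrite gtr_pMl.
have size i := @block_size r s a r0 s1 N.+1 i kept.
have cc k : (1 <= k <= N)%N -> 0 <= c k N by exact: c_ge0.
have wc k : (1 <= k <= N)%N -> wA k <= c k N.
  by move=> kN; have /andP[_] := wAle k; rewrite /weight kN.
have wA0 : wA 0%N = 0 by rewrite (wK K00).1.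
have dio := correlation_le_Lstar D n_gt0 cc w0 wA0 wc.
have := block_char AB (ltW M0) w0 w1 wout be_lt sep size dio th dl1 e0 hdl.
have -> : diag_sum D A B N.+1 wA = HA * E (fun x => fourier_sum f D x ^+ 2).
  rewrite fourier_sum_sqr// /diag_sum /HA mulr_suml; apply: eq_bigr => k _.
  congr (_ * _); rewrite big_nat [RHS]big_nat; apply: eq_bigr => j /andP[j0 _].
  by rewrite /A /B j0.
rewrite -/HA; under eq_Rintegral do under eq_bigr do rewrite tpE.
by [].
Qed.

Let h := sum_sqr c N.
Let V := E (fun x => fourier_sum f D x ^+ 2).
Hypotheses (h0 : 0 < h) (hG : HG <= h / s%:R).

(* [eta] is the accuracy of the approximation for this value of N, and [de * h]
   the level at which the fluctuation of the sum of squares is cut.  [e0] and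
   [eD] bound the tails of the squared coefficients beyond 0 and D. *)
Variables (t th eta de e0 eD ep : R).
Let tau := t / (L2norm f * Num.sqrt h).
Let T := t ^+ 2 / E0.
Let Q := (r * s)%:R * (D%:R * M) ^+ 2.

Let tau_sqr : tau ^+ 2 = T / h.
Proof.
rewrite /tau L2normE// exprMn exprVn exprMn !sqr_sqrtr ?(ltW h0) ?(ltW E00)//.
by rewrite /T invfM mulrA.
Qed.

Let T0 : 0 <= T.
Proof. by rewrite divr_ge0 ?sqr_ge0// ltW. Qed.

Let Q0 : 0 <= Q.
Proof. by rewrite mulr_ge0 ?sqr_ge0. Qed.

Let HA0 : 0 <= HA.
Proof. by apply: sumr_ge0 => k _; exact: sqr_ge0. Qed.

Let V01 : E0 - E (fun x => (f x - fourier_sum f D x) ^+ 2) = V.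
Proof. by rewrite /E0 (fourier_sum_norm hf f0 D) addrC addKr. Qed.

Hypotheses (eta0 : 0 < eta) (eta1 : eta <= 1) (de0 : 0 < de).
Hypothesis he0 : forall D', \sum_(1 <= j < D'.+1) j%:R `^ (- (2 * rho)) <= e0.
Hypothesis heD : forall D', \sum_(D.+1 <= j < D'.+1) j%:R `^ (- (2 * rho)) <= eD.
Hypothesis hep : E (fun x => (f x - fourier_sum f D x) ^+ 2) <= ep.
Hypothesis small_remainder :
  8 * (C0 * (e0 / s%:R + eD)) + 2 * (K0%:R ^+ 2 * E0) / h <= eta ^+ 2.
Hypothesis small_variance : s%:R^-1 + K0%:R / h + ep / E0 <= eta.
Hypothesis small_blocks : `|tau| * ((r * s)%:R * (D%:R * M)) <= eta / (Q + 1).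
Hypothesis small_correlation : expR (T * Q / 2) * (T / 2) *
  (de + 2 * (M ^+ 2 * D%:R ^+ 2 * (r * s)%:R *
    (M ^+ 2 * ((2 * Lstar n c N D + (D%:R * (r * s)%:R) ^+ 2) / h))) / de) <= eta.

Lemma char_remainder :
  `|E (fun x => cos (tau * (kept_sum x + remainder x) + th)) -
    E (fun x => cos (tau * kept_sum x + th))| <= eta * (2 * (`|t| / L2norm f)).
Proof.
have sh : 0 < Num.sqrt h by rewrite sqrtr_gt0.
have sE : 0 < L2norm f by rewrite L2normE// sqrtr_gt0.
have mk : measurable_fun setT kept_sum.
  suff /trig_sqint[] : trig (freqs (R := R) setT) kept_sum by [].
  apply: trig_sum => k _; apply: trigZ.
  apply: (@eq_trig _ _ (fun x => \sum_(1 <= j < D.+1)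
     wave (j * n k)%N (fourier_cos f j) (fourier_sin f j) x)).
    by move=> x; apply: eq_bigr => j _; rewrite wave_scale.
  by apply: trig_sum => j _; exact: trig_wave.
have es : 0 < eta * Num.sqrt h by rewrite mulr_gt0.
apply: (le_trans (E_cos_perturb tau th es mk sqint_remainder)).
have hZ : E (fun x => remainder x ^+ 2) <= eta ^+ 2 * h.
  apply: (le_trans (remainder_L2 he0 heD)).
  apply: (@le_trans _ _ ((8 * (C0 * (e0 / s%:R + eD)) + 2 * (K0%:R ^+ 2 * E0) / h) * h)).
    rewrite [leRHS]mulrDl divfK ?gt_eqF// lerD2r -mulrA ler_wpM2l// -mulrA ler_wpM2l //.
    rewrite mulrDl lerD2r.
    have e00 : 0 <= e0 by apply: le_trans (he0 0%N); rewrite big_geq.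
    by rewrite mulrAC -mulrA ler_wpM2l.
  by rewrite ler_wpM2r ?(ltW h0).
have hZ2 : E (fun x => remainder x ^+ 2) / (eta * Num.sqrt h) <= eta * Num.sqrt h.
  rewrite ler_pdivrMr// (le_trans hZ)// -[h in leLHS](sqr_sqrtr (ltW h0)).
  by rewrite -exprMn expr2.
apply: (@le_trans _ _ (`|tau| * (eta * Num.sqrt h + eta * Num.sqrt h))).
  by rewrite ler_wpM2l// lerD2l.
have -> : `|tau| = `|t| / (L2norm f * Num.sqrt h).
  by rewrite /tau normrM normfV [`|_ * _|]gtr0_norm// mulr_gt0.
rewrite le_eqVlt; apply/orP; left; apply/eqP.
by field; rewrite !gt_eqF.
Qed.

Lemma char_kept :
  `|E (fun x => cos (tau * kept_sum x + th)) -
    cos th * expR (- (tau ^+ 2 * (HA * V) / 2))| <= eta * (4 * T + 1).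
Proof.
have Q1 : 0 < Q + 1 by rewrite ltr_wpDl.
have dl1 : eta / (Q + 1) <= 1.
  by rewrite ler_pdivrMr// mul1r (le_trans eta1)// lerDr.
apply: (le_trans (kept_clt th dl1 (mulr_gt0 de0 h0) small_blocks)).
have HAh : HA <= h by exact: kept_sqr_le.
have L0 : 0 <= Lstar n c N D by apply: Lstar_ge0 => k; exact: c_ge0.
have tQ : tau ^+ 2 * (Q * HA) <= T * Q.
  rewrite tau_sqr mulrAC ler_pdivrMr// -[leRHS]mulrA ler_wpM2l// ler_wpM2l//.
rewrite -/Q [leRHS]mulrDr (mulr1 eta); apply: lerD.
  apply: (@le_trans _ _ (4 * (eta / (Q + 1)) * (T * Q))).
    by rewrite ler_wpM2l// mulr_ge0// divr_ge0// ltW.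
  have -> : 4 * (eta / (Q + 1)) * (T * Q) = eta * (4 * T) * (Q / (Q + 1)).
    by field; rewrite gt_eqF.
  have T40 : 0 <= eta * (4 * T) by apply: mulr_ge0; [exact: ltW|exact: mulr_ge0].
  by rewrite ler_piMr// ler_pdivrMr// mul1r lerDl.
apply: le_trans small_correlation.
set A := M ^+ 2 * D%:R ^+ 2 * (r * s)%:R; set B := 2 * Lstar n c N D + _.
have A0 : 0 <= A by apply: mulr_ge0 => //; apply: mulr_ge0; exact: sqr_ge0.
have B0 : 0 <= B by rewrite /B addr_ge0 ?sqr_ge0// mulr_ge0.
have -> : expR (T * Q / 2) * (T / 2) * (de + 2 * (A * (M ^+ 2 * (B / h))) / de) =
   expR (T * Q / 2) * ((T / h / 2) * (de * h + 2 * (A * h * (M ^+ 2 * B)) / (de * h))).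
  by field; rewrite !gt_eqF.
have deh : 0 < de * h by exact: mulr_gt0.
have X0 : 0 <= M ^+ 2 * B by rewrite mulr_ge0 ?sqr_ge0.
have Y0 : 0 <= A * HA * (M ^+ 2 * B) by apply: mulr_ge0 => //; exact: mulr_ge0.
rewrite -mulrA ler_pM ?expR_ge0//.
- by rewrite mulr_ge0 ?divr_ge0 ?sqr_ge0// addr_ge0 ?(ltW deh)// divr_ge0 ?(ltW deh)// mulr_ge0.
- by rewrite ler_expR ler_wpM2r.
have Th0 : 0 <= T / h / 2 by rewrite divr_ge0// divr_ge0// ltW.
rewrite tau_sqr ler_wpM2l// lerD2l ler_wpM2r ?invr_ge0 ?(ltW deh)//.
by rewrite ler_wpM2l// ler_wpM2r// ler_wpM2l.
Qed.

Lemma char_variance :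
  `|cos th * expR (- (tau ^+ 2 * (HA * V) / 2)) - cos th * expR (- (t ^+ 2 / 2))| <=
  eta * (t ^+ 2 / 2).
Proof.
have V0 : 0 <= V by exact: E_sqr_ge0.
have HAh : HA <= h by exact: kept_sqr_le.
have VE : V <= E0 by rewrite -V01 gerBl E_sqr_ge0.
have hHA : h - h / s%:R - K0%:R <= HA.
  apply: le_trans kept_sqr_ge; rewrite -/h -/HG.
  by rewrite lerD2r lerB.
have hV : E0 - ep <= V by rewrite -V01 lerB.
have -> : tau ^+ 2 * (HA * V) / 2 = t ^+ 2 / 2 * (HA / h * (V / E0)).
  by rewrite tau_sqr /T; field; rewrite !gt_eqF.
set x := HA / h; set y := V / E0.
have x0 : 0 <= x by rewrite divr_ge0// ltW.
have y0 : 0 <= y by rewrite divr_ge0// ltW.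
have x1 : x <= 1 by rewrite ler_pdivrMr// mul1r.
have y1 : y <= 1 by rewrite ler_pdivrMr// mul1r.
have hx : 1 - s%:R^-1 - K0%:R / h <= x.
  rewrite ler_pdivlMr// !mulrBl mul1r divfK ?gt_eqF//.
  by move: hHA; rewrite [h / _]mulrC.
have hy : 1 - ep / E0 <= y.
  by rewrite ler_pdivlMr// mulrBl mul1r divfK ?gt_eqF.
have xy : 1 - eta <= x * y by move: small_variance; nra.
have xy0 : 0 <= x * y by exact: mulr_ge0.
have xy1 : x * y <= 1 by rewrite mulr_ile1.
have t20 : 0 <= t ^+ 2 / 2 by rewrite divr_ge0 ?sqr_ge0.
rewrite -mulrBr normrM -[leRHS]mul1r ler_pM//; first by rewrite ler_norml cos_geN1 cos_le1.
apply: (le_trans (expR_lip _ t20)); first exact: mulr_ge0.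
rewrite -[X in _ - X]mulr1 -mulrBr normrM (ger0_norm t20) mulrC ler_wpM2r//.
by rewrite ler_norml; apply/andP; split; lra.
Qed.

(** Three errors: dropping [remainder], the block approximation, and the
    variance lost by truncation, gaps and initial indices. *)
Lemma char_bound :
  `|E (fun x => cos (t * ((\sum_(1 <= k < N.+1) c k N * f ((n k)%:R * x))
        / (L2norm f * Num.sqrt h)) + th)) - cos th * expR (- (t ^+ 2 / 2))| <=
  eta * (2 * (`|t| / L2norm f) + (4 * T + 1) + t ^+ 2 / 2).
Proof.
have -> : E (fun x => cos (t * ((\sum_(1 <= k < N.+1) c k N * f ((n k)%:R * x))
        / (L2norm f * Num.sqrt h)) + th)) =
    E (fun x => cos (tau * (kept_sum x + remainder x) + th)).
  by apply: eq_Rintegral => x _; rewrite array_sum_split /tau; congr (cos (_ + _)); ring.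
have h1 := char_remainder; have h2 := char_kept; have h3 := char_variance.
rewrite !mulrDr.
have tri (x y z w b1 b2 b3 : R) : `|x - y| <= b1 -> `|y - z| <= b2 -> `|z - w| <= b3 ->
    `|x - w| <= b1 + b2 + b3.
  move=> xy yz zw; rewrite -(subrKA z) (le_trans (ler_normD _ _))// lerD//.
  by rewrite -(subrKA y) (le_trans (ler_normD _ _))// lerD.
by have := tri _ _ _ _ _ _ _ h1 h2 h3; rewrite !mulrDr.
Qed.

End fixed.

Hypothesis h_infty : forall A : R, \forall N \near \oo, A <= sum_sqr c N.
Hypothesis Lstar_small : forall D (e : R), (1 <= D)%N -> 0 < e ->
  \forall N \near \oo, Lstar n c N D <= e * sum_sqr c N.

Let X N x := (\sum_(1 <= k < N.+1) c k N * f ((n k)%:R * x))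
  / (L2norm f * Num.sqrt (sum_sqr c N)).

Let e0 : R := 1 + (2 * rho - 1)^-1.

Let he0 D' : \sum_(1 <= j < D'.+1) j%:R `^ (- (2 * rho)) <= e0.
Proof.
have s0 : 0 < 2 * rho - 1 by move: rho_gt; lra.
have s0' : 0 <= (2 * rho - 1)^-1 by rewrite invr_ge0 ltW.
case: D' => [|D']; first by rewrite big_geq// addr_ge0.
rewrite big_ltn// powR1 lerD2l.
have := @powR_tail R _ 1 D'.+1 s0 isT.
by rewrite subrK powR1 mulr1.
Qed.

Let e00 : 0 <= e0.
Proof. by have := he0 0; rewrite big_geq. Qed.

(** With Fourier truncation of order 0 the kept sum is zero, and the whole sum is
    a remainder. *)
Lemma second_moment : exists C : R, \forall N \near \oo,
  (\int[circle R]_x (X N x ^+ 2)%:E <= C%:E)%E.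
Proof.
exists ((16 * (C0 * e0) + 2 * (K0%:R ^+ 2 * E0)) / E0).
apply: filterS2 (nbhs_infty_ge K0) (h_infty 1) => N K0N h1.
have h0 : 0 < sum_sqr c N by exact: lt_le_trans h1.
pose Z := remainder N 0 1 2 0.
have XE : X N = (fun x => (L2norm f * Num.sqrt (sum_sqr c N))^-1 * Z x).
  apply/funext => x; rewrite /X (array_sum_split 0 1 2 0 K0N) /kept_sum big1 ?add0r 1?mulrC//.
  by move=> k _; rewrite /fourier_sum big_nil mulr0.
have hZ : sqint Z by exact: sqint_remainder.
have hX : sqint (X N) by rewrite XE; exact: sqintZ.
rewrite (E_sqr_EFin hX) lee_fin XE.
have -> : E (fun x => ((L2norm f * Num.sqrt (sum_sqr c N))^-1 * Z x) ^+ 2) =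
    (E0 * sum_sqr c N)^-1 * E (fun x => Z x ^+ 2).
  rewrite -RintegralZl//; last by case: hZ.
  apply: eq_Rintegral => x _; rewrite exprMn exprVn exprMn L2normE// !sqr_sqrtr// ltW//.
rewrite invfM -mulrA mulrC ler_wpM2r ?invr_ge0 ?(ltW E00)// ler_pdivrMl//.
have hR := remainder_L2 N (D := 0) 1 2 0 he0 he0.
apply: (le_trans hR).
set G := \sum_(0 <= k < N.+1) _.
have G1 : G <= sum_sqr c N.
  rewrite -weight_sqr; apply: (le_trans (gap_sqr_le _ _ _ _)).
  by apply: ler_sum => k _; rewrite ler_piMr ?sqr_ge0//; case: gap.
have CG : C0 * (e0 * G) <= C0 * (e0 * sum_sqr c N) by rewrite ler_wpM2l// ler_wpM2l.
have KE : K0%:R ^+ 2 * E0 <= sum_sqr c N * (K0%:R ^+ 2 * E0).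
  by rewrite ler_peMl// mulr_ge0 ?sqr_ge0// ltW.
by move: CG KE; lra.
Qed.

(** [D] makes the Fourier tail small, [s] the proportion of indices in gaps, and
    [r] makes the gaps long enough for the degree [D].  The remaining errors
    are constants over [sum_sqr c N], or [Lstar] over [sum_sqr c N], and
    vanish in the limit. *)
Lemma char_cvg (t th : R) :
  E (fun x => cos (t * X N x + th)) @[N --> \oo] --> cos th * expR (- (t ^+ 2 / 2)).
Proof.
apply/cvgrPdist_le => e ep.
have sE : 0 < L2norm f by rewrite L2normE// sqrtr_gt0.
pose T := t ^+ 2 / E0.
have T0 : 0 <= T by rewrite divr_ge0 ?sqr_ge0// ltW.
pose B := 2 * (`|t| / L2norm f) + (4 * T + 1) + t ^+ 2 / 2.
have B0 : 0 < B.
  have t2 : 0 <= t ^+ 2 / 2 by rewrite divr_ge0 ?sqr_ge0.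
  have tn : 0 <= `|t| / L2norm f by rewrite divr_ge0// ltW.
  by rewrite /B; lra.
pose eta := Num.min 1 (e / B).
have eta0 : 0 < eta by rewrite lt_min ltr01 divr_gt0.
have eta1 : eta <= 1 by rewrite ge_min lexx.
have etaB : eta * B <= e by rewrite -ler_pdivlMr// ge_min lexx orbT.
clearbody eta.
pose kap := eta ^+ 2 / (32 * (C0 + 1)).
have C1 : 0 < C0 + 1 by rewrite ltr_wpDl.
have kap0 : 0 < kap by rewrite divr_gt0 ?exprn_gt0// mulr_gt0.
have [D1 _ hD1] := @powR_tail_small R (2 * rho - 1) kap (ltac:(move: rho_gt; lra)) kap0.
have ep0 : 0 < eta * E0 / 3 by rewrite divr_gt0// mulr_gt0.
have [D2 hD2] := fourier_sum_cvg hf f0 fL ep0.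
pose D := (D1 + D2).+1.
have heD D' : \sum_(D.+1 <= j < D'.+1) j%:R `^ (- (2 * rho)) <= kap.
  have := hD1 D D'; rewrite subrK; apply.
  exact: leqW (leq_addr _ _).
have hep : E (fun x => (f x - fourier_sum f D x) ^+ 2) <= eta * E0 / 3.
  by apply: hD2; exact: leqW (leq_addl _ _).
have [s s1 hs] := natr_above (e0 / kap + 3 / eta).
have s0 : 0 < s%:R :> R by rewrite ltr0n ltnW.
have s_tail : e0 / s%:R <= kap.
  rewrite ler_pdivrMr// mulrC -ler_pdivrMr// (le_trans _ hs)// lerDl.
  by rewrite divr_ge0// ltW.
have s_eta : s%:R^-1 <= eta / 3.
  rewrite -[leRHS]invrK lef_pV2 ?posrE ?invr_gt0 ?divr_gt0// invfM invrK mulrC.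
  by rewrite (le_trans _ hs)// lerDr divr_ge0// ltW.
have [r r0 gapD] := gap_exists q1 D.
pose Q := (r * s)%:R * (D%:R * M) ^+ 2.
have Q1 : 0 < Q + 1 by rewrite ltr_wpDl// mulr_ge0 ?sqr_ge0.
pose W := expR (T * Q / 2) * (T / 2).
have W0 : 0 <= W by rewrite mulr_ge0 ?expR_ge0// divr_ge0.
have W1 : 0 < W + 1 by rewrite ltr_wpDl.
pose de := eta / (2 * (W + 1)).
have de0 : 0 < de by rewrite divr_gt0// mulr_gt0.
pose U := W * (2 * (M ^+ 2 * D%:R ^+ 2 * (r * s)%:R * M ^+ 2)) / de.
have U0 : 0 <= U.
  have MD : 0 <= M ^+ 2 * D%:R ^+ 2 :> R by rewrite mulr_ge0 ?sqr_ge0.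
  rewrite divr_ge0 ?(ltW de0)// mulr_ge0// mulr_ge0// mulr_ge0 ?sqr_ge0//.
  exact: mulr_ge0.
have U1 : 0 < U + 1 by rewrite ltr_wpDl.
pose k2 := eta / (8 * (U + 1)).
have k20 : 0 < k2 by rewrite divr_gt0// mulr_gt0.
pose G : R := (D%:R * (r * s)%:R) ^+ 2.
pose A := `|t| / L2norm f * ((r * s)%:R * (D%:R * M)) / (eta / (Q + 1)).
have nA := h_infty (A ^+ 2).
have nK := h_infty (2 * (2 * (K0%:R ^+ 2 * E0)) / eta ^+ 2).
have nK2 := h_infty (3 * K0%:R / eta).
have nG := h_infty (G / k2).
have n1 := h_infty 1.
have nL := Lstar_small (ltn0Sn _ : 1 <= D)%N k20.
near=> N.
have K0N : (K0 <= N)%N by near: N; exact: nbhs_infty_ge.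
have hA : A ^+ 2 <= sum_sqr c N by near: N.
have hK : 2 * (2 * (K0%:R ^+ 2 * E0)) / eta ^+ 2 <= sum_sqr c N by near: N.
have hK2 : 3 * K0%:R / eta <= sum_sqr c N by near: N.
have hG : G / k2 <= sum_sqr c N by near: N.
have h1 : 1 <= sum_sqr c N by near: N.
have hL : Lstar n c N D <= k2 * sum_sqr c N by near: N.
have h0 : 0 < sum_sqr c N by exact: lt_le_trans h1.
have [a _ ha] := gap_choice r N.+1 (weight N) s1.
have hgap : \sum_(0 <= k < N.+1) gap_weight N r s a k ^+ 2 <= sum_sqr c N / s%:R.
  by apply: (le_trans (gap_sqr_le _ _ _ _)); rewrite -weight_sqr.
rewrite distrC; apply: le_trans etaB.
apply: (char_bound r0 s1 gapD K0N h0 hgap th eta0 eta1 de0 he0 heD hep).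
- have h2 : 2 * (K0%:R ^+ 2 * E0) / sum_sqr c N <= eta ^+ 2 / 2.
    rewrite ler_pdivrMr//; move: hK; rewrite ler_pdivrMr ?exprn_gt0//.
    by move: (sum_sqr c N) => h; lra.
  have h3 : C0 * (e0 / s%:R + kap) <= eta ^+ 2 / 16.
    apply: (@le_trans _ _ ((C0 + 1) * (kap + kap))).
      rewrite ler_pM// ?lerDl// ?lerD2r// addr_ge0 ?(ltW kap0)//.
      by rewrite divr_ge0// ltW.
    rewrite le_eqVlt; apply/orP; left; apply/eqP.
    by rewrite /kap; field; rewrite gt_eqF.
  move: h2 h3; lra.
- have h2 : K0%:R / sum_sqr c N <= eta / 3.
    rewrite ler_pdivrMr//; move: hK2; rewrite ler_pdivrMr//.
    by move: (sum_sqr c N) => h; lra.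
  have h3 : eta * E0 / 3 / E0 = eta / 3 by field; rewrite gt_eqF.
  rewrite h3; move: h2 s_eta; lra.
- have sh : 0 < Num.sqrt (sum_sqr c N) by rewrite sqrtr_gt0.
  have A0 : 0 <= A.
    have t0 : 0 <= `|t| / L2norm f by rewrite divr_ge0// ltW.
    have m0 : 0 <= (r * s)%:R * (D%:R * M) :> R by rewrite mulr_ge0// mulr_ge0// ltW.
    have q0 : 0 <= eta / (Q + 1) by rewrite divr_ge0// ltW.
    by apply: divr_ge0 => //; apply: mulr_ge0.
  have hA' : A <= Num.sqrt (sum_sqr c N).
    by rewrite -(ger0_norm A0) -sqrtr_sqr ler_wsqrtr.
  rewrite normrM normfV [`|_ * _|]gtr0_norm ?mulr_gt0//.
  move: hA'; rewrite /A ler_pdivrMr ?divr_gt0// -/Q => hA'.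
  have mv (y : R) : `|t| / (L2norm f * Num.sqrt (sum_sqr c N)) * y =
      `|t| / L2norm f * y / Num.sqrt (sum_sqr c N) by field; rewrite !gt_eqF.
  rewrite mv ler_pdivrMr//; apply: (le_trans hA').
  by rewrite mulrC.
rewrite -/T -/Q -/W -/G.
have -> : W * (de + 2 * (M ^+ 2 * D%:R ^+ 2 * (r * s)%:R *
      (M ^+ 2 * ((2 * Lstar n c N D + G) / sum_sqr c N))) / de) =
    W * de + U * ((2 * Lstar n c N D + G) / sum_sqr c N).
  by rewrite /U; field; rewrite !gt_eqF.
have h2 : W * de <= eta / 2.
  have -> : W * de = eta / 2 * (W / (W + 1)) by rewrite /de; field; rewrite gt_eqF.
  rewrite ler_piMr ?divr_ge0 ?(ltW eta0)// ler_pdivrMr// mul1r lerDl//.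
have h3 : (2 * Lstar n c N D + G) / sum_sqr c N <= 3 * k2.
  rewrite ler_pdivrMr//; move: hG hL; rewrite ler_pdivrMr//.
  by move: (sum_sqr c N) (Lstar n c N D) => h l; lra.
have h4 : U * ((2 * Lstar n c N D + G) / sum_sqr c N) <= eta / 2.
  apply: (@le_trans _ _ (U * (3 * k2))); first by rewrite ler_wpM2l.
  have -> : U * (3 * k2) = eta / 2 * (3 / 4 * (U / (U + 1))).
    by rewrite /k2; field; rewrite gt_eqF.
  have u1 : U / (U + 1) <= 1 by rewrite ler_pdivrMr// mul1r lerDl.
  have e2 : 0 <= eta / 2 by rewrite divr_ge0// ltW.
  by rewrite ler_piMr//; lra.
by move: h2 h4; lra.
Unshelve. all: by end_near.
Qed.

End Assembly.

Theorem theorem2 (R : realType) (n : nat -> nat) (c : nat -> nat -> R)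
  (f : R -> R) (M rho : R)
  (n_gt0 : forall k, (1 <= k)%N -> (0 < n k)%N)
  (n_lacunary : lacunary R n)
  (c_ge0 : forall k N, (1 <= k <= N)%N -> 0 <= c k N)
  (c_le1 : (array_sup c <= 1%:E)%E)
  (h_infty : sum_sqr c N @[N --> \oo] --> +oo)
  (f_periodic : periodic f 1)
  (f_L2 : f \in Lfun (circle R) 2%:E)
  (f_mean0 : \int[circle R]_x f x = 0)
  (f_sqr : (0 < \int[circle R]_x (f x ^+ 2)%:E < +oo)%E)
  (M_gt0 : 0 < M) (rho_gt : 1 / 2 < rho)
  (f_coef : forall j, (1 <= j)%N ->
    `|fourier_cos f j| + `|fourier_sin f j| <= M * (j%:R `^ (- rho)))
  (Lstar_o : forall D, (1 <= D)%N ->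
    (fun N => Lstar n c N D : R^o) =o_\oo (fun N => sum_sqr c N : R^o)) :
  cvg_in_distribution (circle R)
    (fun N x => (\sum_(1 <= k < N.+1) c k N * f ((n k)%:R * x))
                / (L2norm f * Num.sqrt (sum_sqr c N)))
    (normal_prob 0 1).
Proof.
have [q [K0 [q1 K00 nq]]] := lacunary_growth n_gt0 n_lacunary.
have hf := Lfun_sqint f_L2.
have E00 : 0 < \int[circle R]_x (f x ^+ 2).
  by move: f_sqr; rewrite (E_sqr_EFin hf) lte_fin => /andP[].
have c_le1' := array_le1 c_le1.
have h_ge (A : R) : \forall N \near \oo, A <= sum_sqr c N by move/cvgryPge : h_infty; apply.
have L_le D (e : R) : (1 <= D)%N -> 0 < e -> \forall N \near \oo, Lstar n c N D <= e * sum_sqr c N.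
  move=> D1 e0; have /eqoP/(_ e e0) := Lstar_o D D1.
  apply: filterS => N hN; apply: (le_trans (ler_norm _)); apply: (le_trans hN).
  rewrite ger0_norm// /sum_sqr; apply: sumr_ge0 => k _; exact: sqr_ge0.
have [C1 hC1] := second_moment n_gt0 q1 K00 nq c_ge0 c_le1' f_periodic f_L2 f_mean0 M_gt0
  rho_gt f_coef E00 h_ge.
have [C2 hC2] := gaussian_second_moment R.
apply: (@weak_cvg_of_char _ _ R (circle R) (normal_prob 0 1) _ (Num.max C1 C2)).
- move=> N; apply: measurable_funM => //.
  apply: measurable_sum => k; apply: measurable_funM => //.
  by apply: measurable_scale; case: hf.
- by apply: filterS hC1 => N /le_trans; apply; rewrite lee_fin le_max lexx.
- by apply: (le_trans hC2); rewrite lee_fin le_max lexx orbT.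
move=> t th; rewrite gaussian_char.
exact: (char_cvg n_gt0 q1 K00 nq c_ge0 c_le1' f_periodic f_L2 f_mean0 M_gt0
  rho_gt f_coef E00 h_ge L_le).
Qed.
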